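(* Let $\Sigma=(X,\sigma)$ be a singly generated dynamical system. For every ideal $I$ of $C^*(\Sigma)$, the set $Y_I=\{(x,\gamma)\in X\times\mathbb{T}\mid I\subset P_{(x,\gamma)}\}$ is admissible.
   Context: Singly generated dynamical system (SGDS): a pair $\Sigma=(X,\sigma)$ where $X$ is a locally compact Hausdorff space (not assumed second countable) and $\sigma\colon U\to X$ is a local homeomorphism defined on an open subset $U\subset X$. $\mathbb{N}=\{0,1,2,\dots\}$; $\mathbb{T}$ is the unit circle in $\mathbb{C}$. Put $U_0=X$, $U_1=U$, $U_{n+1}=\{x\in U_n\mid \sigma^n(x)\in U\}$; $U_n$ is the domain of $\sigma^n$, and whenever $\sigma^n(x)$ is written it is implicitly assumed that $x\in U_n$. The algebra $C^*(\Sigma)$: for $\xi,\eta\in C_c(U)$ define $\langle\xi,\eta\rangle\in C_c(X)$ by $\langle\xi,\eta\rangle(x)=\sum_{\sigma(y)=x}\overline{\xi(y)}\eta(y)$. $C^*(\Sigma)$ is the universal $C^*$-algebra generated by the images of a $*$-homomorphism $t^0\colon C_0(X)\to C^*(\Sigma)$ and a linear map $t^1\colon C_c(U)\to C^*(\Sigma)$ satisfying (i) $t^1(\xi)^*t^1(\eta)=t^0(\langle\xi,\eta\rangle)$ for $\xi,\eta\in C_c(U)$; (ii) $t^1(\xi)t^1(\eta)^*=t^0(\xi\overline{\eta})$ for $\xi,\eta\in C_c(V)$ whenever $V\subset U$ is open and $\sigma|_V$ is injective. ''Ideal'' means closed two-sided ideal. Representations: for $x_0\in X$, $\mathrm{Orb}(x_0)=\{x\in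 X\mid \sigma^n(x)=\sigma^m(x_0)\text{ for some }n,m\in\mathbb{N}\}$, and $H_{x_0}$ is the Hilbert space with orthonormal basis $\{\delta_x\}_{x\in\mathrm{Orb}(x_0)}$. For $(x_0,\gamma_0)\in X\times\mathbb{T}$, $\pi_{(x_0,\gamma_0)}\colon C^*(\Sigma)\to B(H_{x_0})$ is the $*$-homomorphism determined by $\pi_{(x_0,\gamma_0)}(t^0(f))\delta_x=f(x)\delta_x$ and $\pi_{(x_0,\gamma_0)}(t^1(\xi))\delta_x=\gamma_0\sum_{\sigma(y)=x}\xi(y)\delta_y$. $P_{(x_0,\gamma_0)}=\ker\pi_{(x_0,\gamma_0)}$. Periods: $x\in X$ is periodic if $\sigma^{k+n}(x)=\sigma^k(x)$ for some $k\in\mathbb{N}$, $n\ge1$; then $p(x)$ is the smallest $n\geq 1$ such that $\sigma^{k+n}(x)=\sigma^k(x)$ for some $k$, and $l(x)$ is the smallest $k\in\mathbb{N}$ with $\sigma^{k+p(x)}(x)=\sigma^k(x)$. Otherwise $x$ is aperiodic and $p(x)=l(x)=\infty$. Let $\zeta_n=e^{2\pi i/n}$ for $n\ge 1$. Admissible sets: for $Y\subset X\times\mathbb{T}$ and $x\in X$ put $Y_x=\{\gamma\in\mathbb{T}\mid(x,\gamma)\in Y\}$. $Y$ is admissible if (i) $Y$ is closed in $X\times\mathbb{T}$ (product topology); (ii) $Y_x=Y_{\sigma(x)}$ for all $x\in U$; (iii) whenever $Y_{x_0}\neq\emptyset,\mathbb{T}$, the point $x_0$ is periodic, $\zeta_{p(x_0)}Y_{x_0}=Y_{x_0}$,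 and there is a neighborhood $V$ of $x_0$ such that every $x\in V$ with $l(x)\neq l(x_0)$ satisfies $Y_x=\emptyset$. *)

(* Defs.v *)
From HB Require Import structures.
From mathcomp Require Import all_boot all_order all_algebra sesquilinear complex.
From mathcomp Require Import all_classical all_reals all_analysis.

Set Implicit Arguments.
Unset Strict Implicit.
Unset Printing Implicit Defensive.

Import Order.TTheory GRing.Theory Num.Theory numFieldNormedType.Exports.

Local Open Scope classical_set_scope.
Local Open Scope ring_scope.
Local Open Scope complex_scope.

(** * C*-algebras and Hilbert spaces *)

(* [R[i]] is the field of complex numbers over [R : realType]; its usual
   topology is carried by the alias [R[i]^o].  Norms take values in the
   nonnegative reals of [R[i]].  C*-algebras need not be unital, hence the
   separate product. *)
Record cstarAlgebra (R : realType) : Type := CStarAlgebra {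
  cstar_sort :> completeNormedModType R[i];
  cmul : cstar_sort -> cstar_sort -> cstar_sort;
  cstar : cstar_sort -> cstar_sort;
  cmulA : forall a b c, cmul a (cmul b c) = cmul (cmul a b) c;
  cmulDl : forall a b c, cmul (a + b) c = cmul a c + cmul b c;
  cmulDr : forall a b c, cmul a (b + c) = cmul a b + cmul a c;
  cmulZl : forall (k : R[i]) a b, cmul (k *: a) b = k *: cmul a b;
  cmulZr : forall (k : R[i]) a b, cmul a (k *: b) = k *: cmul a b;
  cstarD : forall a b, cstar (a + b) = cstar a + cstar b;
  cstarZ : forall (k : R[i]) a, cstar (k *: a) = k^* *: cstar a;
  cstarM : forall a b, cstar (cmul a b) = cmul (cstar b) (cstar a);
  cstarK : forall a, cstar (cstar a) = a;
  cnormM : forall a b, `|cmul a b| <= `|a| * `|b|;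
  cnorm_star : forall a, `|cmul (cstar a) a| = `|a| ^+ 2
}.

Record star_hom (R : realType) (A B : cstarAlgebra R) (phi : A -> B) : Prop :=
  StarHom {
  star_homD : forall a b, phi (a + b) = phi a + phi b;
  star_homZ : forall (k : R[i]) a, phi (k *: a) = k *: phi a;
  star_homM : forall a b, phi (cmul a b) = cmul (phi a) (phi b);
  star_hom_star : forall a, phi (cstar a) = cstar (phi a)
}.

Record closed_subspace (R : realType) (E : completeNormedModType R[i])
    (W : set E) : Prop := ClosedSubspace {
  subspace_closed : closed W;
  subspace0 : W 0;
  subspaceD : forall a b, W a -> W b -> W (a + b);
  subspaceZ : forall (k : R[i]) a, W a -> W (k *: a)
}.

Record closed_star_subalgebra (R : realType) (A : cstarAlgebra R) (W : set A) :
    Prop := ClosedStarSubalgebra {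
  subalgebra_subspace : closed_subspace W;
  subalgebraM : forall a b, W a -> W b -> W (cmul a b);
  subalgebra_star : forall a, W a -> W (cstar a)
}.

Record closed_ideal (R : realType) (A : cstarAlgebra R) (I : set A) : Prop :=
  ClosedIdeal {
  closed_ideal_subspace : closed_subspace I;
  closed_idealMl : forall a b, I b -> I (cmul a b);
  closed_idealMr : forall a b, I a -> I (cmul a b)
}.

(* The inner product is linear in its first argument. *)
Record hilbertSpace (R : realType) : Type := HilbertSpace {
  hilbert_sort :> completeNormedModType R[i];
  hdot : {dot hilbert_sort for @Num.conj R[i]};
  hnorm_dot : forall v : hilbert_sort, `|v| ^+ 2 = hdot v v
}.

Definition bounded_operator (R : realType) (H : hilbertSpace R) (T : H -> H) :
    Prop :=
  linear T /\ exists M : R, forall v, `|T v| <= M%:C * `|v|.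

(* *-homomorphisms from [A] to the C*-algebra B(H); the involution of B(H) is
   the Hilbert space adjoint. *)
Record star_representation (R : realType) (A : cstarAlgebra R)
    (H : hilbertSpace R) (rho : A -> H -> H) : Prop := StarRepresentation {
  rep_bounded : forall a, bounded_operator (rho a);
  repD : forall a b v, rho (a + b) v = rho a v + rho b v;
  repZ : forall (k : R[i]) a v, rho (k *: a) v = k *: rho a v;
  repM : forall a b v, rho (cmul a b) v = rho a (rho b v);
  rep_star : forall a u v, hdot H (rho (cstar a) u) v = hdot H u (rho a v)
}.

(* [delta x], for [x] in [O], are pairwise distinct and form an orthonormal
   basis; the values of [delta] outside [O] are irrelevant. *)
Definition orthonormal_basis (R : realType) (H : hilbertSpace R) (X : eqType)
    (O : set X) (delta : X -> H) : Prop :=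
  (forall x y, O x -> O y -> hdot H (delta x) (delta y) = (x == y)%:R) /\
  (forall W : set H, closed_subspace W -> (forall x, O x -> W (delta x)) ->
     W = [set: H]).

(** * Singly generated dynamical systems *)

Definition local_homeomorphism (X : topologicalType) (U : set X)
    (s : X -> X) : Prop :=
  forall x, U x -> exists V : set X,
    [/\ open V, V x, V `<=` U, open (s @` V) &
        exists g : X -> X,
          [/\ {in V, cancel s g}, {within V, continuous s} &
              {within s @` V, continuous g}]].

(* The partial map is a total function [sg_map] that is only meaningful on
   [sg_dom]; nothing below depends on its values elsewhere. *)
Record sgds : Type := SGDS {
  sg_space :> topologicalType;
  sg_locally_compact : locally_compact [set: sg_space];
  sg_hausdorff : hausdorff_space sg_space;
  sg_dom : set sg_space;
  sg_map : sg_space -> sg_space;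
  sg_dom_open : open sg_dom;
  sg_local_homeo : local_homeomorphism sg_dom sg_map
}.

Arguments sg_dom : clear implicits.
Arguments sg_map : clear implicits.

(* The domain U_n of the n-th iterate. *)
Fixpoint sg_iter_dom (S : sgds) (n : nat) : set S :=
  if n is m.+1 then
    [set x | @sg_iter_dom S m x /\ sg_dom S (iter m (sg_map S) x)]
  else [set: S].

Arguments sg_iter_dom : clear implicits.

Definition sg_fiber (S : sgds) (x : S) : set S :=
  [set y | sg_dom S y /\ sg_map S y = x].

Definition orbit_set (S : sgds) (x0 : S) : set S :=
  [set x | exists n m : nat,
     [/\ sg_iter_dom S n x, sg_iter_dom S m x0 &
         iter n (sg_map S) x = iter m (sg_map S) x0]].

(* sigma^(k+n)(x) = sigma^k(x) *)
Definition recurs (S : sgds) (x : S) (k n : nat) : Prop :=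
  sg_iter_dom S (k + n) x /\
  iter (k + n) (sg_map S) x = iter k (sg_map S) x.

Definition sg_periodic (S : sgds) (x : S) : Prop :=
  exists k n : nat, (1 <= n)%N /\ recurs x k n.

Lemma asbool_inhabited (P : set nat) :
  (exists n, P n) -> exists n, `[< P n >].
Proof. by case=> n Pn; exists n; apply/asboolP. Qed.

(* Least element of a set of natural numbers, [None] standing for infinity. *)
Definition least (P : set nat) : option nat :=
  if pselect (exists n, P n) is left h
  then Some (ex_minn (asbool_inhabited h)) else None.

Definition period (S : sgds) (x : S) : option nat :=
  least [set n | (1 <= n)%N /\ exists k, recurs x k n].

Definition preperiod (S : sgds) (x : S) : option nat :=
  if period x is Some p then least [set k | recurs x k p] else None.

(** * The C*-algebra of a singly generated dynamical system *)

Definition C0 (R : realType) (X : topologicalType) : set (X -> R[i]) :=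
  [set f | continuous (f : X -> R[i]^o) /\
     forall e : R, 0 < e -> exists K : set X,
       compact K /\ forall x, ~ K x -> `|f x| < e%:C].

(* Elements of C_c(V), for [V] open, are identified with their extensions by
   zero to the whole (Hausdorff) space. *)
Definition Cc (R : realType) (X : topologicalType) (V : set X) :
    set (X -> R[i]) :=
  [set xi | continuous (xi : X -> R[i]^o) /\
     exists K : set X, [/\ compact K, K `<=` V & forall x, ~ K x -> xi x = 0]].

(* The sum is over a finite support, as the fibers of a local homeomorphism
   are discrete and closed in its domain. *)
Definition Cc_inner (R : realType) (S : sgds) (xi eta : S -> R[i]) : S -> R[i] :=
  fun x => \sum_(y \in sg_fiber x) ((xi y)^* * eta y).

(* The defining relations; [t0] and [t1] are only meaningful on C_0(X) and
   C_c(U) respectively. *)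
Record sgds_relations (R : realType) (S : sgds) (B : cstarAlgebra R)
    (t0 t1 : (S -> R[i]) -> B) : Prop := SgdsRelations {
  t0D : forall f g, C0 f -> C0 g -> t0 (fun x => f x + g x) = t0 f + t0 g;
  t0Z : forall (k : R[i]) f, C0 f -> t0 (fun x => k * f x) = k *: t0 f;
  t0M : forall f g, C0 f -> C0 g ->
    t0 (fun x => f x * g x) = cmul (t0 f) (t0 g);
  t0_star : forall f, C0 f -> t0 (fun x => ((f x)^*)%R) = cstar (t0 f);
  t1D : forall xi eta, Cc (sg_dom S) xi -> Cc (sg_dom S) eta ->
    t1 (fun x => xi x + eta x) = t1 xi + t1 eta;
  t1Z : forall (k : R[i]) xi, Cc (sg_dom S) xi ->
    t1 (fun x => k * xi x) = k *: t1 xi;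
  t1_inner : forall xi eta, Cc (sg_dom S) xi -> Cc (sg_dom S) eta ->
    cmul (cstar (t1 xi)) (t1 eta) = t0 (Cc_inner xi eta);
  t1_outer : forall V : set S, open V -> V `<=` sg_dom S ->
    {in V &, injective (sg_map S)} ->
    forall xi eta, Cc V xi -> Cc V eta ->
      cmul (t1 xi) (cstar (t1 eta)) = t0 (fun x => xi x * (eta x)^*)
}.

(* [(A, t0, t1)] is the universal C*-algebra C*(S) generated by the images of
   [t0] and [t1] subject to the relations above. *)
Record is_sgds_algebra (R : realType) (S : sgds) (A : cstarAlgebra R)
    (t0 t1 : (S -> R[i]) -> A) : Prop := IsSgdsAlgebra {
  sgds_algebra_relations : sgds_relations t0 t1;
  sgds_algebra_generated : forall W : set A, closed_star_subalgebra W ->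
    (forall f, C0 f -> W (t0 f)) ->
    (forall xi, Cc (sg_dom S) xi -> W (t1 xi)) -> W = [set: A];
  sgds_algebra_universal : forall (B : cstarAlgebra R)
    (s0 s1 : (S -> R[i]) -> B), sgds_relations s0 s1 ->
    exists phi : A -> B, [/\ star_hom phi,
      forall f, C0 f -> phi (t0 f) = s0 f &
      forall xi, Cc (sg_dom S) xi -> phi (t1 xi) = s1 xi]
}.

Definition circle (R : realType) : set R[i] := [set z | `|z| = 1].

Arguments circle : clear implicits.

(* [rho] is the representation attached to [(x0, g0)], on a Hilbert space with
   orthonormal basis [delta x], [x] in the orbit of [x0]. *)
Record orbit_representation (R : realType) (S : sgds) (A : cstarAlgebra R)
    (t0 t1 : (S -> R[i]) -> A) (x0 : S) (g0 : R[i]) (H : hilbertSpace R)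
    (delta : S -> H) (rho : A -> H -> H) : Prop := OrbitRepresentation {
  orbit_basis : orthonormal_basis (orbit_set x0) delta;
  orbit_rep : star_representation rho;
  orbit_rep_t0 : forall f x, C0 f -> orbit_set x0 x ->
    rho (t0 f) (delta x) = f x *: delta x;
  orbit_rep_t1 : forall xi x, Cc (sg_dom S) xi -> orbit_set x0 x ->
    rho (t1 xi) (delta x) = g0 *: \sum_(y \in sg_fiber x) (xi y *: delta y)
}.

(* When [(A, t0, t1)] is C*(S) and [g0] lies on the circle, the representation
   attached to [(x0, g0)] exists by universality and is unique up to unitary
   equivalence because [t0] and [t1] generate; so this is its kernel. *)
Definition orbit_kernel (R : realType) (S : sgds) (A : cstarAlgebra R)
    (t0 t1 : (S -> R[i]) -> A) (x0 : S) (g0 : R[i]) : set A :=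
  [set a | forall (H : hilbertSpace R) (delta : S -> H) (rho : A -> H -> H),
     orbit_representation t0 t1 x0 g0 delta rho -> rho a = (fun=> 0)].

Definition ideal_points (R : realType) (S : sgds) (A : cstarAlgebra R)
    (t0 t1 : (S -> R[i]) -> A) (I : set A) : set (S * R[i]) :=
  [set q | circle R q.2 /\ I `<=` orbit_kernel t0 t1 q.1 q.2].

(** * Admissible sets *)

(* exp(2 pi i / n) *)
Definition zeta (R : realType) (n : nat) : R[i] :=
  cos (2 * pi / n%:R) +i* sin (2 * pi / n%:R).

(* [xsection Y x] is the slice Y_x.  Closedness is relative to the subspace
   [setT `*` circle R] of the product of [S] with the complex plane. *)
Record admissible (R : realType) (S : sgds) (Y : set (S * R[i])) : Prop :=
  Admissible {
  admissible_closed : exists Z : set (S * R[i]^o),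
    closed Z /\ Y = Z `&` ([set: S] `*` circle R);
  admissible_invariant : forall x, sg_dom S x ->
    xsection Y x = xsection Y (sg_map S x);
  admissible_periodic : forall x0,
    xsection Y x0 <> set0 -> xsection Y x0 <> circle R ->
    [/\ sg_periodic x0,
        forall p, period x0 = Some p ->
          [set zeta R p * g | g in xsection Y x0] = xsection Y x0 &
        exists V : set S, nbhs x0 V /\
          forall x, V x -> preperiod x <> preperiod x0 ->
            xsection Y x = set0]
}.

(* Main.v *)
(* The three conditions come from one semicontinuity statement about the kernels
   [P_(x, gamma)].  Let [w] be a point with [sigma^p w = w], where [p] generates all
   relations [sigma^n w = sigma^m w] ([p = 0] if there are none).  Suppose that points
   [x] close to [w] and angles [h] are given with [I] contained in [P_(x, h)].  For [y]
   in the orbit of [w] there is a continuous branch [r] of [sigma^-a sigma^b] with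
   [r w = y], and with [b = gamma / h] the averages
   [sum_(j < N) b ^ (deg y + j p) delta_(r (sigma^(j p) x))] in [H_x] transform under the
   generators of C*(Sigma) as the [delta_y] in [H_w] do under [pi_(w, gamma)], up to
   boundary terms bounded independently of [N].  Once the averages have norm at least
   [sqrt N], an element of [I], which acts by zero on [H_x], acts by zero on [H_w].
   The norm bound holds when [h] is close to [gamma], which gives closedness, and for
   every [gamma] when the points [sigma^(j p) x] are distinct, which is the case
   when the preperiod of [x] differs from that of a nearby periodic point.
   Representations at all points [(x, h)] exist by universality, applied to the
   C*-algebra of adjointable operators on [l2 (Orb x)]. *)

Require Import Defs.
From HB Require Import structures.
From mathcomp Require Import all_boot all_order all_algebra sesquilinear complex finmap.
From mathcomp Require Import all_classical all_reals all_analysis.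
From mathcomp Require Import zify ring lra.

Set Implicit Arguments.
Unset Strict Implicit.
Unset Printing Implicit Defensive.

Import Order.TTheory GRing.Theory Num.Theory numFieldNormedType.Exports.

Local Open Scope classical_set_scope.
Local Open Scope ring_scope.
Local Open Scope complex_scope.

(** * Real-valued norms *)

(** Since the space need not be second countable, no sequence is extracted: a length N is fixed
    first, and x is then taken in a neighbourhood of w depending on N. Information passes between
    H_x and H_w through formal combinations of orbit points. For each a in C*(Sigma) and each y, a
    single combination approximates a applied to the vector of y both in H_w and, relative to the
    norm of the averages, in H_x for N large and x close. Averages for different y are orthogonal
    and of equal norm, so the combination has proportional norms in the two spaces: if a kills H_x,
    it is small in H_w too. The elements admitting such combinations form a closed subalgebra, which
    leaves the generators and their adjoints to be checked. Closedness rests on representations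
    being contractive, uniformly in x; this is the purpose of the square roots in C*-algebras. Two
    branches through the same y differ by a power of sigma^p, so replacing one by another only
    shifts an average; this is where the cyclicity of w enters. Other points are moved onto a cyclic
    one by invariance of the slices. Invariance under zeta_p and the aperiodic case involve no
    limit: rescaling the basis by unimodular numbers changes the angle. *)

Section RealNorm.
Variable R : realType.
Implicit Types (V : normedZmodType R[i]) (E : normedModType R[i]).

(** Norms take values in [R[i]], whose order is only partial; the real part makes the total order,
    suprema and [lra] available. *)
Definition rn V (v : V) : R := complex.Re `|v|.

Lemma rnE V (v : V) : `|v| = (rn v)%:C.
Proof. by rewrite /rn RRe_real // ger0_real. Qed.

Lemma rn_ge0 V (v : V) : 0 <= rn v.
Proof. by rewrite -lecR -rnE normr_ge0. Qed.

Lemma rnD V (u v : V) : rn (u + v) <= rn u + rn v.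
Proof. by rewrite -lecR rmorphD /= -!rnE ler_normD. Qed.

Lemma rnN V (v : V) : rn (- v) = rn v.
Proof. by rewrite /rn normrN. Qed.

Lemma rn_sub V (u v : V) : rn (u - v) = rn (v - u).
Proof. by rewrite -rnN opprB. Qed.

Lemma rn_triangle V (w u v : V) : rn (u - v) <= rn (u - w) + rn (w - v).
Proof. by rewrite -[u - v](subrKA w) rnD. Qed.

Lemma rn0 V : rn (0 : V) = 0.
Proof. by rewrite /rn normr0. Qed.

Lemma rn_eq0 V (v : V) : rn v = 0 -> v = 0.
Proof. by move=> h; apply/eqP; rewrite -normr_eq0 rnE h. Qed.

Lemma rn_small V (v : V) : (forall e : R, 0 < e -> rn v <= e) -> v = 0.
Proof.
move=> h; apply: rn_eq0; apply/eqP; rewrite eq_le rn_ge0 andbT.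
by apply/ler_addgt0Pl => e e0; rewrite addr0 h.
Qed.

Lemma rnM (a b : R[i]) : rn (a * b) = rn a * rn b.
Proof. by apply: complexI; rewrite rmorphM /= -!rnE normrM. Qed.

Lemma rnX (a : R[i]) n : rn (a ^+ n) = rn a ^+ n.
Proof. by apply: complexI; rewrite rmorphXn /= -!rnE normrX. Qed.

Lemma rnZ E (k : R[i]) (v : E) : rn (k *: v) = rn k * rn v.
Proof. by apply: complexI; rewrite rmorphM /= -!rnE normrZ. Qed.

Lemma rn_sum V (I : Type) (s : seq I) (P : pred I) (F : I -> V) :
  rn (\sum_(i <- s | P i) F i) <= \sum_(i <- s | P i) rn (F i).
Proof.
elim/big_ind2: _ => [|u a v b ua vb|//]; first by rewrite rn0.
by rewrite (le_trans (rnD _ _)) // lerD.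
Qed.

Lemma rn_conj (a : R[i]) : rn (Num.conj a) = rn a.
Proof. by rewrite /rn norm_conjC. Qed.

Lemma rn_real (r : R) : rn r%:C = `|r|.
Proof. by rewrite /rn normc_def /= expr0n addr0 sqrtr_sqr. Qed.

Lemma rn_sqr (a : R[i]) : (rn a ^+ 2)%:C = a * Num.conj a.
Proof. by rewrite rmorphXn /= -rnE normCK. Qed.

Lemma conjM_conj (a b : R[i]) : Num.conj (Num.conj a * Num.conj b) = a * b.
Proof. by rewrite rmorphM; congr (_ * _); exact: conjCK. Qed.

Lemma rn1 : rn (1 : R[i]) = 1.
Proof. by rewrite /rn normr1. Qed.

Lemma Re_le_rn (a : R[i]) : complex.Re a <= rn a.
Proof.
by rewrite (le_trans (ler_norm _)) // -lecR -rnE normc_ge_Re.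
Qed.

Lemma circleP (g : R[i]) : circle R g <-> rn g = 1.
Proof.
rewrite /circle /= rnE; split=> [h|->//]; exact: (complexI h).
Qed.

Lemma ball_rn E (u v : E) (e : R) : ball u e%:C v <-> rn (u - v) < e.
Proof. by rewrite -ball_normE /ball_ /= rnE ltcR. Qed.

Lemma nbhs_rnP E (u : E) (B : set E) :
  nbhs u B <-> exists2 e : R, 0 < e & forall v, rn (u - v) < e -> B v.
Proof.
split=> [/nbhs_ballP[e /= e0 eB]|[e e0 eB]].
  have eR : e = (complex.Re e)%:C by rewrite RRe_real // gtr0_real.
  exists (complex.Re e); first by rewrite -ltcR -eR.
  by move=> v /ball_rn; rewrite -eR => /eB.
apply/nbhs_ballP; exists e%:C => /=; first by rewrite ltcR.
by move=> v /ball_rn/eB.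
Qed.

Lemma closed_rnP E (W : set E) : closed W <->
  forall u, (forall e : R, 0 < e -> exists2 w, W w & rn (u - w) < e) -> W u.
Proof.
split=> h u hu; apply: h.
  by move=> B /nbhs_rnP[e e0 eB]; have [w Ww /eB] := hu _ e0; exists w.
move=> e e0; have [|w [Ww ?]] := hu [set w | rn (u - w) < e].
  by apply/nbhs_rnP; exists e.
by exists w.
Qed.

Lemma cvg_rnP E (F : set_system E) (FF : Filter F) (l : E) :
  F --> l <-> forall e : R, 0 < e -> F [set v | rn (l - v) < e].
Proof.
split=> [h e e0|h B /nbhs_rnP[e e0 eB]].
  by apply: h; apply/nbhs_rnP; exists e.
by apply: filterS (h _ e0) => v /eB.
Qed.

Lemma cauchy_rnP E (F : set_system E) (FF : ProperFilter F) :
  cauchy F <-> forall e : R, 0 < e -> exists u, F [set v | rn (u - v) < e].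
Proof.
rewrite cauchyP; split=> [h e e0|h e e0].
  have [|u hu] := h e%:C; first by rewrite ltcR.
  by exists u; apply: filterS hu => v /ball_rn.
have eR : e = (complex.Re e)%:C by rewrite RRe_real // gtr0_real.
have [|u hu] := h (complex.Re e); first by rewrite -ltcR -eR.
by exists u; rewrite eR; apply: filterS hu => v /ball_rn.
Qed.

Lemma continuous_rnP (X : topologicalType) E (f : X -> E) x :
  {for x, continuous f} <->
  forall e : R, 0 < e -> \forall y \near x, rn (f x - f y) < e.
Proof.
split=> [h e e0|h B /nbhs_rnP[e e0 eB]].
  by apply: (h [set v | rn (f x - v) < e]); apply/nbhs_rnP; exists e.
by apply: filterS (h _ e0) => v /eB.
Qed.

Lemma geometric_cauchy (E : completeNormedModType R[i]) (u : nat -> E) (C r : R) :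
  0 <= r < 1 -> (forall n, rn (u n.+1 - u n) <= C * r ^+ n) ->
  exists l, forall e : R, 0 < e -> \forall n \near \oo, rn (l - u n) < e.
Proof.
move=> /andP[r0 r1] hu.
have C0 : 0 <= C by have := le_trans (rn_ge0 _) (hu 0%N); rewrite expr0 mulr1.
have gt1r : 0 < 1 - r by rewrite subr_gt0.
have est n k : rn (u (n + k)%N - u n) <= C * r ^+ n / (1 - r).
  have : rn (u (n + k)%N - u n) <= C * r ^+ n * (1 - r ^+ k) / (1 - r).
    elim: k => [|k ih]; first by rewrite addn0 subrr rn0 expr0 subrr mulr0 mul0r.
    rewrite addnS (le_trans (rn_triangle (u (n + k)%N) _ _)) //.
    apply: le_trans (lerD (hu _) ih) _.
    rewrite le_eqVlt; apply/orP; left; apply/eqP; rewrite exprD exprS.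
    by field; rewrite gt_eqF.
  move/le_trans; apply; rewrite ler_pM2r ?invr_gt0 // ler_piMr //.
    by rewrite mulr_ge0 // exprn_ge0.
  by rewrite gerBl exprn_ge0.
have lim0 e : 0 < e -> \forall n \near \oo, C * r ^+ n / (1 - r) < e.
  move=> e0.
  have : (fun n => C * r ^+ n / (1 - r)) @ \oo --> C * 0 / (1 - r).
    apply: cvgMl; apply: cvgMr.
    by apply: cvg_expr; rewrite ger0_norm.
  rewrite mulr0 mul0r => /cvgrPdist_lt/(_ e e0); apply: filterS => n.
  by rewrite sub0r normrN; apply: le_lt_trans; rewrite ler_norm.
have /cauchy_cvg/cvg_ex[l /cvg_rnP hl] : cauchy (u @ \oo).
  apply/cauchy_rnP => e e0; have [N _ hN] := lim0 _ e0.
  exists (u N); exists N => // n /= Nn.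
  rewrite rn_sub -(subnKC Nn); apply: le_lt_trans (est _ _) (hN N _) => /=; exact: leqnn.
by exists l => e e0; exact: hl.
Qed.

End RealNorm.

(** * Hilbert spaces and contractivity of representations *)

Section Hilbert.
Variables (R : realType) (H : hilbertSpace R).
Implicit Types u v w : H.
Local Notation "''[' u , v ]" := (hdot H u%R v%R).

Lemma dotDl u v w : '[u + v, w] = '[u, w] + '[v, w].
Proof. exact: linearDl. Qed.
Lemma dotDr u v w : '[u, v + w] = '[u, v] + '[u, w].
Proof. exact: linearDr. Qed.
Lemma dotZl k u v : '[k *: u, v] = k * '[u, v].
Proof. exact: linearZl_LR. Qed.
Lemma dotZr k u v : '[u, k *: v] = Num.conj k * '[u, v].
Proof. exact: linearZr_LR. Qed.
Lemma dotBl u v w : '[u - v, w] = '[u, w] - '[v, w].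
Proof. exact: linearBl. Qed.
Lemma dotBr u v w : '[u, v - w] = '[u, v] - '[u, w].
Proof. exact: linearBr. Qed.
Lemma dot0l v : '[0, v] = 0.
Proof. exact: linear0l. Qed.
Lemma dot0r v : '[v, 0] = 0.
Proof. exact: linear0r. Qed.
Lemma dotC u v : '[u, v] = Num.conj '[v, u].
Proof. by rewrite hermC expr0 mul1r. Qed.
Lemma dot_suml (I : Type) (s : seq I) (P : pred I) (F : I -> H) v :
  '[\sum_(i <- s | P i) F i, v] = \sum_(i <- s | P i) '[F i, v].
Proof. exact: linear_sumlz. Qed.
Lemma dot_sumr (I : Type) (s : seq I) (P : pred I) (F : I -> H) v :
  '[v, \sum_(i <- s | P i) F i] = \sum_(i <- s | P i) '[v, F i].
Proof. exact: linear_sumr. Qed.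

Lemma dot_rn v : '[v, v] = (rn v ^+ 2)%:C.
Proof. by rewrite -hnorm_dot rnE rmorphXn. Qed.

Lemma rn_sqrE v : rn v ^+ 2 = complex.Re '[v, v].
Proof. by rewrite dot_rn. Qed.

Lemma dot_eq0 v : '[v, v] = 0 -> v = 0.
Proof.
rewrite dot_rn => /(congr1 (@complex.Re R)) /= /eqP.
by rewrite sqrf_eq0 => /eqP; exact: rn_eq0.
Qed.

Lemma rn_sqrB u v :
  rn (u - v) ^+ 2 = rn u ^+ 2 + rn v ^+ 2 - 2 * complex.Re '[u, v].
Proof.
rewrite !rn_sqrE dotBl !dotBr (dotC v u) !raddfB /=.
case: '[u, v] => a b /=; ring.
Qed.

Lemma Cauchy_Schwarz u v : rn '[u, v] <= rn u * rn v.
Proof.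
have [->|v0] := eqVneq v 0; first by rewrite dot0r !rn0 mulr0.
have nv0 : 0 < rn v by rewrite lt_neqAle rn_ge0 andbT eq_sym;
  apply: contra_neq v0 => /rn_eq0.
(* [k *: v] is the projection of [u] to the line of [v]; the inequality is the expansion of
   [0 <= rn (u - k *: v) ^+ 2]. *)
pose k := '[u, v] / (rn v ^+ 2)%:C.
have := sqr_ge0 (rn (u - k *: v)).
rewrite rn_sqrB rnZ dotZr exprMn.
have nk : rn k = rn '[u, v] / rn v ^+ 2.
  rewrite /k rnM; congr (_ * _); apply: complexI.
  by rewrite -rnE normfV rnE rn_real ger0_norm ?sqr_ge0 // fmorphV.
have -> : complex.Re (Num.conj k * '[u, v]) = rn '[u, v] ^+ 2 / rn v ^+ 2.
  apply: complexI; rewrite /k rmorphM fmorphV /=.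
  have -> : Num.conj (rn v ^+ 2)%:C = (rn v ^+ 2)%:C by rewrite conj_Creal // ger0_real
    // lecR sqr_ge0.
  rewrite mulrAC mulrC -(mulrC '[u, v]) mulrC -rn_sqr -fmorphV -rmorphM /=.
  by [].
rewrite nk.
have -> : rn u ^+ 2 + (rn '[u, v] / rn v ^+ 2) ^+ 2 * rn v ^+ 2 -
  2 * (rn '[u, v] ^+ 2 / rn v ^+ 2) = rn u ^+ 2 - rn '[u, v] ^+ 2 / rn v ^+ 2.
  by field; rewrite gt_eqF.
rewrite subr_ge0 ler_pdivrMr ?exprn_gt0 // -exprMn.
by rewrite ler_pXn2r // nnegrE ?mulr_ge0 ?rn_ge0.
Qed.

Lemma ortho_closed_subspace v : closed_subspace [set u | '[u, v] = 0].
Proof.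
split=> /=.
- apply/closed_rnP => u hu /=; apply: rn_small => e e0.
  have [|w /= w0 uw] := hu (e / (rn v + 1)).
    by rewrite divr_gt0 // ltr_wpDl ?rn_ge0.
  have -> : '[u, v] = '[u - w, v] by rewrite dotBl w0 subr0.
  rewrite (le_trans (Cauchy_Schwarz _ _)) //.
  rewrite (le_trans (ler_wpM2r (rn_ge0 _) (ltW uw))) // -mulrA ler_piMr ?(ltW e0) //.
  by rewrite mulrC ler_pdivrMr ?ltr_wpDl ?rn_ge0 // mul1r lerDl.
- exact: dot0l.
- by move=> a b a0 b0; rewrite dotDl a0 b0 addr0.
- by move=> k a a0; rewrite dotZl a0 mulr0.
Qed.

(** Totality of a basis is phrased with closed subspaces; applied to the orthogonal complement of
    [u - v], it shows that [u - v] is orthogonal to itself. *)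
Lemma orthonormal_basis_ext (X : eqType) (O : set X) (delta : X -> H) u v :
  orthonormal_basis O delta -> (forall x, O x -> '[delta x, u] = '[delta x, v]) ->
  u = v.
Proof.
move=> [_ tot] huv; apply/eqP; rewrite -subr_eq0; apply/eqP; apply: dot_eq0.
have /(congr1 (fun W => W (u - v))) /= : [set w | '[w, u - v] = 0] = [set: H].
  apply: tot; first exact: ortho_closed_subspace.
  by move=> x Ox /=; rewrite dotBr huv // subrr.
by move=> ->.
Qed.
End Hilbert.

(** * C*-algebras: isometric involution, square roots, contractivity of representations *)

Section Contractive.
Variables (R : realType) (A : cstarAlgebra R).
Implicit Types a b : A.

Lemma rn_cmul a b : rn (cmul a b) <= rn a * rn b.
Proof. by rewrite -lecR rmorphM /= -!rnE cnormM. Qed.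

Lemma rn_cstar_mul a : rn (cmul (cstar a) a) = rn a ^+ 2.
Proof. by apply: complexI; rewrite -rnE cnorm_star rnE rmorphXn. Qed.

(** Cancelling [rn b] in [rn b ^+ 2 = rn (cmul (cstar b) b) <= rn (cstar b) * rn b] gives one
    inequality, and [cstarK] turns it into the other. *)
Lemma rn_cstar a : rn (cstar a) = rn a.
Proof.
have le b : rn b <= rn (cstar b).
  have [->|b0] := eqVneq b 0; first by rewrite rn0 rn_ge0.
  have nb0 : 0 < rn b by rewrite lt_neqAle rn_ge0 andbT eq_sym;
    apply: contra_neq b0 => /rn_eq0.
  by rewrite -(ler_pM2r nb0) -expr2 -rn_cstar_mul rn_cmul.
by apply/eqP; rewrite eq_le le -{2}(cstarK a) le.
Qed.

Lemma cstarN a : cstar (- a) = - cstar a.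
Proof. by rewrite -scaleN1r cstarZ rmorphN1 scaleN1r. Qed.

Lemma cmulNl a b : cmul (- a) b = - cmul a b.
Proof. by rewrite -scaleN1r cmulZl scaleN1r. Qed.

Lemma cmulNr a b : cmul a (- b) = - cmul a b.
Proof. by rewrite -scaleN1r cmulZr scaleN1r. Qed.

(* The contraction [b |-> (h + b^2) / 2] has the fixed point [b = 1 - sqrt (1 - h)]. *)
Lemma cstar_sqrt (h : A) : cstar h = h -> rn h < 1 ->
  exists2 b, cstar b = b & b + b = h + cmul b b.
Proof.
move=> hs h1.
pose u := fix u n := if n is m.+1 then (2^-1 : R[i]) *: (h + cmul (u m) (u m)) else 0.
(* The ball of radius [r] is stable, because [(rn h + r ^+ 2) / 2 <= (rn h + 1) / 2 = r], and on it
   the map contracts by the factor [r]. *)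
pose r := (rn h + 1) / 2.
have n2 : rn (2^-1 : R[i]) = 2^-1.
  by rewrite (_ : 2^-1 = (2^-1)%:C) ?rn_real ?ger0_norm // fmorphV rmorph_nat.
have r01 : 0 <= r < 1.
  by rewrite /r divr_ge0 ?addr_ge0 ?rn_ge0 //= ltr_pdivrMr // mul1r; lra.
case/andP: (r01) => r0 r1.
have ur n : rn (u n) <= r.
  elim: n => [|n ih] /=; first by rewrite rn0.
  rewrite rnZ n2 (le_trans (ler_wpM2l _ (rnD _ _))) ?invr_ge0 // /r mulrC.
  rewrite ler_pM2r ?invr_gt0 // lerD2l (le_trans (rn_cmul _ _)) //.
  by rewrite -[leRHS](mulr1 1) ler_pM ?rn_ge0 // (le_trans ih) // ltW.
have ul n : rn (u n.+1 - u n) <= rn (u 1%N) * r ^+ n.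
  elim: n => [|n ih]; first by rewrite subr0 expr0 mulr1.
  (* A difference of squares without commutativity: x^2 - y^2 = x (x - y) + (x - y) y. *)
  have -> : u n.+2 - u n.+1 = (2^-1 : R[i]) *: (cmul (u n.+1) (u n.+1 - u n) +
     cmul (u n.+1 - u n) (u n)).
    rewrite [u n.+2]/= -/(u n.+1) {2}[u n.+1]/= -scalerBr; congr (_ *: _).
    rewrite cmulDr cmulDl cmulNl cmulNr subrKA opprD addrACA subrr add0r.
    by [].
  rewrite rnZ n2 mulrC ler_pdivrMr // (le_trans (rnD _ _)) //.
  have -> : rn (u 1%N) * r ^+ n.+1 * 2 = r * (rn (u 1%N) * r ^+ n) + (rn (u 1%N) * r ^+
    n) * r.
    by rewrite exprS; ring.
  by rewrite lerD // (le_trans (rn_cmul _ _)) // ler_pM ?rn_ge0.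
have [b hb] := geometric_cauchy r01 ul.
have br : rn b <= r.
  apply/ler_addgt0Pl => e e0; have [N _ /(_ N (leqnn N)) /= bN] := hb _ e0.
  rewrite -[b](subrK (u N)) (le_trans (rnD _ _)) // lerD ?ur // ltW //.
have small e : 0 < e -> exists n, rn (b - u n) < e /\ rn (b - u n.+1) < e.
  by move=> e0; have [N _ hN] := hb _ e0; exists N; split; apply: hN => /=.
exists b.
  apply/eqP; rewrite -subr_eq0; apply/eqP; apply: rn_small => e e0.
  have us n : cstar (u n) = u n.
    elim: n => [|n ih] /=; first by rewrite -(scale0r 0) cstarZ rmorph0 !scale0r.
    rewrite cstarZ cstarD cstarM hs ih; congr (_ *: _).
    by rewrite rmorphV ?unitfE ?pnatr_eq0 // rmorph_nat.
  have [|n [bn _]] := small (e / 2); first by rewrite divr_gt0.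
  rewrite (le_trans (rn_triangle (u n) _ _)) // -{1}(us n) -cstarN -cstarD rn_cstar.
  by rewrite (rn_sub (u n)); lra.
apply/eqP; rewrite -subr_eq0; apply/eqP; apply: rn_small => e e0.
(* A quarter of [e] for each of the four error terms, two from [b + b] and two from [cmul b b]. *)
have [|n [bn bn1]] := small (e / 4); first by rewrite divr_gt0.
have E : u n.+1 + u n.+1 = h + cmul (u n) (u n).
  have half2 : 2^-1 + 2^-1 = 1 :> R[i] by field.
  by rewrite /= -scalerDl half2 scale1r.
have -> : b + b - (h + cmul b b) = (b - u n.+1) + (b - u n.+1) -
   (cmul b (b - u n) + cmul (b - u n) (u n)).
  rewrite addrACA -opprD E cmulDr cmulDl cmulNl cmulNr subrKA.
  by rewrite -[RHS]addrA -opprD addrACA subrr addr0.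
rewrite (le_trans (rnD _ _)) // rnN.
have h1' := rnD (b - u n.+1) (b - u n.+1).
have h2 := rnD (cmul b (b - u n)) (cmul (b - u n) (u n)).
have h3 : rn (cmul b (b - u n)) <= rn (b - u n).
  by rewrite (le_trans (rn_cmul _ _)) // ler_piMl ?rn_ge0 // (le_trans br) // ltW.
have h4 : rn (cmul (b - u n) (u n)) <= rn (b - u n).
  by rewrite (le_trans (rn_cmul _ _)) // ler_piMr ?rn_ge0 // (le_trans (ur _)) // ltW.
lra.
Qed.

(* With [1 - a^* a = (1 - b)^2] one has [|v|^2 - |rho(a) v|^2 = |v - rho(b) v|^2]. *)
Lemma rep_contractive (H : hilbertSpace R) (rho : A -> H -> H) :
  star_representation rho -> forall a v, rn (rho a v) <= rn a * rn v.
Proof.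
move=> hr.
have lt1 a v : rn a < 1 -> rn (rho a v) <= rn v.
  move=> a1.
  have [||b bs bb] := @cstar_sqrt (cmul (cstar a) a).
  - by rewrite cstarM cstarK.
  - by rewrite rn_cstar_mul expr_lt1 ?rn_ge0.
  have : rn v ^+ 2 - rn (rho a v) ^+ 2 = rn (v - rho b v) ^+ 2.
    rewrite rn_sqrB !rn_sqrE -[in LHS](rep_star hr) -(repM hr).
    rewrite -(rep_star hr) bs -(repM hr).
    have -> : complex.Re (hdot H v (rho b v)) = complex.Re (hdot H (rho b v) v).
      by rewrite dotC; case: (hdot H _ _).
    have := congr1 (fun c => complex.Re (hdot H (rho c v) v)) bb.
    rewrite /= !(repD hr) !dotDl !raddfD /=; lra.
  move=> E; rewrite -(@ler_pXn2r _ 2) ?nnegrE ?rn_ge0 //.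
  by rewrite -subr_ge0 E sqr_ge0.
move=> a v; apply/ler_addgt0Pl => e e0.
(* Slightly above [rn a], so that [lt1] applies to [a] divided by [t]; the excess costs at most [e],
   since [rn v / (rn v + 1) <= 1]. *)
pose t := rn a + e / (rn v + 1).
have v1 : 0 < rn v + 1 by rewrite ltr_wpDl ?rn_ge0.
have t0 : 0 < t by rewrite ltr_wpDl ?rn_ge0 // divr_gt0.
have tn : rn t%:C = t by rewrite rn_real gtr0_norm.
have ta : rn (t^-1%:C *: a) < 1.
  rewrite rnZ rn_real ger0_norm ?invr_ge0 ?(ltW t0) // ltr_pdivrMl // mulr1.
  by rewrite /t ltrDl divr_gt0.
have := lt1 _ v ta.
rewrite (repZ hr) rnZ rn_real ger0_norm ?invr_ge0 ?(ltW t0) // ler_pdivrMl //.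
move/le_trans; apply; rewrite /t mulrDl addrC lerD2r -mulrA ler_piMr ?(ltW e0) //.
by rewrite mulrC ler_pdivrMr // mul1r lerDl.
Qed.

End Contractive.

Section RepLinear.
Variables (R : realType) (A : cstarAlgebra R) (H : hilbertSpace R) (rho : A -> H -> H).
Hypothesis hr : star_representation rho.

Lemma repLD a v w : rho a (v + w) = rho a v + rho a w.
Proof. by have [l _] := rep_bounded hr a; have := l 1 v w; rewrite !scale1r. Qed.

Lemma repL0 a : rho a 0 = 0.
Proof.
have := repLD a 0 0; rewrite addr0 => /(congr1 (fun z => z - rho a 0)).
by rewrite subrr addrK.
Qed.

Lemma repLZ a k v : rho a (k *: v) = k *: rho a v.
Proof. by have [l _] := rep_bounded hr a; have := l k v 0; rewrite repL0 !addr0. Qed.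

Lemma repLB a v w : rho a (v - w) = rho a v - rho a w.
Proof. by rewrite repLD -[- w]scaleN1r repLZ scaleN1r. Qed.

Lemma repLsum a (J : Type) (l : seq J) (v : J -> H) :
  rho a (\sum_(j <- l) v j) = \sum_(j <- l) rho a (v j).
Proof. by elim: l => [|j l ih]; rewrite ?big_nil ?repL0 // !big_cons repLD ih. Qed.

(** The null space of [rho a] is a closed subspace, by contractivity, and it contains a basis. *)
Lemma rep_basis_eq0 (X : eqType) (O : set X) (delta : X -> H) a :
  orthonormal_basis O delta -> (forall x, O x -> rho a (delta x) = 0) -> rho a = (fun=> 0).
Proof.
move=> [_ tot] h; apply/funext => v.
suff E : [set w | rho a w = 0] = [set: H].
  by have : [set: H] v by []; rewrite -E.
apply: tot => //; split.
- apply/closed_rnP => u hu /=; apply: rn_small => e e0.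
  have a1 : 0 < rn a + 1 by rewrite ltr_wpDl ?rn_ge0.
  have [|w /= w0 uw] := hu (e / (rn a + 1)); first by rewrite divr_gt0.
  rewrite -[u](subrK w) repLD w0 addr0 (le_trans (rep_contractive hr _ _)) //.
  apply: (@le_trans _ _ ((rn a + 1) * rn (u - w))).
    by rewrite ler_wpM2r ?rn_ge0 // lerDl.
  by rewrite -ler_pdivlMl // mulrC ltW.
- exact: repL0.
- by move=> b c /= b0 c0; rewrite repLD b0 c0 addr0.
- by move=> k b /= b0; rewrite repLZ b0 scaler0.
Qed.

End RepLinear.

(** * The Hilbert space of square summable functions *)

Section SquareSummable.
Variables (R : realType) (X : choiceType).
Implicit Types (f g : X -> R[i]) (E : {fset X}).

(** Finite subsets replace enumerations, as an orbit may be uncountable when the space is not second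
    countable. *)
Definition sqsum f E : R := \sum_(x <- E) rn (f x) ^+ 2.

Definition sqsummable f := exists M, forall E, sqsum f E <= M.

Definition sqnorm f : R := sup (range (sqsum f)).

Lemma sqsum_ge0 f E : 0 <= sqsum f E.
Proof. by apply: sumr_ge0 => x _; exact: sqr_ge0. Qed.

Lemma sqsum_mono f E E' : (E `<=` E')%fset -> sqsum f E <= sqsum f E'.
Proof.
move=> EE'; rewrite /sqsum [leRHS](big_fsetID _ (mem E)) /=.
have -> : [fset x in E' | x \in E]%fset = E.
  apply/fsetP => x; rewrite !inE /=; case: (boolP (x \in E)) => // xE;
    last by rewrite andbF.
  by rewrite (fsubsetP EE').
by rewrite lerDl; apply: sumr_ge0 => x _; exact: sqr_ge0.
Qed.

Lemma sqsum_le_sqnorm f E : sqsummable f -> sqsum f E <= sqnorm f.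
Proof.
move=> [M hM]; apply: ub_le_sup; last by exists E.
by exists M => _ [E' _ <-].
Qed.

Lemma sqnorm_le f M : (forall E, sqsum f E <= M) -> sqnorm f <= M.
Proof. by move=> h; apply: ge_sup; [exists (sqsum f fset0), fset0 | move=> _ [E _ <-]]. Qed.

Lemma sqnorm_ge0 f : sqsummable f -> 0 <= sqnorm f.
Proof. by move=> hf; apply: le_trans (sqsum_ge0 f fset0) (sqsum_le_sqnorm _ hf). Qed.

Lemma sqnorm_approx f e : sqsummable f -> 0 < e -> exists E, sqnorm f - e < sqsum f E.
Proof.
move=> [M hM] e0.
have hs : has_sup (range (sqsum f)).
  by split; [exists (sqsum f fset0), fset0 | exists M => _ [E' _ <-]].
by have [_ [E _ <-] hE] := sup_adherent e0 hs; exists E.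
Qed.

Lemma sqr_rn_le_sqnorm f x : sqsummable f -> rn (f x) ^+ 2 <= sqnorm f.
Proof.
move=> hf; apply: le_trans (sqsum_le_sqnorm [fset x]%fset hf).
by rewrite /sqsum big_seq_fset1.
Qed.

(* [(a + b)^2 <= (1 + t) a^2 + (1 + 1/t) b^2]; the best [t] yields Minkowski. *)
Lemma sqsum_add f g E t : 0 < t ->
  sqsum (fun x => f x + g x) E <= (1 + t) * sqsum f E + (1 + t^-1) * sqsum g E.
Proof.
move=> t0; rewrite /sqsum !mulr_sumr -big_split /=; apply: ler_sum => x _.
have h := rnD (f x) (g x).
set a := rn (f x) in h *; set b := rn (g x) in h *.
have a0 : 0 <= a by exact: rn_ge0.
have b0 : 0 <= b by exact: rn_ge0.
apply: (@le_trans _ _ ((a + b) ^+ 2)).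
  by rewrite ler_pXn2r // ?nnegrE ?rn_ge0 ?addr_ge0.
rewrite -subr_ge0.
have -> : (1 + t) * a ^+ 2 + (1 + t^-1) * b ^+ 2 - (a + b) ^+ 2 = (t * a - b) ^+ 2 / t.
  by field; rewrite gt_eqF.
by rewrite divr_ge0 ?sqr_ge0 // ltW.
Qed.

Lemma sqsummableD f g : sqsummable f -> sqsummable g -> sqsummable (fun x => f x + g x).
Proof.
move=> [M hM] [N hN]; exists ((1 + 1) * M + (1 + 1^-1) * N) => E.
apply: le_trans (sqsum_add _ _ _ ltr01) _.
by rewrite lerD // ler_wpM2l ?addr_ge0 ?invr_ge0.
Qed.

Lemma sqnorm_add f g t : sqsummable f -> sqsummable g -> 0 < t ->
  sqnorm (fun x => f x + g x) <= (1 + t) * sqnorm f + (1 + t^-1) * sqnorm g.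
Proof.
move=> hf hg t0; apply: sqnorm_le => E; apply: le_trans (sqsum_add _ _ _ t0) _.
by rewrite lerD // ler_wpM2l ?addr_ge0 ?invr_ge0 ?(ltW t0) // sqsum_le_sqnorm.
Qed.

Lemma sqsumZ f k E : sqsum (fun x => k * f x) E = rn k ^+ 2 * sqsum f E.
Proof.
by rewrite /sqsum mulr_sumr; apply: eq_bigr => x _; rewrite rnM exprMn.
Qed.

Lemma sqsummableZ f k : sqsummable f -> sqsummable (fun x => k * f x).
Proof.
move=> [M hM]; exists (rn k ^+ 2 * M) => E.
by rewrite sqsumZ ler_wpM2l ?sqr_ge0.
Qed.

Lemma sqnormZ_le f k : sqsummable f -> sqnorm (fun x => k * f x) <= rn k ^+ 2 * sqnorm f.
Proof.
by move=> hf; apply: sqnorm_le => E; rewrite sqsumZ ler_wpM2l ?sqr_ge0 ?sqsum_le_sqnorm.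
Qed.

Lemma sqnormZ f k : sqsummable f -> sqnorm (fun x => k * f x) = rn k ^+ 2 * sqnorm f.
Proof.
move=> hf; apply/eqP; rewrite eq_le sqnormZ_le //=.
have [->|k0] := eqVneq k 0.
  by rewrite rn0 expr0n mul0r sqnorm_ge0 //; apply: sqsummableZ.
have nk : 0 < rn k ^+ 2.
  by rewrite exprn_gt0 // lt_neqAle rn_ge0 andbT eq_sym; apply: contra_neq k0 => /rn_eq0.
rewrite -ler_pdivlMl //; have := sqnormZ_le k^-1 (sqsummableZ k hf).
rewrite (_ : (fun x => _) = f); last by apply/funext => x; rewrite mulrA mulVf // mul1r.
by rewrite (_ : rn k^-1 = (rn k)^-1) ?exprVn //; apply: complexI;
  rewrite -rnE normfV rnE fmorphV.
Qed.

Definition fin_net : set_system {fset X} :=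
  [set B | exists E0, forall E, (E0 `<=` E)%fset -> B E].

#[global] Instance fin_net_filter : ProperFilter fin_net.
Proof.
split.
  by move=> [E0 /(_ E0)]; apply.
split.
- by exists fset0.
- move=> P Q [E1 h1] [E2 h2]; exists (E1 `|` E2)%fset => E;
  rewrite fsubUset => /andP[e1 e2].
  by split; [exact: h1|exact: h2].
- by move=> P Q PQ [E1 h1]; exists E1 => E /h1/PQ.
Qed.

Lemma sqnorm_cvg f : sqsummable f ->
  (fun E => (sqsum f E)%:C : R[i]^o) @ fin_net --> ((sqnorm f)%:C : R[i]^o).
Proof.
move=> hf; apply/cvg_rnP => e e0; have [E0 hE0] := sqnorm_approx hf e0.
exists E0 => E /(sqsum_mono f) EE; have := sqsum_le_sqnorm E hf.
move=> h /=; rewrite -rmorphB rn_real ger0_norm ?subr_ge0 //.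
by lra.
Qed.

(* The inner product by polarization, so that its convergence reduces to that of sums of
   squares. *)
Definition polar f g : R[i] := 4^-1 * \sum_(k < 4)
  'i%C ^+ k * (sqnorm (fun x => f x + 'i%C ^+ k * g x))%:C.

Lemma polar_cvg f g : sqsummable f -> sqsummable g ->
  (fun E => (\sum_(x <- E) f x * Num.conj (g x)) : R[i]^o) @ fin_net --> (polar f g :
    R[i]^o).
Proof.
move=> hf hg.
have hs k : sqsummable (fun x => f x + 'i%C ^+ k * g x).
  by apply: sqsummableD => //; apply: sqsummableZ.
have -> : (fun E => (\sum_(x <- E) f x * Num.conj (g x)) : R[i]^o) =
  fun E => 4^-1 * \sum_(k < 4) 'i%C ^+ k * (sqsum (fun x => f x + 'i%C ^+ k * g x) E)%:C.
  apply/funext => E; rewrite mulr_sumr.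
  under [RHS]eq_bigr => k _ do rewrite /sqsum rmorph_sum /= !mulr_sumr.
  rewrite exchange_big /=; apply: eq_bigr => x _.
  rewrite !big_ord_recl big_ord0 /= !rn_sqr.
  rewrite !expr0 !mul1r addr0 /bump /= !add1n.
  have i2 : 'i%C * 'i%C = -1 :> R[i] by rewrite -expr2 sqr_i.
  have ci : Num.conj ('i%C : R[i]) = - 'i%C by apply/eqP; rewrite eq_complex /= oppr0 !eqxx.
  rewrite !rmorphD /= !rmorphM /= !rmorphXn /= ci.
  set a := f x; set b := g x; set a' := Num.conj a; set b' := Num.conj b.
  have i3 : 'i%C ^+ 3 = - 'i%C :> R[i] by rewrite exprS sqr_i mulrN1.
  rewrite !expr1 !sqr_i i3 !mulrNN !i2 !mulN1r.
  (* [field] does not know the square of [I], so the difference of the two sides is written as a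
     multiple of [I * I + 1]. *)
  set I := 'i%C; apply/eqP; rewrite -subr_eq0; apply/eqP.
  transitivity ((I * I + 1) * (2^-1 * (a * b' - b * a'))); first by field.
  by rewrite i2 addNr mul0r.
have cv (k : 'I_4) : (fun E => 'i%C ^+ k * (sqsum (fun x =>
  f x + 'i%C ^+ k * g x) E)%:C : R[i]^o)
   @ fin_net --> ('i%C ^+ k * (sqnorm (fun x => f x + 'i%C ^+ k * g x))%:C : R[i]^o).
  by apply: cvgMr; exact: sqnorm_cvg.
apply: cvgMr; apply: cvg_big => [|k _]; [exact: add_continuous | exact: cv].
Qed.

Lemma polar_unique f g l : sqsummable f -> sqsummable g ->
  (fun E => (\sum_(x <- E) f x * Num.conj (g x)) : R[i]^o) @ fin_net --> (l : R[i]^o) ->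
  polar f g = l.
Proof. by move=> hf hg; apply: cvg_unique; [exact: norm_hausdorff | exact: polar_cvg]. Qed.

Lemma polar_fin f g (E0 : {fset X}) : sqsummable f -> sqsummable g ->
  (forall x, x \notin E0 -> g x = 0) ->
  polar f g = \sum_(x <- E0) f x * Num.conj (g x).
Proof.
move=> hf hg g0; apply: polar_unique => //; apply/cvg_rnP => e e0.
exists E0 => E EE /=; rewrite [X in _ - X](big_fsetID _ (mem E0)) /=.
have -> : [fset x in E | x \in E0]%fset = E0.
  apply/fsetP => x; rewrite !inE /=; case: (boolP (x \in E0)) => // xE;
    last by rewrite andbF.
  by rewrite (fsubsetP EE).
have -> : \sum_(i <- [fset x | x in E & x \notin E0]%fset) f i * Num.conj (g i) = 0.
  rewrite big_seq big1 // => x.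
  by rewrite !inE /= => /andP[_ /g0 ->]; rewrite rmorph0 mulr0.
by rewrite addr0 subrr rn0.
Qed.

End SquareSummable.
Arguments fin_net {X} _.

Section Ell2.
Variables (R : realType) (X : choiceType) (O : set X).

(** Functions on the whole type that vanish off [O], instead of functions on a subtype; thus [sigma]
    can be applied to arguments without coercions. *)
Record ell2 := Ell2 {
  ell2_fun :> X -> R[i];
  ell2_summable : sqsummable ell2_fun;
  ell2_out : forall x, ~ O x -> ell2_fun x = 0 }.

HB.instance Definition _ := gen_eqMixin ell2.
HB.instance Definition _ := gen_choiceMixin ell2.
Implicit Types (f g h : ell2) (E : {fset X}).

Lemma ell2P f g : (forall x, f x = g x) -> f = g.
Proof.
case: f g => [f hf f0] [g hg g0] /= /funext E; case: _ / E in hg g0 *.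
by congr Ell2; exact: Prop_irrelevance.
Qed.

Lemma sqsummable0 : @sqsummable R X (fun=> 0).
Proof. by exists 0 => E; rewrite /sqsum big1 // => x _; rewrite rn0 expr0n. Qed.

Definition ell2_zero := Ell2 sqsummable0 (fun _ _ => erefl).

Lemma ell2_add_out f g x : ~ O x -> f x + g x = 0.
Proof. by move=> Ox; rewrite !ell2_out // addr0. Qed.
Definition ell2_add f g :=
  Ell2 (sqsummableD (ell2_summable f) (ell2_summable g)) (@ell2_add_out f g).

Lemma ell2_scale_out k f x : ~ O x -> k * f x = 0.
Proof. by move=> Ox; rewrite ell2_out // mulr0. Qed.
Definition ell2_scale k f := Ell2 (sqsummableZ k (ell2_summable f)) (@ell2_scale_out k f).

Lemma ell2_addA : associative ell2_add.
Proof. by move=> f g h; apply: ell2P => x /=; rewrite addrA. Qed.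
Lemma ell2_addC : commutative ell2_add.
Proof. by move=> f g; apply: ell2P => x /=; rewrite addrC. Qed.
Lemma ell2_add0 : left_id ell2_zero ell2_add.
Proof. by move=> f; apply: ell2P => x /=; rewrite add0r. Qed.
Lemma ell2_addN : left_inverse ell2_zero (ell2_scale (-1)) ell2_add.
Proof. by move=> f; apply: ell2P => x /=; rewrite mulN1r addNr. Qed.
HB.instance Definition _ := GRing.isZmodule.Build ell2 ell2_addA ell2_addC ell2_add0
  ell2_addN.

Lemma ell2_scaleA a b f : ell2_scale a (ell2_scale b f) = ell2_scale (a * b) f.
Proof. by apply: ell2P => x /=; rewrite mulrA. Qed.
Lemma ell2_scale1 : left_id 1 ell2_scale.
Proof. by move=> f; apply: ell2P => x /=; rewrite mul1r. Qed.
Lemma ell2_scaleDr : right_distributive ell2_scale +%R.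
Proof. by move=> k f g; apply: ell2P => x /=; rewrite mulrDr. Qed.
Lemma ell2_scaleDl f : {morph ell2_scale^~ f : a b / a + b}.
Proof. by move=> a b; apply: ell2P => x /=; rewrite mulrDl. Qed.
HB.instance Definition _ := GRing.Zmodule_isLmodule.Build R[i] ell2
  ell2_scaleA ell2_scale1 ell2_scaleDr ell2_scaleDl.

Lemma ell2DE f g x : (f + g) x = f x + g x. Proof. by []. Qed.
Lemma ell2ZE k f x : (k *: f) x = k * f x. Proof. by []. Qed.
Lemma ell2NE f x : (- f) x = - f x. Proof. by rewrite -scaleN1r ell2ZE mulN1r. Qed.
Lemma ell2BE f g x : (f - g) x = f x - g x. Proof. by rewrite ell2DE ell2NE. Qed.
Lemma ell2_sumE (I : Type) (s : seq I) (P : pred I) (F : I -> ell2) x :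
  (\sum_(i <- s | P i) F i) x = \sum_(i <- s | P i) F i x.
Proof. by elim/big_ind2: _ => // [f a g b <- <-]. Qed.

Definition ell2_norm f : R[i] := (Num.sqrt (sqnorm f))%:C.

Lemma ell2_normZ k f : ell2_norm (k *: f) = `|k| * ell2_norm f.
Proof.
rewrite /ell2_norm rnE -rmorphM /=; congr (_%:C).
have -> : sqnorm (k *: f) = rn k ^+ 2 * sqnorm f by exact: sqnormZ (ell2_summable f).
by rewrite sqrtrM ?sqr_ge0 // sqrtr_sqr ger0_norm ?rn_ge0.
Qed.

Lemma sqnorm_eq0 f : sqnorm f = 0 -> f = 0.
Proof.
move=> f0; apply: ell2P => x; apply: rn_eq0; apply/eqP;
  rewrite -sqrf_eq0 eq_le sqr_ge0 andbT.
by rewrite -f0 sqr_rn_le_sqnorm //; exact: ell2_summable.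
Qed.

Lemma ell2_norm_eq0 f : ell2_norm f = 0 -> f = 0.
Proof.
move/complexI/eqP; rewrite sqrtr_eq0 => h; apply: sqnorm_eq0.
by apply/eqP; rewrite eq_le h sqnorm_ge0 //; exact: ell2_summable.
Qed.

Lemma ell2_normD f g : ell2_norm (f + g) <= ell2_norm f + ell2_norm g.
Proof.
rewrite /ell2_norm -rmorphD lecR.
have pos h : h != 0 -> 0 < sqnorm h.
  move=> h0; rewrite lt_neqAle sqnorm_ge0; last exact: ell2_summable.
  by rewrite andbT eq_sym; apply: contra_neq h0 => /sqnorm_eq0.
have [->|f0] := eqVneq f 0; first by rewrite add0r lerDr sqrtr_ge0.
have [->|g0] := eqVneq g 0; first by rewrite addr0 lerDl sqrtr_ge0.
set a := Num.sqrt (sqnorm f); set b := Num.sqrt (sqnorm g).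
have a0 : 0 < a by rewrite sqrtr_gt0 pos.
have b0 : 0 < b by rewrite sqrtr_gt0 pos.
have fE : sqnorm f = a ^+ 2 by rewrite sqr_sqrtr // ltW // pos.
have gE : sqnorm g = b ^+ 2 by rewrite sqr_sqrtr // ltW // pos.
(* At [t = b / a] the right-hand side is exactly [(a + b) ^+ 2]. *)
have := @sqnorm_add _ _ f g (b / a) (ell2_summable f) (ell2_summable g) (divr_gt0 b0 a0).
rewrite fE gE => h.
have -> : a + b = Num.sqrt ((a + b) ^+ 2) by rewrite sqrtr_sqr ger0_norm // addr_ge0 // ltW.
rewrite ler_sqrt ?sqr_ge0 //; apply: le_trans h _; rewrite le_eqVlt; apply/orP; left;
  apply/eqP.
by field; rewrite !gt_eqF.
Qed.

HB.instance Definition _ := Lmodule_isNormed.Build R[i] ell2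
  ell2_normD ell2_normZ ell2_norm_eq0.

Lemma ell2_rn f : rn f = Num.sqrt (sqnorm f).
Proof. by []. Qed.

Lemma ell2_rn_sqr f : rn f ^+ 2 = sqnorm f.
Proof. by rewrite ell2_rn sqr_sqrtr // sqnorm_ge0 //; exact: ell2_summable. Qed.

Lemma ell2_rn_le f M : 0 <= M -> (forall E, sqsum f E <= M ^+ 2) -> rn f <= M.
Proof.
move=> M0 h; rewrite -(@ler_pXn2r _ 2) ?nnegrE ?rn_ge0 // ell2_rn_sqr.
exact: sqnorm_le.
Qed.

Lemma ell2_coord_le f x : rn (f x) <= rn f.
Proof.
rewrite -(@ler_pXn2r _ 2) ?nnegrE ?rn_ge0 // ell2_rn_sqr.
by apply: sqr_rn_le_sqnorm; exact: ell2_summable.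
Qed.

Lemma complex_cauchy_cvg (F : set_system R[i]^o) : ProperFilter F ->
  cauchy F -> exists l : R[i]^o, F --> l.
Proof.
move=> FF /cauchy_rnP hF.
have part (p : R[i] -> R) : (forall a b, p (a - b) = p a - p b) ->
   (forall a, `|p a| <= rn a) -> exists l : R, forall e : R,
     0 < e -> F [set z | `|l - p z| < e].
  move=> pB pn.
  have pF : ProperFilter (p @ F) by exact: fmap_proper_filter.
  have /R_complete : cauchy (p @ F).
    apply/cauchyP => e e0; have [u hu] := hF _ e0; exists (p u).
    suff : F [set z | ball (p u) e (p z)] by [].
    by apply: filterS hu => z /= uz; rewrite /ball /= -pB (le_lt_trans (pn _)).
  move=> /cvgrPdist_lt h; exists (lim (p @ F)) => e /h.
  by [].
have [|a|lr hr] := part (@complex.Re R).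
- by move=> a b; rewrite raddfB.
- by rewrite -lecR -rnE normc_ge_Re.
have [|a|li hi] := part (@complex.Im R).
- by move=> a b; rewrite raddfB.
(* The bound on the imaginary part is the bound on the real part after multiplication by i, which
   preserves the modulus. *)
- rewrite -normrN -ReiNIm.
  have -> : rn a = rn (a * 'i%C) by rewrite rnM (_ : rn 'i%C = 1) ?mulr1 // /rn normc_def
    /= expr0n expr1n add0r sqrtr1.
  by rewrite -lecR -rnE normc_ge_Re.
exists (lr +i* li); apply/cvg_rnP => e e0.
have e2 : 0 < e / 2 by rewrite divr_gt0.
apply: filterS2 (hr _ e2) (hi _ e2) => -[x y] /= hx hy.
have -> : (lr +i* li) - (x +i* y) = (lr - x)%:C + 'i%C * (li - y)%:C by rewrite
  [LHS]complexE.
rewrite (le_lt_trans (rnD _ _)) // rnM !rn_real.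
have -> : rn ('i%C : R[i]) = 1 by rewrite /rn normc_def /= expr0n expr1n add0r sqrtr1.
by rewrite mul1r; lra.
Qed.

Lemma ell2_complete (F : set_system ell2) : ProperFilter F -> cauchy F -> cvg F.
Proof.
move=> FF /cauchy_rnP hF.
have hc x : exists l : R[i]^o, (fun f : ell2 => f x : R[i]^o) @ F --> l.
  apply: complex_cauchy_cvg; apply/cauchy_rnP => e e0.
  have [u hu] := hF _ e0; exists (u x : R[i]^o).
  suff : F [set v : ell2 | rn (u x - v x) < e] by [].
  apply: filterS hu => v /= uv; by rewrite -ell2BE (le_lt_trans (ell2_coord_le _ _)).
pose l x := sval (cid (hc x)).
have lP x e : 0 < e -> F [set f : ell2 | rn (l x - f x) < e].
  by move=> e0; have /cvg_rnP/(_ e e0) := svalP (cid (hc x)).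
(* Closeness in norm passes to the pointwise limit [l] on every finite set with a bound independent
   of the set; this gives both summability of [l] and convergence in norm. *)
have fin (u : ell2) (e : R) E : 0 < e -> F [set v | rn (u - v) < e] ->
    sqsum (fun x => u x - l x) E <= e ^+ 2.
  move=> e0 hu; apply/ler_addgt0Pl => d d0.
  have near_sum : F [set v : ell2 | sqsum (fun x => u x - l x) E <= d + sqsum (fun x =>
    u x - v x) E].
    rewrite /sqsum; elim: (enum_fset E) d d0 => [|x s ih] d d0.
      by apply: filterS hu => v _ /=; rewrite !big_nil addr0 ltW.
    have d2 : 0 < d / 2 by rewrite divr_gt0.
    (* Chosen so that [(q + k) ^+ 2 <= q ^+ 2 + d / 2] for every [0 <= q < e]: since [k <= 1], the
       excess [2 * q * k + k ^+ 2] is at most [k * (2 * e + 1)]. *)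
    pose k := Num.min 1 (d / 2 / (2 * e + 1)).
    have e1 : 0 < 2 * e + 1 by lra.
    have k0 : 0 < k by rewrite lt_min ltr01 divr_gt0.
    have k1 : k <= 1 by rewrite ge_min lexx.
    have kd : k * (2 * e + 1) <= d / 2 by rewrite -ler_pdivlMr // ge_min lexx orbT.
    apply: filterS3 (ih _ d2) (lP x _ k0) hu => v /= hs hx uv.
    rewrite !big_cons.
    suff : rn (u x - l x) ^+ 2 <= d / 2 + rn (u x - v x) ^+ 2 by move: hs; lra.
    have h1 := rn_triangle (v x) (u x) (l x); rewrite (rn_sub (v x)) in h1.
    have h2 : rn (u x - v x) < e by rewrite -ell2BE (le_lt_trans (ell2_coord_le _ _)).
    have h3 := rn_ge0 (u x - v x); have h4 := rn_ge0 (u x - l x).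
    have h5 := rn_ge0 (l x - v x).
    set p := rn (u x - l x) in h1 h4 *; set q := rn (u x - v x) in h1 h2 h3 *.
    have h6 : p <= q + k by lra.
    have h7 : p ^+ 2 <= (q + k) ^+ 2 by rewrite ler_pXn2r // nnegrE; lra.
    nra.
  have [v [/= uv vs]] := filter_ex (filterI hu near_sum).
  rewrite (le_trans vs) // lerD2l.
  have -> : (fun x => u x - v x) = (u - v) by apply/funext => x; rewrite ell2BE.
  rewrite (le_trans (sqsum_le_sqnorm _ (ell2_summable _))) // -ell2_rn_sqr.
  by rewrite ler_pXn2r // ?nnegrE ?rn_ge0 // ltW.
have [u1 hu1] := hF 1 ltr01.
have dl : sqsummable (fun x => u1 x - l x) by exists 1 => E; rewrite -[1](expr1n _ 2) fin.
have ls : sqsummable l.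
  have := sqsummableD (ell2_summable u1) (sqsummableZ (-1) dl).
  by congr sqsummable; apply/funext => x; rewrite mulN1r opprB addrC subrK.
have l0 x : ~ O x -> l x = 0.
  move=> Ox; apply: rn_small => e e0; have [f /= hf] := filter_ex (lP x _ e0).
  by move: hf; rewrite ell2_out // subr0 => /ltW.
apply/cvg_ex; exists (Ell2 ls l0); apply/cvg_rnP => e e0.
have e3 : 0 < e / 3 by rewrite divr_gt0.
have [u hu] := hF _ e3; apply: filterS (hu) => v /= uv.
rewrite (le_lt_trans (rn_triangle u _ _)) // rn_sub.
suff : rn (u - Ell2 ls l0) <= e / 3 by move: uv; lra.
apply: ell2_rn_le => [|E]; first exact: ltW.
have -> : ell2_fun (u - Ell2 ls l0) = fun x => u x - l x by apply/funext => x;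
  rewrite ell2BE.
exact: fin.
Qed.

HB.instance Definition _ := Uniform_isComplete.Build ell2 ell2_complete.

Definition ell2_dot f g : R[i] := polar f g.

Lemma ell2_dot_cvg f g :
  (fun E => (\sum_(x <- E) f x * Num.conj (g x)) : R[i]^o) @ fin_net --> (ell2_dot f g :
    R[i]^o).
Proof. by apply: polar_cvg; exact: ell2_summable. Qed.

Lemma ell2_dot_unique f g l :
  (fun E => (\sum_(x <- E) f x * Num.conj (g x)) : R[i]^o) @ fin_net --> (l : R[i]^o) ->
  ell2_dot f g = l.
Proof. by apply: polar_unique; exact: ell2_summable. Qed.

Lemma ell2_dotDl f g h : ell2_dot (f + g) h = ell2_dot f h + ell2_dot g h.
Proof.
apply: ell2_dot_unique.
have -> : (fun E => (\sum_(x <- E) (f + g) x * Num.conj (h x)) : R[i]^o) =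
  (fun E => (\sum_(x <- E) f x * Num.conj (h x) + \sum_(x <- E) g x * Num.conj (h x)) :
    R[i]^o).
  by apply/funext => E; rewrite -big_split; apply: eq_bigr => x _; rewrite ell2DE mulrDl.
by apply: cvgD; exact: ell2_dot_cvg.
Qed.

Lemma ell2_dotZl k f h : ell2_dot (k *: f) h = k * ell2_dot f h.
Proof.
apply: ell2_dot_unique.
have -> : (fun E => (\sum_(x <- E) (k *: f) x * Num.conj (h x)) : R[i]^o) =
  (fun E => (k * \sum_(x <- E) f x * Num.conj (h x)) : R[i]^o).
  by apply/funext => E; rewrite mulr_sumr; apply: eq_bigr => x _; rewrite ell2ZE mulrA.
by apply: cvgMr; exact: ell2_dot_cvg.
Qed.

Lemma ell2_dotC f g : ell2_dot f g = Num.conj (ell2_dot g f).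
Proof.
apply: ell2_dot_unique; apply/cvg_rnP => e e0.
have h : fin_net [set E | rn (ell2_dot g f - \sum_(x <- E) g x * Num.conj (f x)) < e].
  by have /cvg_rnP/(_ e e0) := @ell2_dot_cvg g f.
suff : fin_net [set E | rn (Num.conj (ell2_dot g f) - \sum_(x <- E) f x * Num.conj (g x))
  < e] by [].
apply: filterS h => E /= hE.
rewrite -rn_conj rmorphB /= conjCK rmorph_sum.
under eq_bigr => x _ do rewrite rmorphM /= conjCK mulrC.
exact: hE.
Qed.

Lemma ell2_dot_norm f : ell2_dot f f = (rn f ^+ 2)%:C.
Proof.
apply: ell2_dot_unique; rewrite ell2_rn_sqr.
have -> : (fun E => (\sum_(x <- E) f x * Num.conj (f x)) : R[i]^o) =
   (fun E => (sqsum f E)%:C : R[i]^o).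
  by apply/funext => E; rewrite /sqsum rmorph_sum; apply: eq_bigr => x _; exact/esym/rn_sqr.
exact: sqnorm_cvg (ell2_summable f).
Qed.

Lemma ell2_dot_zmodl h : zmod_morphism (ell2_dot^~ h).
Proof. by move=> f g; rewrite ell2_dotDl -scaleN1r ell2_dotZl mulN1r. Qed.
Lemma ell2_dot_scalel h : scalable_for *%R (ell2_dot^~ h).
Proof. by move=> k f; rewrite ell2_dotZl. Qed.
Lemma ell2_dot_zmodr f : zmod_morphism (ell2_dot f).
Proof. by move=> g h; rewrite !(ell2_dotC f) ell2_dot_zmodl rmorphB. Qed.
Lemma ell2_dot_scaler f : scalable_for (Num.conj \; *%R) (ell2_dot f).
Proof. by move=> k g /=; rewrite !(ell2_dotC f) ell2_dotZl rmorphM. Qed.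
HB.instance Definition _ := isBilinear.Build R[i] ell2 ell2 R[i] *%R (Num.conj \; *%R)
  ell2_dot ell2_dot_zmodl ell2_dot_zmodr ell2_dot_scalel ell2_dot_scaler.

Lemma ell2_dot_herm f g : ell2_dot f g = (-1) ^+ false * Num.conj (ell2_dot g f).
Proof. by rewrite expr0 mul1r ell2_dotC. Qed.
HB.instance Definition _ := isHermitianSesquilinear.Build R[i] ell2 false Num.conj
  ell2_dot ell2_dot_herm.

Lemma ell2_dot_gt0 f : f != 0 -> 0 < ell2_dot f f.
Proof.
move=> f0; rewrite ell2_dot_norm ltcR exprn_gt0 // lt_neqAle rn_ge0 andbT eq_sym.
by apply: contra_neq f0 => /rn_eq0.
Qed.
HB.instance Definition _ := isDotProduct.Build R[i] ell2 ell2_dot ell2_dot_gt0.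

Lemma ell2_norm_dot f : `|f| ^+ 2 = ell2_dot f f.
Proof. by rewrite ell2_dot_norm rnE rmorphXn. Qed.

Definition ell2_hilbert : hilbertSpace R :=
  @HilbertSpace R ell2 ell2_dot ell2_norm_dot.

End Ell2.

(** * The point masses form an orthonormal basis *)

Section Ell2Basis.
Variables (R : realType) (X : choiceType) (O : set X).
Local Notation H := (ell2_hilbert R O).
Local Notation "''[' u , v ]" := (hdot H u%R v%R).
Implicit Types (f g h : ell2 R O) (E : {fset X}).

(** The test on [x] makes the vector zero for [x] outside [O], so that [ell2_delta] is total and
    formulas summing over all points stay valid. *)
Definition delta_fun (x y : X) : R[i] := (`[< O x >] && (y == x))%:R.

Lemma delta_summable x : sqsummable (delta_fun x).
Proof.
exists 1 => E; apply: (@le_trans _ _ (sqsum (delta_fun x) (E `|` [fset x])%fset)).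
  by apply: sqsum_mono; exact: fsubsetUl.
rewrite /sqsum (big_fsetD1 x) /=; last by rewrite !inE eqxx orbT.
rewrite big_seq big1 ?addr0.
  by rewrite /delta_fun; case: (_ && _); rewrite ?rn1 ?rn0 ?expr1n ?expr0n.
by move=> y; rewrite !inE => /andP[/negPf yx _]; rewrite /delta_fun yx andbF rn0 expr0n.
Qed.

Lemma delta_out x y : ~ O y -> delta_fun x y = 0.
Proof.
rewrite /delta_fun => Oy; case: asboolP => // Ox /=; case: eqP => // yx.
by rewrite yx in Oy.
Qed.

Definition ell2_delta x : ell2 R O := Ell2 (@delta_summable x) (@delta_out x).

Lemma ell2_deltaE x y : O x -> ell2_delta x y = (y == x)%:R.
Proof. by move=> Ox /=; rewrite /delta_fun asboolT. Qed.

Lemma dot_delta f x : O x -> '[f, ell2_delta x] = f x.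
Proof.
move=> Ox; rewrite /= /ell2_dot (@polar_fin _ _ _ _ [fset x]%fset).
- by rewrite big_seq_fset1 ell2_deltaE // eqxx rmorph1 mulr1.
- exact: ell2_summable.
- exact: delta_summable.
- by move=> y; rewrite inE => /negPf yx; rewrite ell2_deltaE // yx.
Qed.

Lemma delta_dot f x : O x -> '[ell2_delta x, f] = Num.conj (f x).
Proof. by move=> Ox; rewrite dotC dot_delta. Qed.

Definition fin_part f E : ell2 R O := \sum_(x <- E) f x *: ell2_delta x.

Lemma fin_partE f E y : fin_part f E y = if y \in E then f y else 0.
Proof.
rewrite /fin_part ell2_sumE.
have [Oy|Oy] := pselect (O y); last first.
  by rewrite (ell2_out f Oy) if_same big1 // => x _; rewrite ell2_out.
case: ifP => yE.
  rewrite (big_fsetD1 y) //= big_seq big1 ?addr0.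
    by rewrite /delta_fun asboolT // eqxx mulr1.
  move=> x; rewrite !inE => /andP[xy _].
  by rewrite /delta_fun eq_sym (negPf xy) andbF mulr0.
rewrite big_seq big1 // => x xE; rewrite /= /delta_fun; case: eqP => [yx|];
  last by rewrite andbF mulr0.
by rewrite yx xE in yE.
Qed.

Lemma fin_part_approx f (e : R) : 0 < e -> exists E, rn (f - fin_part f E) < e.
Proof.
move=> e0; have e2 : 0 < e / 2 by rewrite divr_gt0.
have e3 : 0 < (e / 2) ^+ 2 by rewrite exprn_gt0.
have [E hE] := sqnorm_approx (ell2_summable f) e3.
exists E; apply: (@le_lt_trans _ _ (e / 2)); last by lra.
apply: ell2_rn_le => [|E']; first exact: ltW.
have -> : sqsum (f - fin_part f E) E' = \sum_(x <- (E' `\` E)%fset) rn (f x) ^+ 2.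
  have vE x : (f - fin_part f E) x = if x \in E then 0 else f x.
    by rewrite ell2BE fin_partE; case: ifP; rewrite ?subrr ?subr0.
  rewrite /sqsum; under eq_bigr => x _ do rewrite vE.
  rewrite (big_fsetID _ (mem E)) /= [X in X + _]big_seq big1 ?add0r.
    have -> : [fset x in E' | x \notin E]%fset = (E' `\` E)%fset.
      by apply/fsetP => x; rewrite !inE /= andbC.
    apply: eq_big_seq => x; rewrite !inE => /andP[/negPf xE _].
    by rewrite xE.
  by move=> x; rewrite !inE /= => /andP[_ ->]; rewrite rn0 expr0n.
(* The tail is the excess of the sum over the union above the sum over [E], and the latter is
   already within [(e / 2) ^+ 2] of the supremum. *)
have := sqsum_le_sqnorm (E `|` E')%fset (ell2_summable f).
have -> : sqsum f (E `|` E')%fset = sqsum f E + \sum_(x <- (E' `\` E)%fset) rn (f x) ^+ 2.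
  rewrite {1}/sqsum (big_fsetID _ (mem E)) /=; congr (_ + _).
    rewrite /sqsum; congr (\sum_(i <- enum_fset _) _); apply/fsetP => x; rewrite !inE /=.
    by case: (x \in E); rewrite ?andbF.
  congr (\sum_(i <- enum_fset _) _); apply/fsetP => x; rewrite !inE /=.
  by case: (x \in E); rewrite ?andbF //= andbT.
by lra.
Qed.

Lemma ell2_orthonormal_basis : orthonormal_basis (H := H) O ell2_delta.
Proof.
split=> [x y Ox Oy|W [Wc W0 WD WZ] hW].
  by rewrite dot_delta // ell2_deltaE // eq_sym.
apply/seteqP; split=> // f _; move/closed_rnP: Wc; apply => e e0.
have [E hE] := fin_part_approx f e0; exists (fin_part f E) => //.
rewrite /fin_part; elim/big_ind: _ => // x _.
have [Ox|Ox] := pselect (O x); first by apply: WZ; exact: hW.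
by rewrite ell2_out // scale0r.
Qed.

End Ell2Basis.

(** * Adjointable operators *)

Section Operators.
Variables (R : realType) (H : hilbertSpace R).
Local Notation "''[' u , v ]" := (hdot H u%R v%R).

Definition adjoint_of (T T' : H -> H) := forall u v, '[T u, v] = '[u, T' v].

(** An adjoint is part of the data, so the involution needs no Riesz theorem; linearity is a
    consequence of it and is not a field. *)
Record bop := Bop {
  bop_fun :> H -> H;
  bop_bounded : exists M : R, forall v, rn (bop_fun v) <= M * rn v;
  bop_adjoint : exists T' : H -> H, adjoint_of bop_fun T' }.

HB.instance Definition _ := gen_eqMixin bop.
HB.instance Definition _ := gen_choiceMixin bop.
Implicit Types S T : bop.

Lemma bopP S T : (forall v, S v = T v) -> S = T.
Proof.
case: S T => [f f1 f2] [g g1 g2] /= /funext E; case: _ / E in g1 g2 *.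
by congr Bop; exact: Prop_irrelevance.
Qed.

Lemma dot_ext (u v : H) : (forall w, '[w, u] = '[w, v]) -> u = v.
Proof.
move=> h; apply/eqP; rewrite -subr_eq0; apply/eqP; apply: dot_eq0.
by rewrite dotBr h subrr.
Qed.

Lemma adjoint_of_sym (T T' : H -> H) : adjoint_of T T' -> adjoint_of T' T.
Proof. by move=> h u v; rewrite dotC -h -dotC. Qed.

Lemma adjoint_linear (T T' : H -> H) : adjoint_of T T' -> linear T'.
Proof.
move=> h k u v; apply: dot_ext => w.
by rewrite -h !(dotDr, dotZr) -!h.
Qed.

Lemma bop_linear T : linear T.
Proof. by have [T' h] := bop_adjoint T; apply: adjoint_linear (adjoint_of_sym h). Qed.

Lemma bopD T u v : T (u + v) = T u + T v.
Proof. by rewrite -[u]scale1r bop_linear !scale1r. Qed.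

Lemma bop0 T : T 0 = 0.
Proof. by apply: (addIr (T 0)); rewrite -bopD !add0r. Qed.

Lemma bopZ T k u : T (k *: u) = k *: T u.
Proof. by rewrite -[k *: u]addr0 bop_linear bop0 addr0. Qed.

Lemma bop_add_bounded S T : exists M : R, forall v, rn (S v + T v) <= M * rn v.
Proof.
have [[M hM] [N hN]] := (bop_bounded S, bop_bounded T).
by exists (M + N) => v; rewrite mulrDl (le_trans (rnD _ _)) // lerD.
Qed.
Lemma bop_add_adjoint S T : exists T' : H -> H, adjoint_of (fun v => S v + T v) T'.
Proof.
have [[S' hS] [T' hT]] := (bop_adjoint S, bop_adjoint T).
by exists (fun v => S' v + T' v) => u v; rewrite dotDl hS hT -dotDr.
Qed.
Definition bop_add S T := Bop (bop_add_bounded S T) (bop_add_adjoint S T).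

Lemma bop_scale_bounded (k : R[i]) T : exists M : R, forall v, rn (k *: T v) <= M * rn v.
Proof.
have [M hM] := bop_bounded T.
by exists (rn k * M) => v; rewrite rnZ -mulrA ler_wpM2l ?rn_ge0.
Qed.
Lemma bop_scale_adjoint (k : R[i]) T : exists T' : H -> H, adjoint_of (fun v =>
  k *: T v) T'.
Proof.
have [T' hT] := bop_adjoint T.
by exists (fun v => Num.conj k *: T' v) => u v; rewrite dotZl hT dotZr conjCK.
Qed.
Definition bop_scale k T := Bop (bop_scale_bounded k T) (bop_scale_adjoint k T).

Lemma bop_zero_bounded : exists M : R, forall v : H, rn (0 : H) <= M * rn v.
Proof. by exists 0 => v; rewrite rn0 mul0r. Qed.
Lemma bop_zero_adjoint : exists T' : H -> H, adjoint_of (fun=> 0) T'.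
Proof. by exists (fun=> 0) => u v; rewrite dot0l dot0r. Qed.
Definition bop_zero := Bop bop_zero_bounded bop_zero_adjoint.

Lemma bop_addA : associative bop_add.
Proof. by move=> S T U; apply: bopP => x /=; rewrite addrA. Qed.
Lemma bop_addC : commutative bop_add.
Proof. by move=> S T; apply: bopP => x /=; rewrite addrC. Qed.
Lemma bop_add0 : left_id bop_zero bop_add.
Proof. by move=> S; apply: bopP => x /=; rewrite add0r. Qed.
Lemma bop_addN : left_inverse bop_zero (bop_scale (-1)) bop_add.
Proof. by move=> S; apply: bopP => x /=; rewrite scaleN1r addNr. Qed.
HB.instance Definition _ := GRing.isZmodule.Build bop bop_addA bop_addC bop_add0 bop_addN.

Lemma bop_scaleA a b T : bop_scale a (bop_scale b T) = bop_scale (a * b) T.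
Proof. by apply: bopP => x /=; rewrite scalerA. Qed.
Lemma bop_scale1 : left_id 1 bop_scale.
Proof. by move=> T; apply: bopP => x /=; rewrite scale1r. Qed.
Lemma bop_scaleDr : right_distributive bop_scale +%R.
Proof. by move=> k S T; apply: bopP => x /=; rewrite scalerDr. Qed.
Lemma bop_scaleDl T : {morph bop_scale^~ T : a b / a + b}.
Proof. by move=> a b; apply: bopP => x /=; rewrite scalerDl. Qed.
HB.instance Definition _ := GRing.Zmodule_isLmodule.Build R[i] bop
  bop_scaleA bop_scale1 bop_scaleDr bop_scaleDl.

Lemma bop_addE S T v : (S + T) v = S v + T v. Proof. by []. Qed.
Lemma bop_scaleE k T v : (k *: T) v = k *: T v. Proof. by []. Qed.
Lemma bop_subE S T v : (S - T) v = S v - T v.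
Proof. by rewrite bop_addE -[- T]scaleN1r bop_scaleE scaleN1r. Qed.

(** Nonnegativity keeps the infimum meaningful on the zero space, where every real number satisfies
    the inequality. *)
Definition op_bounds T : set R := [set M | 0 <= M /\ forall v, rn (T v) <= M * rn v].
Definition opn T : R := inf (op_bounds T).

Lemma op_bounds_neq0 T : op_bounds T !=set0.
Proof.
have [M hM] := bop_bounded T; exists `|M|; split=> // v.
by rewrite (le_trans (hM v)) // ler_wpM2r ?rn_ge0 // ler_norm.
Qed.

Lemma opn_ge0 T : 0 <= opn T.
Proof. by apply: lb_le_inf; [exact: op_bounds_neq0 | move=> M []]. Qed.

Lemma opn_le T M : 0 <= M -> (forall v, rn (T v) <= M * rn v) -> opn T <= M.
Proof. by move=> M0 h; apply: ge_inf; [exists 0 => N [] | split]. Qed.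

Lemma opnP T v : rn (T v) <= opn T * rn v.
Proof.
have [->|v0] := eqVneq v 0; first by rewrite bop0 !rn0 mulr0.
have nv0 : 0 < rn v by rewrite lt_neqAle rn_ge0 andbT eq_sym;
  apply: contra_neq v0 => /rn_eq0.
rewrite -ler_pdivrMr //; apply: lb_le_inf; first exact: op_bounds_neq0.
by move=> M [_ /(_ v) h]; rewrite ler_pdivrMr.
Qed.

Definition bop_norm T : R[i] := (opn T)%:C.

Lemma bop_normD S T : bop_norm (S + T) <= bop_norm S + bop_norm T.
Proof.
rewrite /bop_norm -rmorphD lecR; apply: opn_le; first by rewrite addr_ge0 ?opn_ge0.
by move=> v; rewrite bop_addE (le_trans (rnD _ _)) // mulrDl lerD ?opnP.
Qed.

Lemma opnZ_le k T : opn (k *: T) <= rn k * opn T.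
Proof.
apply: opn_le => [|v]; first by rewrite mulr_ge0 ?rn_ge0 ?opn_ge0.
by rewrite bop_scaleE rnZ -mulrA ler_wpM2l ?rn_ge0 ?opnP.
Qed.

Lemma bop_normZ k T : bop_norm (k *: T) = `|k| * bop_norm T.
Proof.
rewrite /bop_norm rnE -rmorphM /=; congr (_%:C); apply/eqP; rewrite eq_le opnZ_le /=.
have [->|k0] := eqVneq k 0; first by rewrite rn0 mul0r opn_ge0.
have nk : 0 < rn k by rewrite lt_neqAle rn_ge0 andbT eq_sym;
  apply: contra_neq k0 => /rn_eq0.
rewrite -ler_pdivlMl //; have := opnZ_le k^-1 (k *: T).
rewrite scalerA mulVf // scale1r.
by rewrite (_ : rn k^-1 = (rn k)^-1) //; apply: complexI; rewrite -rnE normfV rnE fmorphV.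
Qed.

Lemma bop_norm_eq0 T : bop_norm T = 0 -> T = 0.
Proof.
move/complexI => T0; apply: bopP => v; apply: rn_eq0; apply/eqP.
by rewrite eq_le rn_ge0 andbT; have := opnP T v; rewrite T0 mul0r.
Qed.

HB.instance Definition _ := Lmodule_isNormed.Build R[i] bop
  bop_normD bop_normZ bop_norm_eq0.

Lemma bop_rn T : rn T = opn T. Proof. by []. Qed.

Lemma rn_bop_le T v : rn (T v) <= rn T * rn v.
Proof. by rewrite bop_rn opnP. Qed.

Definition bop_star_fun T : H -> H := sval (cid (bop_adjoint T)).
Lemma bop_star_funP T : adjoint_of T (bop_star_fun T).
Proof. exact: svalP (cid (bop_adjoint T)). Qed.

(** With [w] the image of [v] under the adjoint, the squared norm of [w] is ['[T w, v]], and one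
    factor [rn w] cancels. *)
Lemma bop_star_rn T v : rn (bop_star_fun T v) <= rn T * rn v.
Proof.
set w := bop_star_fun T v.
have [->|w0] := eqVneq w 0; first by rewrite rn0 mulr_ge0 ?rn_ge0.
have nw0 : 0 < rn w by rewrite lt_neqAle rn_ge0 andbT eq_sym;
  apply: contra_neq w0 => /rn_eq0.
rewrite -(ler_pM2r nw0) -expr2 rn_sqrE -bop_star_funP.
rewrite (le_trans (Re_le_rn _)) // (le_trans (Cauchy_Schwarz _ _)) //.
by rewrite mulrAC ler_wpM2r ?rn_ge0 // rn_bop_le.
Qed.

Definition bop_star T : bop :=
  Bop (ex_intro _ (rn T) (bop_star_rn T)) (ex_intro _ _ (adjoint_of_sym (bop_star_funP T))).

Lemma bop_starP T u v : '[T u, v] = '[u, bop_star T v].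
Proof. exact: bop_star_funP. Qed.

Lemma bop_complete (F : set_system bop) : ProperFilter F -> cauchy F -> cvg F.
Proof.
move=> FF /cauchy_rnP hF.
have hc v : exists l : H, (fun T : bop => T v : H) @ F --> l.
  apply/cvg_ex; apply: cauchy_cvg; apply/cauchy_rnP => e e0.
  have v1 : 0 < rn v + 1 by rewrite ltr_wpDl ?rn_ge0.
  have [|U hU] := hF (e / (rn v + 1)); first by rewrite divr_gt0.
  exists (U v : H).
  suff : F [set T : bop | rn (U v - T v) < e] by [].
  apply: filterS hU => T /= UT; rewrite -bop_subE (le_lt_trans (rn_bop_le _ _)) //.
  rewrite (@le_lt_trans _ _ (rn (U - T) * (rn v + 1))) //.
    by rewrite ler_wpM2l ?rn_ge0 // lerDl.
  by rewrite -ltr_pdivlMr.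
pose L v := sval (cid (hc v)).
have LP v e : 0 < e -> F [set T : bop | rn (L v - T v) < e].
  by move=> e0; have /cvg_rnP/(_ e e0) := svalP (cid (hc v)).
have fin (U : bop) (e : R) v : 0 < e -> F [set T | rn (U - T) < e] ->
    rn (U v - L v) <= e * rn v.
  move=> e0 hU; apply/ler_addgt0Pl => d d0.
  have [T [/= UT /ltW LT]] := filter_ex (filterI hU (LP v _ d0)).
  rewrite (le_trans (rn_triangle (T v) _ _)) // addrC rn_sub lerD //.
  by rewrite -bop_subE (le_trans (rn_bop_le _ _)) // ler_wpM2r ?rn_ge0 // ltW.
have [U1 hU1] := hF 1 ltr01.
have Lb : exists M : R, forall v, rn (L v) <= M * rn v.
  exists (1 + rn U1) => v; rewrite mulrDl -[L v](subrK (U1 v)) (le_trans (rnD _ _)) //.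
  by rewrite lerD ?rn_bop_le // rn_sub fin.
(* The involution does not increase the bound, so the adjoints converge pointwise as well; their
   limit is the adjoint of [L]. *)
have hcs v : exists l : H, (fun T : bop => bop_star T v : H) @ F --> l.
  apply/cvg_ex; apply: cauchy_cvg; apply/cauchy_rnP => e e0.
  have v1 : 0 < rn v + 1 by rewrite ltr_wpDl ?rn_ge0.
  have [|U hU] := hF (e / (rn v + 1)); first by rewrite divr_gt0.
  exists (bop_star U v : H).
  suff : F [set T : bop | rn (bop_star U v - bop_star T v) < e] by [].
  apply: filterS hU => T /= UT.
  have -> : bop_star U v - bop_star T v = bop_star (U - T) v.
    by apply: dot_ext => w; rewrite dotBr -!bop_starP -dotBl -bop_subE.
  rewrite (le_lt_trans (bop_star_rn _ _)) //.
  rewrite (@le_lt_trans _ _ (rn (U - T) * (rn v + 1))) //.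
    by rewrite ler_wpM2l ?rn_ge0 // lerDl.
  by rewrite -ltr_pdivlMr.
have La : exists T' : H -> H, adjoint_of L T'.
  exists (fun v => sval (cid (hcs v))) => u v; apply/eqP; rewrite -subr_eq0; apply/eqP.
  apply: rn_small => e e0; set l := sval _.
  pose d := e / (rn u + rn v + 1).
  have nu := rn_ge0 u; have nv := rn_ge0 v.
  have d0 : 0 < d by rewrite divr_gt0 //; lra.
  have hl : F [set T : bop | rn (l - bop_star T v) < d].
    by have /cvg_rnP/(_ d d0) := svalP (cid (hcs v)).
  have [T [/= /ltW h1 /ltW h2]] := filter_ex (filterI hl (LP u _ d0)).
  have -> : '[L u, v] - '[u, l] = '[L u - T u, v] - '[u, l - bop_star T v].
    by rewrite dotBl dotBr -bop_starP opprB addrA subrK.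
  rewrite (le_trans (rnD _ _)) // rnN.
  have h3 := Cauchy_Schwarz (L u - T u) v; have h4 := Cauchy_Schwarz u (l - bop_star T v).
  have h5 : rn (L u - T u) * rn v <= d * rn v by rewrite ler_wpM2r.
  have h6 : rn u * rn (l - bop_star T v) <= rn u * d by rewrite ler_wpM2l.
  have h7 : d * (rn u + rn v + 1) = e by rewrite /d divfK // gt_eqF //; lra.
  by lra.
apply/cvg_ex; exists (Bop Lb La); apply/cvg_rnP => e e0.
have e3 : 0 < e / 3 by rewrite divr_gt0.
have [U hU] := hF _ e3; apply: filterS (hU) => T /= UT.
rewrite (le_lt_trans (rn_triangle U _ _)) // rn_sub.
suff : rn (U - Bop Lb La) <= e / 3 by move: UT; lra.
by rewrite bop_rn; apply: opn_le => [|v]; [exact: ltW | rewrite bop_subE fin].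
Qed.
HB.instance Definition _ := Uniform_isComplete.Build bop bop_complete.

Lemma bop_mul_bounded S T : exists M : R, forall v, rn (S (T v)) <= M * rn v.
Proof.
exists (rn S * rn T) => v; rewrite (le_trans (rn_bop_le _ _)) //.
by rewrite -mulrA ler_wpM2l ?rn_ge0 // rn_bop_le.
Qed.
Lemma bop_mul_adjoint S T : exists T' : H -> H, adjoint_of (fun v => S (T v)) T'.
Proof. by exists (fun v => bop_star T (bop_star S v)) => u v; rewrite !bop_starP. Qed.
Definition bop_mul S T := Bop (bop_mul_bounded S T) (bop_mul_adjoint S T).

Lemma bop_mulA S T U : bop_mul S (bop_mul T U) = bop_mul (bop_mul S T) U.
Proof. exact: bopP. Qed.
Lemma bop_mulDl S T U : bop_mul (S + T) U = bop_mul S U + bop_mul T U.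
Proof. exact: bopP. Qed.
Lemma bop_mulDr S T U : bop_mul S (T + U) = bop_mul S T + bop_mul S U.
Proof. by apply: bopP => v /=; rewrite bopD. Qed.
Lemma bop_mulZl (k : R[i]) S T : bop_mul (k *: S) T = k *: bop_mul S T.
Proof. exact: bopP. Qed.
Lemma bop_mulZr (k : R[i]) S T : bop_mul S (k *: T) = k *: bop_mul S T.
Proof. by apply: bopP => v /=; rewrite bopZ. Qed.
Lemma bop_starD S T : bop_star (S + T) = bop_star S + bop_star T.
Proof.
by apply: bopP => v; apply: dot_ext => w; rewrite bop_addE dotDr -!bop_starP bop_addE dotDl.
Qed.
Lemma bop_starZ (k : R[i]) T : bop_star (k *: T) = k^* *: bop_star T.
Proof.
apply: bopP => v; apply: dot_ext => w;
  rewrite bop_scaleE dotZr -!bop_starP bop_scaleE dotZl.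
by congr (_ * _); exact/esym/conjcK.
Qed.
Lemma bop_starM S T : bop_star (bop_mul S T) = bop_mul (bop_star T) (bop_star S).
Proof.
by apply: bopP => v; apply: dot_ext => w; rewrite -bop_starP /= !bop_starP.
Qed.
Lemma bop_starK T : bop_star (bop_star T) = T.
Proof.
apply: bopP => v; apply: dot_ext => w.
by rewrite -bop_starP dotC -bop_starP -dotC.
Qed.
Lemma bop_normM S T : `|bop_mul S T| <= `|S| * `|T|.
Proof.
rewrite !rnE -rmorphM lecR; apply: opn_le => [|v]; first by rewrite mulr_ge0 ?rn_ge0.
by rewrite /= (le_trans (rn_bop_le _ _)) // -mulrA ler_wpM2l ?rn_ge0 // rn_bop_le.
Qed.
Lemma bop_norm_star T : `|bop_mul (bop_star T) T| = `|T| ^+ 2.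
Proof.
rewrite !rnE -rmorphXn /=; congr (_%:C); apply/eqP; rewrite eq_le; apply/andP; split.
  apply: opn_le => [|v]; first by rewrite sqr_ge0.
  rewrite /= (le_trans (bop_star_rn _ _)) // expr2 -mulrA ler_wpM2l ?rn_ge0 // rn_bop_le.
  by [].
(* The squared norm of [T v] is ['[bop_star T (T v), v]], at most [m * rn v ^+ 2], so [Num.sqrt m]
   bounds [T]. *)
set m := rn (bop_mul _ _).
have m0 : 0 <= m by exact: rn_ge0.
rewrite -[m]sqr_sqrtr // ler_pXn2r ?nnegrE ?rn_ge0 ?sqrtr_ge0 //.
apply: opn_le => [|v]; first exact: sqrtr_ge0.
rewrite -(@ler_pXn2r _ 2) ?nnegrE ?rn_ge0 ?mulr_ge0 ?sqrtr_ge0 ?rn_ge0 //.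
rewrite exprMn sqr_sqrtr // rn_sqrE bop_starP dotC.
have -> : complex.Re (Num.conj '[bop_star T (T v),
  v]) = complex.Re '[bop_mul (bop_star T) T v, v].
  by case: (hdot _ _ _).
rewrite (le_trans (Re_le_rn _)) // (le_trans (Cauchy_Schwarz _ _)) //.
by rewrite expr2 mulrA ler_wpM2r ?rn_ge0 // rn_bop_le.
Qed.

Definition bop_algebra : cstarAlgebra R :=
  @CStarAlgebra R bop bop_mul bop_star bop_mulA bop_mulDl bop_mulDr bop_mulZl bop_mulZr
   bop_starD bop_starZ bop_starM bop_starK bop_normM bop_norm_star.

Lemma bop_representation (A : cstarAlgebra R) (phi : A -> bop_algebra) :
  star_hom phi -> star_representation (fun a => bop_fun (phi a)).
Proof.
move=> h; split.
- move=> a; split; first exact: bop_linear.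
  by exists (rn (phi a)) => v; rewrite !rnE -rmorphM lecR rn_bop_le.
- by move=> a b v; rewrite (star_homD h).
- by move=> k a v; rewrite (star_homZ h).
- by move=> a b v; rewrite (star_homM h).
- move=> a u v; rewrite (star_hom_star h) /=.
  by rewrite (bop_starP (bop_star (phi a))) bop_starK.
Qed.

End Operators.

(** * Adjoints of bounded operators on square summable functions *)

Section Ell2Adjoint.
Variables (R : realType) (X : choiceType) (O : set X).
Local Notation H := (ell2_hilbert R O).
Local Notation "''[' u , v ]" := (hdot H u%R v%R).

(** The adjoint is written in coordinates: its value on [h] has the coordinate ['[h, T (D x)]] at
    [x]. Only summability requires work. *)
Lemma ell2_adjoint (T : H -> H) (M : R) : linear T -> (forall v, rn (T v) <= M * rn v) ->
  exists T' : H -> H, adjoint_of T T'.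
Proof.
move=> lT bT.
pose D := ell2_delta R O.
have M0 : 0 <= `|M| by [].
have bT' v : rn (T v) <= `|M| * rn v.
  by rewrite (le_trans (bT v)) // ler_wpM2r ?rn_ge0 // ler_norm.
have T0 : T 0 = 0.
  by have := lT 1 0 0; rewrite !scale1r addr0 => /(congr1 (fun z => z - T 0));
    rewrite subrr addrK.
have TD u v : T (u + v) = T u + T v by have := lT 1 u v; rewrite !scale1r.
have TZ k u : T (k *: u) = k *: T u by have := lT k u 0; rewrite T0 !addr0.
have Tsum (E : {fset X}) (c : X -> R[i]) : T (\sum_(x <- E) c x *: D x) = \sum_(x <- E) c
  x *: T (D x).
  by elim: (enum_fset E) => [|x s ih]; rewrite ?big_nil // !big_cons TD TZ ih.
pose g (h : H) x := '[h, T (D x)].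
have gout h x : ~ O x -> g h x = 0.
  move=> Ox; rewrite /g (_ : D x = 0) ?T0 ?dot0r //; apply: ell2P => y /=.
  by rewrite /delta_fun asboolF.
have gsum h : sqsummable (g h).
  exists (`|M| ^+ 2 * rn h ^+ 2) => E.
  (* The truncation of [g h] to [E], used as a test vector: ['[h, T u]] is the sum to be bounded,
     while [rn u ^+ 2] is at most that sum, so one factor [rn u] cancels. *)
  pose u : H := \sum_(x <- E) g h x *: D x.
  have E1 : '[h, T u] = (sqsum (g h) E)%:C.
    rewrite /u Tsum dot_sumr /sqsum rmorph_sum; apply: eq_bigr => x _.
    by rewrite dotZr mulrC; exact/esym/rn_sqr.
  have E2 : rn u ^+ 2 <= sqsum (g h) E.
    have uE y : u y = if y \in E then g h y else 0.
      have [Oy|Oy] := pselect (O y); last by rewrite ell2_out ?gout ?if_same.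
      rewrite /u ell2_sumE; case: ifP => yE.
        rewrite (big_fsetD1 y) //= big_seq big1 ?addr0.
          by rewrite /delta_fun asboolT // eqxx mulr1.
        move=> x; rewrite !inE => /andP[xy _].
        by rewrite /delta_fun eq_sym (negPf xy) andbF mulr0.
      rewrite big_seq big1 // => x xE; rewrite /= /delta_fun.
      case: eqP => [yx|]; last by rewrite andbF mulr0.
      by rewrite yx xE in yE.
    rewrite ell2_rn_sqr; apply: sqnorm_le => E'.
    rewrite [leLHS](big_fsetID _ (mem E)) /=.
    have -> : \sum_(x <- [fset x in E' | x \notin E]%fset) rn (u x) ^+ 2 = 0.
      rewrite big_seq big1 // => x.
      by rewrite !inE /= => /andP[_ /negPf xE]; rewrite uE xE rn0 expr0n.
    rewrite addr0.
    apply: (@le_trans _ _ (sqsum (g h) [fset x in E' | x \in E]%fset)).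
      by rewrite /sqsum le_eqVlt; apply/orP; left; apply/eqP; apply: eq_big_seq => x;
        rewrite !inE /= => /andP[_ xE]; rewrite uE xE.
    by apply: sqsum_mono; apply/fsubsetP => x; rewrite !inE /= => /andP[].
  have s0 := sqsum_ge0 (g h) E.
  have E3 : sqsum (g h) E <= rn h * (`|M| * rn u).
    have -> : sqsum (g h) E = rn '[h, T u] by rewrite E1 rn_real ger0_norm.
    by rewrite (le_trans (Cauchy_Schwarz _ _)) // ler_wpM2l ?rn_ge0.
  rewrite -exprMn.
  have E4 : rn u <= rn h * `|M|.
    have [u0|u0] := eqVneq (rn u) 0; first by rewrite u0 mulr_ge0 ?rn_ge0.
    have u1 : 0 < rn u by rewrite lt_neqAle rn_ge0 eq_sym u0.
    by rewrite -(ler_pM2r u1) -expr2 (le_trans E2) // -mulrA.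
  by have := ler_wpM2l (mulr_ge0 (rn_ge0 h) M0) E4; nra.
exists (fun h => Ell2 (gsum h) (@gout h)) => u v.
have cl : closed_subspace [set w : H | '[T w, v] - '[w, Ell2 (gsum v) (@gout v)] = 0].
  set v' : H := Ell2 _ _; split.
  - apply/closed_rnP => w hw /=; apply: rn_small => e e0.
    pose K := `|M| * rn v + rn v' + 1.
    have K0 : 0 < K by rewrite ltr_wpDl // addr_ge0 ?mulr_ge0 ?rn_ge0.
    have [|w' /= w'0 ww'] := hw (e / K); first by rewrite divr_gt0.
    have -> : '[T w, v] - '[w, v'] = '[T (w - w'), v] - '[w - w', v'].
      have TN : T (- w') = - T w' by rewrite -scaleN1r TZ scaleN1r.
      rewrite TD TN !dotBl.
      have -> : '[T w', v] = '[w', v'] by apply/eqP; rewrite -subr_eq0; apply/eqP.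
      by ring.
    rewrite (le_trans (rnD _ _)) // rnN.
    have h1 := le_trans (Cauchy_Schwarz (T (w - w')) v) (ler_wpM2r (rn_ge0 v) (bT' (w -
      w'))).
    have h2 := Cauchy_Schwarz (w - w') v'.
    have h3 : rn (w - w') * K <= e by rewrite -ler_pdivlMr // ltW.
    have h4 := rn_ge0 (w - w').
    rewrite /K in h3; nra.
  - by apply/eqP; rewrite subr_eq0 T0 (dot0l v) (dot0l v').
  - move=> a b a0 b0; suff : '[T (a + b), v] - '[a + b, v'] = 0 by [].
    by rewrite TD !dotDl opprD addrACA [X in X + _]a0 [X in _ + X]b0 addr0.
  - move=> k a a0; suff : '[T (k *: a), v] - '[k *: a, v'] = 0 by [].
    by rewrite TZ !dotZl -mulrBr [X in _ * X]a0 mulr0.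
have [_ tot] := ell2_orthonormal_basis R O.
have E := tot _ cl _.
suff : [set w : H | '[T w, v] - '[w, Ell2 (gsum v) (@gout v)] = 0] u.
  by move=> h; apply/eqP; rewrite -subr_eq0; apply/eqP; exact: h.
rewrite E // => x Ox; suff : '[T (D x), v] - '[D x, Ell2 (gsum v) (@gout v)] = 0 by [].
by rewrite delta_dot //= /g -dotC subrr.
Qed.

End Ell2Adjoint.

(** * Local homeomorphisms *)

(** If [P K] failed, the sets containing some [K] minus [C] with [P C] would form a proper filter; a
    neighbourhood satisfying [P] of a cluster point in [K] contradicts this. *)
Lemma compact_induction (T : topologicalType) (P : set T -> Prop) (K : set T) :
  P set0 -> (forall A B, A `<=` B -> P B -> P A) ->
  (forall A B, P A -> P B -> P (A `|` B)) -> compact K ->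
  (forall x, K x -> exists2 V, nbhs x V & P V) -> P K.
Proof.
move=> P0 Psub PU cK hK; apply: contrapT => nPK.
pose F : set_system T := [set B | exists2 C, P C & K `\` C `<=` B].
have FF : ProperFilter F.
  split.
    move=> [C PC KC]; apply: nPK; apply: Psub PC => x Kx; apply: contrapT => Cx.
    exact: (KC x).
  split.
  - by exists set0.
  - move=> A B [C PC KA] [D PD KB]; exists (C `|` D); first exact: PU.
    by move=> x [Kx CDx]; split; [apply: KA|apply: KB]; split=> // ?; apply: CDx;
      [left|right].
  - by move=> A B AB [C PC KA]; exists C => //; apply: subset_trans AB.
have [|x [Kx clx]] := cK F FF; first by exists set0 => // x [].
have [V nV PV] := hK x Kx.
have [|z [/= [Kz Vz] Vz']] := clx (K `\` V) V _ nV; first by exists V.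
by [].
Qed.

Lemma near_seq (T : topologicalType) (I : eqType) (y : T) (l : seq I) (Q : I -> T -> Prop) :
  (forall z, z \in l -> \forall y' \near y, Q z y') ->
  \forall y' \near y, forall z, z \in l -> Q z y'.
Proof.
elim: l => [|a l ih] h; first exact: nearW.
have : \forall y' \near y, forall z, z \in l -> Q z y'.
  by apply: ih => z zl; apply: h; rewrite inE zl orbT.
apply: filterS2 (h a (mem_head _ _)) => y' Qa Ql z; rewrite inE => /orP[/eqP ->//|];
  exact: Ql.
Qed.

Section Dynamics.
Variables (R : realType) (S : sgds).
Implicit Types (x y z : S) (n m k : nat).
Local Notation s := (sg_map S).
Local Notation U := (sg_dom S).
Local Notation Un := (sg_iter_dom S).

Lemma iter_domS n x : Un n.+1 x <-> U x /\ Un n (s x).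
Proof.
elim: n => [|n ih] /=; first by split=> [[_]|[]].
split=> [[[h1 h2] h3]|[h1 [h2 h3]]].
  have [|h4 h5] := ih.1; first by split.
  by split=> //; split=> //; rewrite -iterSr.
by split; [apply/ih | move: h3; rewrite -iterSr].
Qed.

Lemma iter_domD n m x : Un (n + m) x <-> Un m x /\ Un n (iter m s x).
Proof.
elim: n => [|n ih] /=; first by rewrite add0n; split=> [|[]].
rewrite ih iterD; tauto.
Qed.

Lemma iter_dom_le n m x : (n <= m)%N -> Un m x -> Un n x.
Proof. by move=> nm; rewrite -(subnK nm) iter_domD => -[]. Qed.

Lemma local_section x : U x -> exists g : S -> S,
  [/\ g (s x) = x, {for s x, continuous g} &
      \forall w \near s x, U (g w) /\ s (g w) = w].
Proof.
move=> Ux; have [V [oV Vx VU osV [g [gK sc gc]]]] := sg_local_homeo Ux.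
have sVx : (s @` V) (s x) by exists x.
have gsx v : V v -> g (s v) = v by move=> Vv; apply: gK; exact/mem_set.
exists g; split; first exact: gsx.
  by have := gc; rewrite (continuous_open_subspace g osV); apply; exact/mem_set.
apply: filterS (open_nbhs_nbhs (conj osV sVx)) => _ [v Vv <-].
by rewrite gsx //; split=> //; exact: VU.
Qed.

Lemma map_continuous x : U x -> {for x, continuous s}.
Proof.
move=> Ux; have [V [oV Vx VU osV [g [gK sc gc]]]] := sg_local_homeo Ux.
by have := sc; rewrite (continuous_open_subspace s oV); apply; exact/mem_set.
Qed.

Lemma map_locally_injective x : U x ->
  exists2 V : set S, nbhs x V & forall y z, V y -> V z -> s y = s z -> y = z.
Proof.
move=> Ux; have [V [oV Vx VU osV [g [gK sc gc]]]] := sg_local_homeo Ux.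
exists V; first exact: open_nbhs_nbhs.
by move=> y z Vy Vz e; rewrite -[y]gK ?e ?gK //; exact/mem_set.
Qed.

Lemma near_dom x : U x -> \forall y \near x, U y.
Proof. by move=> Ux; apply: open_nbhs_nbhs; split=> //; exact: sg_dom_open. Qed.

Lemma iter_continuous n x : Un n x -> {for x, continuous (iter n s)}.
Proof.
elim: n => [|n ih] //=; first by move=> _; exact: cvg_id.
move=> [h1 h2]; apply: (@continuous_comp _ _ _ (iter n s) s); first exact: ih.
exact: map_continuous.
Qed.

Lemma near_iter_dom n x : Un n x -> \forall y \near x, Un n y.
Proof.
elim: n => [|n ih] /=; first by move=> _; exact: nearW.
move=> [h1 h2]; apply: filterI; first exact: ih.
by apply: (iter_continuous h1); exact: near_dom.
Qed.

Lemma iter_locally_injective n x : Un n x ->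
  exists2 V : set S, nbhs x V &
    forall y z, V y -> V z -> iter n s y = iter n s z -> y = z.
Proof.
elim: n => [|n ih] /=; first by exists setT => //; exact: filterT.
move=> [h1 h2]; have [V nV hV] := ih h1; have [W nW hW] := map_locally_injective h2.
exists (V `&` (iter n s @^-1` W)).
  by apply: filterI => //; exact: (iter_continuous h1).
by move=> y z [Vy Wy] [Vz Wz] /hW e; apply: hV => //; apply: e.
Qed.

Lemma iter_section n x : Un n x -> exists g : S -> S,
  [/\ g (iter n s x) = x, {for iter n s x, continuous g} &
      \forall w \near iter n s x, Un n (g w) /\ iter n s (g w) = w].
Proof.
elim: n => [|n ih] /=.
  by move=> _; exists id; split; [ | exact: cvg_id | exact: nearW].
move=> [h1 h2]; have [g [gx gc gn]] := ih h1; have [f [fx fc fn]] := local_section h2.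
exists (g \o f); split => /=; first by rewrite fx.
  by apply: continuous_comp; [exact: fc | rewrite fx].
have : \forall w \near s (iter n s x), Un n (g (f w)) /\ iter n s (g (f w)) = f w.
  by apply: (fc [set v | Un n (g v) /\ iter n s (g v) = v]); rewrite /= fx.
by apply: filterS2 fn => w [Ufw sfw] [Ug ig]; rewrite ig.
Qed.

Lemma near_neq (T : topologicalType) (f g : T -> S) (a : T) :
  {for a, continuous f} -> {for a, continuous g} -> f a <> g a ->
  \forall b \near a, f b <> g b.
Proof.
move=> fc gc; apply: contra_notP => h.
apply: (@sg_hausdorff S) => A B nA nB.
have h1 : \forall b \near a, B (g b) by exact: gc.
have h2 : \forall b \near a, A (f b) by exact: fc.
apply: contrapT => AB; apply: h; apply: filterS2 h1 h2 => b Bb Ab e.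
by apply: AB; exists (f b); split=> //=; rewrite e.
Qed.

Lemma near_disjoint x y : x <> y ->
  exists A B : set S, [/\ nbhs x A, nbhs y B & forall z, A z -> B z -> False].
Proof.
move=> xy; apply: contrapT => h; apply: xy; apply: (@sg_hausdorff S) => A B nA nB.
apply: contrapT => AB; apply: h; exists A, B; split=> // z Az Bz.
by apply: AB; exists z.
Qed.

Lemma compact_fiber_finite (K : set S) x : compact K -> K `<=` U ->
  finite_set (K `&` sg_fiber x).
Proof.
move=> cK KU.
apply: (@compact_induction S (fun A => finite_set (A `&` sg_fiber x)) K) => //.
- by rewrite set0I.
- by move=> A B AB; apply: sub_finite_set; exact: setSI.
- by move=> A B hA hB; rewrite setIUl finite_setU.
- move=> y Ky; have [V nV hV] := map_locally_injective (KU _ Ky); exists V => //.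
  have [[z [Vz [Uz sz]]]|ne] := pselect (exists z, (V `&` sg_fiber x) z).
    apply: (@sub_finite_set _ _ [set z]) => // w [Vw [Uw sw]] /=.
    by apply: hV => //; rewrite sw sz.
  by apply: (@sub_finite_set _ _ set0) => // w hw; apply: ne; exists w.
Qed.

Lemma sections : exists sec : S -> S -> S, forall z, U z ->
  [/\ sec z (s z) = z, {for s z, continuous (sec z)} &
      \forall w \near s z, U (sec z w) /\ s (sec z w) = w].
Proof.
have h z : exists g : S -> S, U z ->
  [/\ g (s z) = z, {for s z, continuous g} & \forall w \near s z, U (g w) /\ s (g w) = w].
  have [Uz|nU] := pselect (U z); last by exists id.
  by have [g hg] := local_section Uz; exists g.
by exists (fun z => sval (cid (h z))) => z Uz; exact: (svalP (cid (h z))).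
Qed.

(** One branch of the inverse of [sigma] through each point of the domain is fixed for good, so that
    sums over nearby fibers can be indexed by a single list. *)
Definition sec : S -> S -> S := sval (cid sections).

Lemma secP z : U z ->
  [/\ sec z (s z) = z, {for s z, continuous (sec z)} &
      \forall w \near s z, U (sec z w) /\ s (sec z w) = w].
Proof. exact: svalP (cid sections) z. Qed.

(** Near a point of [K] over [y], local injectivity leaves only the branch through it; near any
    other point of [K], the Hausdorff property keeps [sigma] away from [y]. Compactness joins the
    two cases. *)
Lemma compact_fiber_sections (K : set S) y : compact K -> K `<=` U ->
  \forall y' \near y, forall z', K z' -> s z' = y' ->
    exists2 z, (K `&` sg_fiber y) z & z' = sec z y'.
Proof.
move=> cK KU.
pose P (V : set S) := \forall y' \near y, forall z', (V `&` K) z' -> s z' = y' ->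
    exists2 z, (K `&` sg_fiber y) z & z' = sec z y'.
suff : P K by rewrite /P; apply: filterS => y' h z' Kz'; apply: h.
apply: (@compact_induction S P K) => //.
- by apply: nearW => y' z' [].
- by move=> A B AB; rewrite /P; apply: filterS => y' h z' [Az Kz]; apply: h; split=> //;
  exact: AB.
- move=> A B; rewrite /P; apply: filterS2 => y' hA hB z' [[Az|Bz] Kz];
  [exact: hA|exact: hB].
move=> x Kx; have Ux := KU _ Kx.
have [sxy|sxy] := pselect (s x = y).
  have [secx secc secn] := secP Ux; rewrite sxy in secx secc secn.
  have [V nV hV] := map_locally_injective Ux; exists V => //.
  have : \forall y' \near y, V (sec x y') by apply: secc; rewrite secx.
  apply: filterS2 secn => y' [Us ss] Vs z' [Vz' Kz'] sz'; exists x => //.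
  by apply: hV => //; rewrite ss.
have [A [B [nA nB AB]]] := near_disjoint sxy.
exists (s @^-1` A); first exact: map_continuous.
by apply: filterS nB => y' By' z' [Az' _] sz'; case: (AB (s z')) => //; rewrite sz'.
Qed.

(* The finite fiber of [y] in [K] moves continuously with [y], and no further
   points of [K] appear. *)
Lemma near_fiber_sum (K : set S) y : compact K -> K `<=` U ->
  exists L : seq S, [/\ uniq L, (forall z, z \in L <-> K z /\ sg_fiber y z),
    (forall (V : lmodType R[i]) (F : S -> V), (forall z, ~ K z -> F z = 0) ->
       \sum_(z \in sg_fiber y) F z = \sum_(z <- L) F z) &
    \forall y' \near y, forall (V : lmodType R[i]) (F : S -> V), (forall z,
      ~ K z -> F z = 0) ->
       \sum_(z \in sg_fiber y') F z = \sum_(z <- L) F (sec z y')].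
Proof.
move=> cK KU; have fin := compact_fiber_finite y cK KU.
pose L := enum_fset (fset_set (K `&` sg_fiber y)).
have LP z : z \in L <-> (K `&` sg_fiber y) z.
  by rewrite /L in_fset_set //; split; [exact: set_mem | exact: mem_set].
exists L; split=> [|//|V F F0|].
- exact: fset_uniq.
- rewrite (fsbigE L) ?fset_uniq //.
  + by rewrite big_seq_cond [RHS]big_seq; apply: eq_bigl => z;
    apply/andb_idr => /LP[_ ?]; exact/mem_set.
  + by move=> z /= /LP[].
  + move=> z fz; have [Kz|/F0//] := pselect (K z).
    by move/negP; case; apply/LP.
have hs : \forall y' \near y, forall z, z \in L -> U (sec z y') /\ s (sec z y') = y'.
  by apply: near_seq => z /LP[Kz [Uz sz]]; have [_ _] := secP Uz; rewrite sz.
(* Distinct branches keep distinct values near [y], so moving the fiber creates no repetition in the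
   list. *)
have hd : \forall y' \near y, forall z, z \in L -> forall w,
  w \in L -> sec z y' = sec w y' -> z = w.
  apply: near_seq => z /LP[Kz [Uz sz]]; apply: near_seq => w /LP[Kw [Uw sw]].
  have [->|zw] := eqVneq z w; first exact: nearW.
  have [secz secc _] := secP Uz; have [secw secc' _] := secP Uw.
  rewrite sz in secz secc; rewrite sw in secw secc'.
  have : \forall y' \near y, sec z y' <> sec w y'.
    by apply: near_neq => //; rewrite secz secw; exact/eqP.
  by apply: filterS => y' ne /ne.
apply: filterS3 hs hd (compact_fiber_sections y cK KU) => y' h1 h2 h3 V F F0.
have uL : uniq [seq sec z y' | z <- L].
  by rewrite map_inj_in_uniq ?fset_uniq // => z w zL wL; exact: h2.
rewrite (fsbigE [seq sec z y' | z <- L]) //.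
- rewrite -(big_map (fun z => sec z y') xpredT) big_seq_cond [RHS]big_seq.
  apply: eq_bigl => z; apply/andb_idr => /mapP[w wL ->]; apply/mem_set.
  exact: h1.
- by move=> _ /= /mapP[w wL ->]; exact: h1.
- move=> z [Uz sz] nz; apply: F0 => Kz; move/negP: nz; apply.
  by have [w hw ->] := h3 z Kz sz; apply: map_f; apply/LP.
Qed.
End Dynamics.

(** * Existence of the orbit representations *)

Section OrbitSet.
Variables (S : sgds) (x0 : S).
Local Notation s := (sg_map S).
Local Notation U := (sg_dom S).

Lemma orbit_map x : U x -> orbit_set x0 x <-> orbit_set x0 (s x).
Proof.
move=> Ux; split=> [[n [m [nx mx e]]]|[n [m [nx mx e]]]]; last first.
  by exists n.+1, m; split=> //; [apply/iter_domS | rewrite iterSr].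
case: n nx e => [|n] nx e; last first.
  by exists n, m; split=> //; [have /iter_domS[] := nx | rewrite -iterSr].
exists 0%N, m.+1; split=> //=; last by rewrite -e.
by split=> //; rewrite -e.
Qed.

Lemma orbit_fiber x y : orbit_set x0 x -> sg_fiber x y -> orbit_set x0 y.
Proof. by move=> Ox [Uy sy]; apply/(orbit_map Uy); rewrite sy. Qed.
End OrbitSet.

Section CompactSupport.
Variables (R : realType) (X : topologicalType).

Lemma Cc_C0 (V : set X) (f : X -> R[i]) : Cc V f -> C0 f.
Proof.
move=> [fc [K [cK KV K0]]]; split=> // e e0; exists K; split=> // x /K0 ->.
by rewrite normr0 ltcR.
Qed.

Lemma C0_bounded (f : X -> R[i]) : C0 f -> exists C, forall x, rn (f x) <= C.
Proof.
move=> [fc /(_ 1 ltr01)[K [cK hK]]].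
have [C hC] : exists C, forall x, K x -> rn (f x) <= C.
  apply: (@compact_induction X (fun V => exists C, forall x, V x -> rn (f x) <= C) K) => //.
  - by exists 0.
  - by move=> A B AB [C hC]; exists C => x /AB/hC.
  - move=> A B [C hC] [D hD]; exists (Num.max C D) => x [/hC|/hD] h;
      by rewrite le_max h ?orbT.
  - move=> x Kx; have /continuous_rnP/(_ 1 ltr01) h := fc x.
    exists [set y | rn (f x - f y) < 1] => //; exists (rn (f x) + 1) => y /= hy.
    rewrite -[f y](subrK (f x)) (le_trans (rnD _ _)) // addrC lerD2l rn_sub; exact: ltW.
exists (Num.max C 1) => x; have [Kx|/hK] := pselect (K x).
  by rewrite le_max hC.
by rewrite rnE ltcR le_max => /ltW ->; rewrite orbT.
Qed.

Lemma Cc_add (V : set X) (f g : X -> R[i]) : Cc V f -> Cc V g -> Cc V (fun x => f x + g x).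
Proof.
move=> [fc [K [cK KV K0]]] [gc [L [cL LV L0]]]; split.
  by move=> x; exact: (cvgD (fc x) (gc x)).
exists (K `|` L); split; first exact: compactU.
  by move=> x [/KV|/LV].
move=> x KL; rewrite K0 ?L0 ?addr0 // => h; apply: KL; [by right|by left].
Qed.

Lemma Cc_scale (V : set X) (f : X -> R[i]) k : Cc V f -> Cc V (fun x => k * f x).
Proof.
move=> [fc [K [cK KV K0]]]; split; first by move=> x; apply: cvgMr; exact: fc.
by exists K; split=> // x /K0 ->; rewrite mulr0.
Qed.

Lemma Cc_sub (V W : set X) (f : X -> R[i]) : V `<=` W -> Cc V f -> Cc W f.
Proof.
move=> VW [fc [K [cK KV K0]]]; split=> //; exists K; split=> //.
exact: subset_trans VW.
Qed.
End CompactSupport.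

(** * The generators acting on square summable functions on an orbit *)

Section OrbitOperators.
Variables (R : realType) (S : sgds) (x0 : S) (g0 : R[i]).
Hypothesis g01 : circle R g0.
Local Notation s := (sg_map S).
Local Notation U := (sg_dom S).
Local Notation O := (orbit_set x0).
Local Notation H := (ell2_hilbert R O).
Local Notation D := (ell2_delta R O).
Local Notation "''[' u , v ]" := (hdot H u%R v%R).

Lemma g0_conj : g0 * Num.conj g0 = 1.
Proof. by rewrite -rn_sqr (circleP g0).1 // expr1n. Qed.

Definition bounded_on_orbit (f : S -> R[i]) := exists C, forall x, O x -> rn (f x) <= C.

Lemma mult_sqsum f : bounded_on_orbit f -> exists2 C, 0 <= C &
  forall (h : H) E, sqsum (fun x => f x * h x) E <= C ^+ 2 * sqsum h E.
Proof.
move=> [C hC]; exists `|C| => // h E; rewrite /sqsum mulr_sumr; apply: ler_sum => x _.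
rewrite rnM exprMn.
have [Ox|Ox] := pselect (O x); last by rewrite ell2_out // rn0 expr0n !mulr0.
rewrite ler_wpM2r ?sqr_ge0 // ler_pXn2r ?nnegrE ?rn_ge0 //.
by rewrite (le_trans (hC x Ox)) ?ler_norm.
Qed.

Lemma mult_sqsummable f (h : H) : bounded_on_orbit f -> sqsummable (fun x => f x * h x).
Proof.
move=> /mult_sqsum[C C0 hC]; exists (C ^+ 2 * sqnorm h) => E;
  rewrite (le_trans (hC h E)) //.
by rewrite ler_wpM2l ?sqr_ge0 // sqsum_le_sqnorm //; exact: ell2_summable.
Qed.

Lemma mult_out f (h : H) x : ~ O x -> f x * h x = 0.
Proof. by move=> Ox; rewrite ell2_out ?mulr0. Qed.

Definition mult_fun f (hf : bounded_on_orbit f) (h : H) : H :=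
  Ell2 (mult_sqsummable h hf) (@mult_out f h).

Lemma mult_bounded f (hf : bounded_on_orbit f) :
  exists M : R, forall h, rn (mult_fun hf h) <= M * rn h.
Proof.
have [C C0 hC] := mult_sqsum hf; exists C => h.
rewrite -(@ler_pXn2r _ 2) ?nnegrE ?mulr_ge0 ?rn_ge0 // ell2_rn_sqr exprMn ell2_rn_sqr.
apply: sqnorm_le => E; rewrite (le_trans (hC h E)) // ler_wpM2l ?sqr_ge0 //.
by apply: sqsum_le_sqnorm; exact: ell2_summable.
Qed.

Lemma mult_linear f (hf : bounded_on_orbit f) : linear (mult_fun hf).
Proof. by move=> k u v; apply: ell2P => x; rewrite ell2DE ell2ZE /= mulrDr mulrCA. Qed.

Lemma mult_adjoint f (hf : bounded_on_orbit f) :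
  exists T' : H -> H, adjoint_of (mult_fun hf) T'.
Proof. by have [M hM] := mult_bounded hf; apply: ell2_adjoint (mult_linear hf) hM. Qed.

(* [op0] and [op1] are zero on functions that do not define bounded operators. *)
Definition op0 (f : S -> R[i]) : bop_algebra H :=
  if pselect (bounded_on_orbit f) is left hf then Bop (mult_bounded hf) (mult_adjoint hf)
  else 0.

Lemma op0E f (h : H) x : bounded_on_orbit f -> (op0 f h : H) x = f x * h x.
Proof. by rewrite /op0; case: pselect. Qed.

(** Coordinates of the action of [t1 xi]: the fiber sums over basis vectors become a weighted
    composition with [sigma]. *)
Definition comp_fun (xi : S -> R[i]) (h : H) (y : S) : R[i] :=
  if `[< U y >] then g0 * xi y * h (s y) else 0.

Definition comp_bounded_by (xi : S -> R[i]) :=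
  exists2 M : R, 0 <= M & forall (h : H) E, sqsum (comp_fun xi h) E <= M ^+ 2 * sqnorm h.

Lemma comp_sqsummable xi (h : H) : comp_bounded_by xi -> sqsummable (comp_fun xi h).
Proof. by move=> [M M0 hM]; exists (M ^+ 2 * sqnorm h). Qed.

Lemma comp_out xi (h : H) y : ~ O y -> comp_fun xi h y = 0.
Proof.
rewrite /comp_fun => Oy; case: asboolP => // Uy.
by rewrite [X in _ * X]ell2_out ?mulr0 // => /(orbit_map x0 Uy).
Qed.

Definition comp_op (xi : S -> R[i]) (hx : comp_bounded_by xi) (h : H) : H :=
  Ell2 (comp_sqsummable h hx) (@comp_out xi h).

Lemma comp_bounded xi (hx : comp_bounded_by xi) :
  exists M : R, forall h, rn (comp_op hx h) <= M * rn h.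
Proof.
have [M M0 hM] := hx; exists M => h; rewrite -(@ler_pXn2r _ 2) ?nnegrE ?mulr_ge0 ?rn_ge0 //.
by rewrite ell2_rn_sqr exprMn ell2_rn_sqr; apply: sqnorm_le => E; exact: hM.
Qed.

Lemma comp_linear xi (hx : comp_bounded_by xi) : linear (comp_op hx).
Proof.
move=> k u v; apply: ell2P => x; rewrite ell2DE ell2ZE /= /comp_fun.
by case: asboolP => _; rewrite ?mulr0 ?addr0 // ell2DE ell2ZE mulrDr mulrCA.
Qed.

Lemma comp_adjoint xi (hx : comp_bounded_by xi) :
  exists T' : H -> H, adjoint_of (comp_op hx) T'.
Proof. by have [M hM] := comp_bounded hx; apply: ell2_adjoint (comp_linear hx) hM. Qed.

Definition op1 (xi : S -> R[i]) : bop_algebra H :=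
  if pselect (comp_bounded_by xi) is left hx then Bop (comp_bounded hx) (comp_adjoint hx)
  else 0.

Lemma Cc_comp_bounded xi : Cc U xi -> comp_bounded_by xi.
Proof.
move=> [xc [K [cK KU K0]]].
(* The part of the norm carried by [V]. Compact induction reduces its bound to small sets, on which
   [sigma] is injective and [xi] is bounded. *)
pose P (V : set S) := exists2 M : R, 0 <= M & forall (h : H) (E : {fset S}),
  \sum_(y <- E | `[< V y >]) rn (comp_fun xi h y) ^+ 2 <= M ^+ 2 * sqnorm h.
have : P K.
  apply: (@compact_induction S P K) => //.
  - by exists 0 => // h E; rewrite big_pred0 ?expr0n ?mul0r // => y; apply/asboolP.
  - move=> A B AB [M M0 hM]; exists M => // h E; apply: le_trans (hM h E).
    rewrite big_mkcond [leRHS]big_mkcond; apply: ler_sum => y _.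
    case: asboolP => Ay; case: asboolP => By //; first by case: By; exact: AB.
    exact: sqr_ge0.
  - move=> A B [M M0 hM] [N N0 hN]; exists (M + N); first exact: addr_ge0.
    move=> h E; have n0 : 0 <= sqnorm h by apply: sqnorm_ge0; exact: ell2_summable.
    apply: (@le_trans _ _ (M ^+ 2 * sqnorm h + N ^+ 2 * sqnorm h)).
      apply: le_trans (lerD (hM h E) (hN h E)).
      rewrite big_mkcond [X in X + _]big_mkcond [X in _ + X]big_mkcond -big_split /=.
      apply: ler_sum => y _; have := sqr_ge0 (rn (comp_fun xi h y)).
      case: asboolP => ABy; case: asboolP => Ay; case: asboolP => By c0;
        rewrite ?addr0 ?add0r ?lerDl ?addr_ge0 //.
      by case: ABy.
    by rewrite -mulrDl ler_wpM2r //; nra.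
  move=> x Kx; have [V nV hV] := map_locally_injective (KU _ Kx).
  have /continuous_rnP/(_ 1 ltr01) nW := xc x.
  exists (V `&` [set y | rn (xi x - xi y) < 1]); first exact: filterI.
  have c0 : 0 <= rn (xi x) + 1 by rewrite addr_ge0 ?rn_ge0.
  exists (rn (xi x) + 1) => // h E.
  set W := V `&` _.
  pose E' := [fset y in E | `[< W y >]]%fset.
  have E'W y : y \in E' -> W y by rewrite !inE /= => /andP[_ /asboolP].
  have -> : \sum_(y <- E | `[< W y >]) rn (comp_fun xi h y) ^+ 2 =
      \sum_(y <- E') rn (comp_fun xi h y) ^+ 2.
    by rewrite big_fset_condE.
  apply: (@le_trans _ _ ((rn (xi x) + 1) ^+ 2 * \sum_(y <- E') rn (h (s y)) ^+ 2)).
    rewrite mulr_sumr big_seq [leRHS]big_seq; apply: ler_sum => y /E'W[_ /= hy].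
    rewrite /comp_fun; case: asboolP => _; last by rewrite rn0 expr0n mulr_ge0 ?sqr_ge0.
    rewrite !rnM (circleP g0).1 // mul1r exprMn ler_wpM2r ?sqr_ge0 //.
    rewrite ler_pXn2r ?nnegrE ?rn_ge0 //.
    rewrite -[xi y](subrK (xi x)) (le_trans (rnD _ _)) // addrC lerD2l rn_sub; exact: ltW.
  rewrite ler_wpM2l ?sqr_ge0 //.
  (* Injectivity of [sigma] on [V] reindexes the sum by the image points, each counted once. *)
  have -> : \sum_(y <- E') rn (h (s y)) ^+ 2 = sqsum h [fset s y | y in E']%fset.
    move: E' E'W => E' E'W.
    by rewrite /sqsum big_imfset //= => y z /E'W[Vy _] /E'W[Vz _]; exact: hV.
  by apply: sqsum_le_sqnorm; exact: ell2_summable.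
move=> [M M0 hM]; exists M => // h E; apply: le_trans (hM h E).
rewrite /sqsum [leRHS]big_mkcond; apply: ler_sum => y _.
case: asboolP => // /K0 xy; rewrite /comp_fun xy mulr0 mul0r if_same rn0 expr0n.
by [].
Qed.

Lemma op1E xi (h : H) y : Cc U xi ->
  (op1 xi h : H) y = if `[< U y >] then g0 * xi y * h (s y) else 0.
Proof. by move=> /Cc_comp_bounded; rewrite /op1; case: pselect. Qed.

Lemma C0_orbit f : C0 f -> bounded_on_orbit f.
Proof. by move=> /C0_bounded[C hC]; exists C. Qed.

Lemma op0_delta f x : bounded_on_orbit f -> O x -> op0 f (D x) = f x *: (D x : H).
Proof.
move=> hf Ox; apply: ell2P => y; rewrite op0E // ell2ZE !ell2_deltaE //.
by case: eqP => [->|]; rewrite ?mulr0.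
Qed.

Lemma op1_delta xi x : Cc U xi -> O x ->
  op1 xi (D x) = g0 *: (\sum_(y \in sg_fiber x) (xi y *: (D y : H))).
Proof.
move=> hx Ox; have [xc [K [cK KU K0]]] := hx.
have [L [uL LP sumL _]] := near_fiber_sum R x cK KU.
rewrite sumL; last by move=> y /K0 ->; rewrite scale0r.
have LO y : y \in L -> O y by move=> /LP[_]; exact: orbit_fiber.
apply: ell2P => y; rewrite op1E // ell2ZE ell2_sumE.
have -> : \sum_(i <- L) (xi i *: (D i : H)) y = \sum_(i <- L) (if i == y then xi y else 0).
  apply: eq_big_seq => i /LO Oi; rewrite ell2ZE ell2_deltaE // eq_sym.
  by case: eqP => [->|]; rewrite ?mulr1 ?mulr0.
have [yL|yL] := boolP (y \in L).
  rewrite (bigD1_seq y) //= eqxx big1 ?addr0; last by move=> i /negPf ->.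
  have /LP[_ [Uy sy]] := yL; rewrite asboolT // sy /delta_fun asboolT // eqxx mulr1.
  by [].
rewrite big1_seq ?mulr0; last first.
  by move=> i /andP[_ iL]; case: eqP => // iy; rewrite iy (negPf yL) in iL.
case: asboolP => // Uy; rewrite ell2_deltaE //; case: eqP => [sy|]; last by rewrite mulr0.
have [Ky|/K0 ->] := pselect (K y); last by rewrite mulr0 mul0r.
by move/negP: yL; case; apply/LP.
Qed.

Lemma orbit_relations : sgds_relations op0 op1.
Proof.
have basis := ell2_orthonormal_basis R O.
split.
- move=> f g hf hg; apply: bopP => v; apply: ell2P => x.
  have h : bounded_on_orbit (fun x => f x + g x).
    have [C hC] := C0_orbit hf; have [C' hC'] := C0_orbit hg; exists (C + C') => y Oy.
    by rewrite (le_trans (rnD _ _)) // lerD ?hC ?hC'.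
  rewrite op0E // bop_addE ell2DE !op0E ?mulrDl //; exact: C0_orbit.
- move=> k f hf; apply: bopP => v; apply: ell2P => x.
  have h : bounded_on_orbit (fun x => k * f x).
    have [C hC] := C0_orbit hf; exists (rn k * C) => y Oy.
    by rewrite rnM ler_wpM2l ?rn_ge0 ?hC.
  by rewrite op0E // bop_scaleE ell2ZE !op0E ?mulrA //; exact: C0_orbit.
- move=> f g hf hg; apply: bopP => v; apply: ell2P => x.
  have h : bounded_on_orbit (fun x => f x * g x).
    have [C hC] := C0_orbit hf; have [C' hC'] := C0_orbit hg; exists (C * C') => y Oy.
    by rewrite rnM ler_pM ?rn_ge0 ?hC ?hC'.
  by rewrite op0E //= !op0E ?mulrA //; exact: C0_orbit.
- move=> f hf; apply: bopP => v; apply: (orthonormal_basis_ext basis) => x Ox.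
  have h : bounded_on_orbit (fun x => Num.conj (f x)).
    by have [C hC] := C0_orbit hf; exists C => y Oy; rewrite rn_conj hC.
  rewrite -(bop_starP (op0 f)) op0_delta //; last exact: C0_orbit.
  by rewrite dotZl !delta_dot // op0E // rmorphM; congr (_ * _); exact: conjCK.
- move=> f g hf hg; apply: bopP => v; apply: ell2P => y.
  have h : Cc U (fun x => f x + g x).
    exact: Cc_add.
  rewrite bop_addE ell2DE !op1E //; case: asboolP => _; last by rewrite addr0.
  by rewrite mulrDr mulrDl.
- move=> k f hf; apply: bopP => v; apply: ell2P => y.
  have h : Cc U (fun x => k * f x).
    exact: Cc_scale.
  rewrite bop_scaleE ell2ZE !op1E //; case: asboolP => _; last by rewrite mulr0.
  by rewrite mulrCA !mulrA.
- move=> xi eta hxi heta.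
  have [xc [K [cK KU K0]]] := hxi.
  have inner v z : O z -> '[op1 xi (D z), op1 eta v] = Num.conj (Cc_inner xi eta z * v z).
    move=> Oz; rewrite op1_delta //.
    have [L [uL LP sumL _]] := near_fiber_sum R z cK KU.
    rewrite sumL; last by move=> y /K0 ->; rewrite scale0r.
    have [L' [uL' LP' sumL' _]] := near_fiber_sum R z cK KU.
    have -> : Cc_inner xi eta z = \sum_(y <- L) Num.conj (xi y) * eta y.
      rewrite /Cc_inner (sumL' R[i]^o); last by move=> y /K0 ->; rewrite rmorph0 mul0r.
      by apply: perm_big; apply: uniq_perm => // y; apply/idP/idP => [/LP'/LP|/LP/LP'].
    rewrite dotZl dot_suml mulr_suml rmorph_sum mulr_sumr;
      apply: eq_big_seq => y /LP[Ky [Uy sy]].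
    rewrite dotZl delta_dot; last by apply: (orbit_fiber Oz).
    rewrite op1E // asboolT // sy.
    transitivity (Num.conj (Num.conj (xi y)) * Num.conj (eta y) * Num.conj (v z));
      last by rewrite !rmorphM.
    rewrite conjCK !rmorphM /= -[RHS]mul1r -g0_conj.
    by rewrite (mulrC (xi y)) mulrA [RHS]mulrC !mulrA; ring.
  (* The identity [inner] at [v = D z] exhibits the value of [Cc_inner] as a matrix coefficient,
     bounded by operator norms. *)
  have h : bounded_on_orbit (Cc_inner xi eta).
    exists (rn (op1 xi) * rn (op1 eta)) => z Oz.
    have := inner (D z) z Oz; rewrite ell2_deltaE // eqxx mulr1 => E.
    have dn : rn (D z : H) = 1.
      by apply/eqP; rewrite -(@eqrXn2 _ 2) ?rn_ge0 // rn_sqrE dot_delta // ell2_deltaE //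
        eqxx expr1n.
    rewrite -rn_conj -E (le_trans (Cauchy_Schwarz _ _)) //.
    have b (T : bop H) : rn (T (D z)) <= rn T by have := rn_bop_le T (D z);
      rewrite dn mulr1.
    exact: (ler_pM (rn_ge0 _) (rn_ge0 _) (b _) (b _)).
  apply: bopP => v; apply: (orthonormal_basis_ext basis) => z Oz.
  by rewrite -(bop_starP (op1 xi)) inner // delta_dot // op0E.
- move=> V oV VU Vinj xi eta hxi heta.
  have hxi' := Cc_sub VU hxi; have heta' := Cc_sub VU heta.
  have off (f : S -> R[i]) z : Cc V f -> ~ V z -> f z = 0.
    by move=> [_ [K [_ KV K0]]] Vz; apply: K0 => /KV.
  have h : bounded_on_orbit (fun x => xi x * Num.conj (eta x)).
    have [C hC] := C0_orbit (Cc_C0 hxi); have [C' hC'] := C0_orbit (Cc_C0 heta);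
      exists (C * C') => y Oy.
    by rewrite rnM rn_conj ler_pM ?rn_ge0 ?hC ?hC'.
  apply: bopP => v; apply: ell2P => z; rewrite op0E //= op1E //.
  have [Vz|Vz] := pselect (V z); last by rewrite (off xi) // mulr0 !mul0r if_same.
  have Uz := VU _ Vz; rewrite asboolT //.
  have [Oz|Oz] := pselect (O z); last first.
    by rewrite [X in _ * X = _]ell2_out ?[X in _ = _ * X]ell2_out ?mulr0 // =>
      /(orbit_map x0 Uz).
  have Osz : O (s z) by apply/(orbit_map x0 Uz).
  have -> : bop_star_fun (op1 eta) v (s z) = '[bop_star (op1 eta) v,
    D (s z)] by rewrite dot_delta.
  have -> : '[bop_star (op1 eta) v, D (s z)] = '[v, op1 eta (D (s z))].
    by rewrite dotC -bop_starP -dotC.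
  (* By injectivity on [V], the support of [eta] meets the fiber of [s z] at most in [z], so only
     one term survives. *)
  have -> : op1 eta (D (s z)) = (g0 * eta z) *: (D z : H).
    apply: ell2P => y; rewrite op1E // ell2ZE !ell2_deltaE //.
    case: asboolP => Uy.
      case: (eqVneq y z) => [->|yz]; first by rewrite eqxx.
      case: eqP => [sy|]; last by rewrite !mulr0.
      have [Vy|Vy] := pselect (V y); last by rewrite (off eta y) // !(mulr0, mul0r).
      by case/eqP: yz; apply: Vinj => //; exact: mem_set.
    case: eqP => [yz|]; last by rewrite mulr0.
    by rewrite yz in Uy.
  rewrite dotZr dot_delta // rmorphM !mulrA; congr (_ * _).
  transitivity (g0 * Num.conj g0 * (xi z * Num.conj (eta z)));
    last by rewrite g0_conj mul1r.
  by rewrite /=; ring.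
Qed.

End OrbitOperators.

Lemma orbit_representation_exists (R : realType) (S : sgds) (A : cstarAlgebra R)
    (t0 t1 : (S -> R[i]) -> A) (x0 : S) (g0 : R[i]) :
  is_sgds_algebra t0 t1 -> circle R g0 ->
  exists (H : hilbertSpace R) (delta : S -> H) (rho : A -> H -> H),
    orbit_representation t0 t1 x0 g0 delta rho.
Proof.
move=> hA g01.
have [phi [hphi phi0 phi1]] := sgds_algebra_universal hA (orbit_relations x0 g01).
exists (ell2_hilbert R (orbit_set x0)), (ell2_delta R (orbit_set x0)), (fun a =>
  bop_fun (phi a)).
split.
- exact: ell2_orthonormal_basis.
- exact: bop_representation.
- by move=> f x hf Ox; rewrite phi0 // op0_delta //; exact: C0_orbit.
- by move=> xi x hx Ox; rewrite phi1 // op1_delta.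
Qed.

(** * Approximate intertwiners *)

Section ApproxFilter.
Variables (R : realType) (X : Type) (A : cstarAlgebra R) (O : set X).

(* [md_norm] is the intended norm of the vectors [md_vec y]; only [vec_le] below
   relates the two. *)
Record model := Model {
  md_space : hilbertSpace R;
  md_vec : X -> md_space;
  md_rho : A -> md_space -> md_space;
  md_norm : R;
  md_rep : star_representation md_rho;
  md_norm_ge0 : 0 <= md_norm }.

Implicit Types (m : model) (u : seq (R[i] * X)).

(** The list [u] is a formal combination: it does not mention the model, and can be evaluated in all
    of them. *)
Definition comb m u : md_space m := \sum_(q <- u) q.1 *: md_vec m q.2.

Definition supported u := all (fun q => `[< O q.2 >]) u.

(* Not a [set_system], which would be inconsistent at the universe of [model]. *)
Variable F : (model -> Prop) -> Prop.

Definition eventual := (forall P : model -> Prop, (forall m, P m) -> F P) /\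
  forall P Q T : model -> Prop, F P -> F Q -> (forall m, P m -> Q m -> T m) -> F T.

Hypothesis FF : eventual.

Lemma ev1 (P T : model -> Prop) : F P -> (forall m, P m -> T m) -> F T.
Proof. by move=> h PT; apply: (FF.2 _ _ _ h h) => m /PT. Qed.

Hypothesis vec_le : forall y, O y -> F (fun m => rn (md_vec m y) <= md_norm m).

(** The order of quantifiers is essential: [u] is chosen before the model, so the same combination
    describes [a] in eventually all models, with an error relative to [md_norm]. *)
Definition approximable (a : A) := forall y (e : R), O y -> 0 < e ->
  exists2 u, supported u &
    F (fun m => rn (md_rho a (md_vec m y) - comb m u) <= e * md_norm m).

Lemma comb_cat m u u' : comb m (u ++ u') = comb m u + comb m u'.
Proof. by rewrite /comb big_cat. Qed.

Lemma comb_scale m k u : comb m [seq (k * q.1, q.2) | q <- u] = k *: comb m u.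
Proof.
by rewrite /comb big_map scaler_sumr; apply: eq_bigr => q _; rewrite scalerA.
Qed.

Lemma supported_scale k u : supported u -> supported [seq (k * q.1, q.2) | q <- u].
Proof. by rewrite /supported all_map. Qed.

Lemma rho_subl m a b v : md_rho (a - b) (v : md_space m) = md_rho a v - md_rho b v.
Proof.
by rewrite (repD (md_rep m)) -[- b]scaleN1r (repZ (md_rep m)) scaleN1r.
Qed.

Lemma approximable_comb a u (e : R) : approximable a -> supported u -> 0 < e ->
  exists2 u', supported u' &
    F (fun m => rn (md_rho a (comb m u) - comb m u') <= e * md_norm m).
Proof.
move=> Qa; elim: u e => [|[c z] u ih] e.
  move=> _ e0; exists [::] => //; apply: FF.1 => m /=.
  by rewrite /comb !big_nil (repL0 (md_rep m)) subrr rn0 mulr_ge0 ?md_norm_ge0 ?(ltW e0).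
rewrite /= => /andP[/asboolP Oz su] e0.
have e2 : 0 < e / 2 by rewrite divr_gt0.
have c1 : 0 < rn c + 1 by rewrite ltr_wpDl ?rn_ge0.
have [u1 su1 h1] := ih _ su e2.
have [u2 su2 h2] := Qa z _ Oz (divr_gt0 e2 c1).
exists ([seq (c * q.1, q.2) | q <- u2] ++ u1).
  by rewrite /supported all_cat; apply/andP; split=> //; exact: supported_scale.
apply: (FF.2 _ _ _ h1 h2) => m /= {}h1 {}h2.
rewrite comb_cat comb_scale /comb big_cons -/(comb m u) /= (repLD (md_rep m)) (repLZ
  (md_rep m)) opprD addrACA -scalerBr.
rewrite (le_trans (rnD _ _)) // rnZ.
have h3 : rn c * rn (md_rho a (md_vec m z) - comb m u2) <= e / 2 * md_norm m.
  apply: le_trans (ler_wpM2l (rn_ge0 c) h2) _.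
  rewrite mulrA ler_wpM2r ?md_norm_ge0 // mulrCA ler_piMr ?(ltW e2) //.
  by rewrite ler_pdivrMr // mul1r lerDl.
by lra.
Qed.

Lemma approximable0 : approximable 0.
Proof.
move=> y e Oy e0; exists [::] => //; apply: FF.1 => m /=.
rewrite /comb big_nil -(scale0r (0 : A)) (repZ (md_rep m)) scale0r subrr rn0.
by rewrite mulr_ge0 ?md_norm_ge0 ?(ltW e0).
Qed.

Lemma approximableD a b : approximable a -> approximable b -> approximable (a + b).
Proof.
move=> Qa Qb y e Oy e0; have e2 : 0 < e / 2 by rewrite divr_gt0.
have [u su hu] := Qa y _ Oy e2; have [v sv hv] := Qb y _ Oy e2.
exists (u ++ v); first by rewrite /supported all_cat; apply/andP.
apply: (FF.2 _ _ _ hu hv) => m /= {}hu {}hv.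
rewrite comb_cat (repD (md_rep m)) opprD addrACA (le_trans (rnD _ _)) //; lra.
Qed.

Lemma approximableZ k a : approximable a -> approximable (k *: a).
Proof.
move=> Qa y e Oy e0; have k1 : 0 < rn k + 1 by rewrite ltr_wpDl ?rn_ge0.
have [u su hu] := Qa y _ Oy (divr_gt0 e0 k1).
exists [seq (k * q.1, q.2) | q <- u]; first exact: supported_scale.
apply: (ev1 hu) => m /= {}hu; rewrite comb_scale (repZ (md_rep m)) -scalerBr rnZ.
apply: le_trans (ler_wpM2l (rn_ge0 k) hu) _.
rewrite mulrA ler_wpM2r ?md_norm_ge0 // mulrCA ler_piMr ?(ltW e0) //.
by rewrite ler_pdivrMr // mul1r lerDl.
Qed.

Lemma approximableM a b : approximable a -> approximable b -> approximable (cmul a b).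
Proof.
move=> Qa Qb y e Oy e0; have e2 : 0 < e / 2 by rewrite divr_gt0.
have a1 : 0 < rn a + 1 by rewrite ltr_wpDl ?rn_ge0.
have [u su hu] := Qb y _ Oy (divr_gt0 e2 a1).
have [v sv hv] := approximable_comb Qa su e2.
exists v => //; apply: (FF.2 _ _ _ hu hv) => m /= {}hu {}hv.
rewrite (repM (md_rep m)) (le_trans (rn_triangle (md_rho a (comb m u)) _ _)) //.
rewrite -(repLB (md_rep m)).
have h1 := rep_contractive (md_rep m) a (md_rho b (md_vec m y) - comb m u).
have h2 : rn a * rn (md_rho b (md_vec m y) - comb m u) <= e / 2 * md_norm m.
  apply: le_trans (ler_wpM2l (rn_ge0 a) hu) _.
  rewrite mulrA ler_wpM2r ?md_norm_ge0 // mulrCA ler_piMr ?(ltW e2) //.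
  by rewrite ler_pdivrMr // mul1r lerDl.
lra.
Qed.

(** Contractivity bounds the cost of replacing [a] by [b] in all models simultaneously. *)
Lemma approximable_closed a :
  (forall e : R, 0 < e -> exists2 b, approximable b & rn (a - b) < e) -> approximable a.
Proof.
move=> h y e Oy e0; have e2 : 0 < e / 2 by rewrite divr_gt0.
have [b Qb ab] := h _ e2; have [u su hu] := Qb y _ Oy e2.
exists u => //; apply: (FF.2 _ _ _ hu (vec_le Oy)) => m /= {}hu vy.
rewrite (le_trans (rn_triangle (md_rho b (md_vec m y)) _ _)) // -rho_subl.
have h1 := rep_contractive (md_rep m) (a - b) (md_vec m y).
have h2 : rn (a - b) * rn (md_vec m y) <= e / 2 * md_norm m.
  by rewrite ler_pM ?rn_ge0 // ltW.
lra.
Qed.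

(** The definition of [approximable] gives no stability under the involution, so the condition is
    imposed on [a] and [cstar a] together. *)
Lemma approximable_subalgebra :
  closed_star_subalgebra [set a | approximable a /\ approximable (cstar a)].
Proof.
split; first split.
- apply/closed_rnP => a ha; split; apply: approximable_closed => e /ha[b [Qb Qb'] ab].
    by exists b.
  by exists (cstar b) => //; rewrite -cstarN -cstarD rn_cstar.
- split; first exact: approximable0.
  by rewrite -(scale0r (0 : A)) cstarZ rmorph0 scale0r; exact: approximable0.
- move=> a b [Qa Qa'] [Qb Qb']; split; first exact: approximableD.
  by rewrite cstarD; exact: approximableD.
- move=> k a [Qa Qa']; split; first exact: approximableZ.
  by rewrite cstarZ; exact: approximableZ.
- move=> a b [Qa Qa'] [Qb Qb']; split; first exact: approximableM.
  by rewrite cstarM; exact: approximableM.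
- by move=> a [Qa Qa']; split=> //=; rewrite cstarK.
Qed.

End ApproxFilter.

(** * Branches of the dynamics near a cyclic point *)

Section Germs.
Variables (S : sgds) (x0 : S) (p : nat).
Local Notation s := (sg_map S).
Local Notation U := (sg_dom S).
Local Notation Un := (sg_iter_dom S).
Implicit Types (x y z : S) (r : S -> S).

(** At [p = 0] the first two conditions are trivial and congruence is equality, so points with
    injective forward orbit fall under the same definition. *)
Definition cyclic_at := [/\ Un p x0, iter p s x0 = x0 &
  forall n m, Un n x0 -> Un m x0 -> iter n s x0 = iter m s x0 -> n = m %[mod p]].

(* [r] is a branch of [sigma^-a sigma^b] through [y], and [n = b - a] is its degree. *)
Definition germ y (n : int) r := exists a b : nat,
  [/\ n = b%:Z - a%:Z, r x0 = y, {for x0, continuous r} &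
      \forall x \near x0, [/\ Un a (r x), Un b x & iter a s (r x) = iter b s x]].

Hypothesis cyc : cyclic_at.

Lemma cyclic_iter j : Un (j * p) x0 /\ iter (j * p) s x0 = x0.
Proof.
have [h1 h2 _] := cyc; elim: j => [|j [ih1 ih2]] //.
rewrite mulSn; split; last by rewrite iterD ih2.
by rewrite iter_domD ih2.
Qed.

Lemma near_shift (P : set S) j :
  (\forall x \near x0, P x) -> \forall x \near x0, P (iter (j * p) s x).
Proof.
have [h1 h2] := cyclic_iter j => hP.
have h : nbhs (iter (j * p) s x0) P by rewrite h2.
exact: (iter_continuous h1 h).
Qed.

Lemma near_shifts (P : set S) N :
  (\forall x \near x0, P x) -> \forall x \near x0, forall j,
    (j < N)%N -> P (iter (j * p) s x).
Proof.
move=> hP; have := @near_seq _ _ x0 (iota 0 N) (fun j x => P (iter (j * p) s x)) _.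
move=> h; apply: filterS (h _) => [x hx j jN|j _]; last exact: near_shift.
by apply: hx; rewrite mem_iota.
Qed.

Lemma germ_near_orbit y n r N : germ y n r ->
  \forall x \near x0, forall j, (j < N)%N -> orbit_set x (r (iter (j * p) s x)).
Proof.
move=> [a [b [_ _ _ h]]].
have hN : \forall x \near x0, forall j, (j < N)%N -> Un (j * p) x.
  have := @near_seq _ _ x0 (iota 0 N) (fun j x => Un (j * p) x) _.
  move=> h'; apply: filterS (h' _) => [x hx j jN|j _]; last first.
    by apply: near_iter_dom; have [] := cyclic_iter j.
  by apply: hx; rewrite mem_iota.
apply: filterS2 hN (near_shifts N h) => x hN1 hN2 j jN.
have [h1 h2 h3] := hN2 j jN; exists a, (b + j * p)%N; split=> //.
  by rewrite iter_domD; split=> //; exact: hN1.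
by rewrite h3 iterD.
Qed.

Lemma germ_exists y : orbit_set x0 y -> exists n r, germ y n r.
Proof.
move=> [a [b [h1 h2 h3]]]; have [g [gy gc gn]] := iter_section h1.
rewrite h3 in gy gc gn.
exists (b%:Z - a%:Z), (g \o iter b s), a, b; split=> //=.
  by apply: continuous_comp; [exact: iter_continuous | exact: gc].
have h4 : \forall x \near x0,
  Un a (g (iter b s x)) /\ iter a s (g (iter b s x)) = iter b s x.
  exact: (iter_continuous h2 gn).
by apply: filterS2 h4 (near_iter_dom h2) => x [? ?] ?.
Qed.

(** [r x] determines [iter b s x] through [iter a s], and [iter b s] is locally injective. *)
Lemma germ_injective y n r : germ y n r ->
  exists2 V, nbhs x0 V & forall x x', V x -> V x' -> r x = r x' -> x = x'.
Proof.
move=> [a [b [_ r0 _ h]]].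
have [_ Ub _] := nbhs_singleton h.
have [V nV hV] := iter_locally_injective Ub.
exists (V `&` [set x | iter a s (r x) = iter b s x]).
  by apply: filterI => //; apply: filterS h => x [].
by move=> x x' [Vx /= ex] [Vx' /= ex'] e; apply: hV => //; rewrite -ex -ex' e.
Qed.

Lemma germ_map y n r : germ y n r -> U y -> germ (s y) (n + 1) (s \o r).
Proof.
move=> [a [b [nE r0 rc h]]] Uy.
have cont : {for x0, continuous (s \o r)}.
  by apply: continuous_comp => //; rewrite r0; exact: map_continuous.
have [h1 h2 h3] := nbhs_singleton h.
have nU : \forall x \near x0, U (r x).
  by apply: rc; rewrite /= r0; exact: near_dom.
(* The degree rises by one either by removing one step from [a] or, when [a] is zero, by adding one
   to [b]. *)
case: a nE h h1 h3 => [|a] nE h h1 h3.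
  exists 0%N, b.+1; split=> //=; first by rewrite nE; lia.
    by rewrite r0.
  by apply: filterS2 h nU => x [/= _ k2 k3] k4; split=> //; rewrite -?k3.
exists a, b; split=> //=; first by rewrite nE; lia.
  by rewrite r0.
by apply: filterS h => x [/iter_domS[_ k1] k2 k3]; split=> //; rewrite -iterSr.
Qed.

Lemma germ_sec y n r z : germ y n r -> U z -> s z = y -> germ z (n - 1) (sec z \o r).
Proof.
move=> [a [b [nE r0 rc h]]] Uz sz.
have [secz secc secn] := secP Uz; rewrite sz in secz secc secn.
exists a.+1, b; split=> /=.
- by rewrite nE; lia.
- by rewrite r0.
- by apply: continuous_comp => //; rewrite r0.
have h2 : \forall x \near x0, U (sec z (r x)) /\ s (sec z (r x)) = r x.
  have hs : nbhs (r x0) [set w | U (sec z w) /\ s (sec z w) = w] by rewrite r0.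
  exact: (rc _ hs).
apply: filterS2 h h2 => x [k1 k2 k3] [k4 k5]; split=> //.
  by apply/iter_domS; rewrite k5.
by rewrite -iterS iterSr k5.
Qed.

(** Applying [iter e s] with [e = maxn a a'] turns both branches into forward iterates, whose
    exponents are congruent modulo [p] because they agree at [x0]. Local injectivity of [iter e s]
    at [y] then cancels it. *)
Lemma germ_shift y n r n' r' : germ y n r -> germ y n' r' -> (n <= n')%R ->
  exists d : nat, n' = n + (d * p)%:Z /\ \forall x \near x0, r' x = r (iter (d * p) s x).
Proof.
move=> [a [b [nE r0 rc h]]] [a' [b' [nE' r0' rc' h']]] nn'.
have [h1 h2 h3] := nbhs_singleton h; have [h1' h2' h3'] := nbhs_singleton h'.
rewrite r0 in h1 h3; rewrite r0' in h1' h3'.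
pose e := maxn a a'.
have Ue : Un e y by rewrite /e /maxn; case: ifP.
have ea : (e - a + a = e)%N by rewrite subnK // leq_maxl.
have ea' : (e - a' + a' = e)%N by rewrite subnK // leq_maxr.
have d1 : Un (e - a + b) x0.
  have /iter_domD[_ u] : Un (e - a + a) y by rewrite ea.
  by apply/iter_domD; split=> //; rewrite -h3.
have d2 : Un (e - a' + b') x0.
  have /iter_domD[_ u] : Un (e - a' + a') y by rewrite ea'.
  by apply/iter_domD; split=> //; rewrite -h3'.
have E : iter (e - a + b) s x0 = iter (e - a' + b') s x0.
  by rewrite !iterD -h3 -h3' -!iterD ea ea'.
have [_ _ /(_ _ _ d1 d2 E) md] := cyc.
have le : (e - a + b <= e - a' + b')%N by move: nn'; rewrite nE nE'; lia.
have /dvdnP[d dE] : (p %| (e - a' + b') - (e - a + b))%N by rewrite -eqn_mod_dvd //;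
  apply/eqP.
have dE' : (e - a' + b' = d * p + (e - a + b))%N by rewrite -dE subnK.
exists d; split; first by rewrite nE nE'; lia.
have [V nV hV] := iter_locally_injective Ue.
have [c1 c2] := cyclic_iter d.
have k1 : \forall x \near x0, V (r' x) by apply: rc'; rewrite /= r0'.
have k2' : \forall x \near x0, V (r x) by apply: rc; rewrite /= r0.
have k2 := near_shift d k2'.
have k3 := near_shift d h.
apply: filterS3 k1 k2 (filterI k3 h') => x v1 v2 [[_ _ k] [_ _ k']].
apply: hV => //; rewrite -{1}ea' -ea !iterD k k' -!iterD; congr iter.
by rewrite ea dE'; lia.
Qed.

Lemma germs_distinct y n r z n' r' N : germ y n r -> germ z n' r' -> y <> z ->
  \forall x \near x0, forall j k, (j < N)%N -> (k < N)%N ->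
    r (iter (j * p) s x) <> r' (iter (k * p) s x).
Proof.
move=> [a [b [_ r0 rc _]]] [a' [b' [_ r0' rc' _]]] yz.
have [B [C [nB nC BC]]] := near_disjoint yz.
have k1 : \forall x \near x0, B (r x) by apply: rc; rewrite /= r0.
have k2 : \forall x \near x0, C (r' x) by apply: rc'; rewrite /= r0'.
apply: filterS2 (near_shifts N k1) (near_shifts N k2) => x h1 h2 j k jN kN e.
by apply: (BC _ (h1 j jN)); rewrite e; exact: h2.
Qed.

End Germs.

(** * Adjoints of the generators in an abstract orbit representation *)

Section OrbitRep.
Variables (R : realType) (S : sgds) (A : cstarAlgebra R) (t0 t1 : (S -> R[i]) -> A).
Variables (x : S) (g : R[i]) (H : hilbertSpace R) (delta : S -> H) (rho : A -> H -> H).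
Hypothesis hr : orbit_representation t0 t1 x g delta rho.
Local Notation s := (sg_map S).
Local Notation U := (sg_dom S).
Local Notation O := (orbit_set x).

Lemma orbit_rn_delta z : O z -> rn (delta z) = 1.
Proof.
move=> Oz; have [h _] := orbit_basis hr.
by apply/eqP; rewrite -(@eqrXn2 _ 2) ?rn_ge0 // rn_sqrE h // eqxx expr1n.
Qed.

(** Read off the matrix coefficients of [t1 xi]: the basis vector at [z] occurs only in the image of
    the one at [s z]. *)
Lemma orbit_t1_star xi z : Cc U xi -> O z ->
  rho (cstar (t1 xi)) (delta z) =
    if `[< U z >] then (Num.conj g * Num.conj (xi z)) *: delta (s z) else 0.
Proof.
move=> hx Oz; have [xc [K [cK KU K0]]] := hx; have [on _] := orbit_basis hr.
apply: (orthonormal_basis_ext (orbit_basis hr)) => w Ow.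
have -> : hdot H (delta w) (rho (cstar (t1 xi)) (delta z)) =
    hdot H (rho (t1 xi) (delta w)) (delta z).
  by rewrite dotC (rep_star (orbit_rep hr)) -dotC.
rewrite (orbit_rep_t1 hr) // dotZl.
have [L [uL LP sumL _]] := near_fiber_sum R w cK KU.
rewrite sumL; last by move=> y /K0 ->; rewrite scale0r.
have -> : hdot H (\sum_(y <- L) xi y *: delta y) (delta z) = if z \in L then xi z else 0.
  rewrite dot_suml; case: ifP => zL.
    rewrite (bigD1_seq z) //= dotZl on // eqxx mulr1 big_seq_cond big1 ?addr0 //.
    move=> y /andP[/LP[_ fy] yz]; rewrite dotZl on ?(negPf yz) ?mulr0 //.
    exact: orbit_fiber fy.
  rewrite big_seq big1 // => y yL; rewrite dotZl on //.
    by case: eqP => [yz|_]; [rewrite -yz yL in zL | rewrite mulr0].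
  by have /LP[_ fy] := yL; exact: orbit_fiber fy.
case: asboolP => Uz; last first.
  rewrite dot0r; case: ifP => zL; last by rewrite mulr0.
  by have /LP[_ []] := zL.
have Osz : O (s z) by have /(orbit_map x Uz) := Oz.
rewrite dotZr on // conjM_conj; case: eqP => [wz|wz]; rewrite ?mulr1 ?mulr0.
  case: ifP => // zL; have [Kz|/K0->//] := pselect (K z).
  by move/negP: zL; case; apply/LP.
case: ifP => [/LP[_ [_ sz]]|]; last by rewrite mulr0.
by case: wz.
Qed.

End OrbitRep.

Section Estimates.
Variables (R : realType) (V : normedZmodType R[i]).

(** The two windows overlap except for [d] terms at each end. *)
Lemma shift_sum_le (f : nat -> V) N d : (forall j, (j < N + d)%N -> rn (f j) <= 1) ->
  rn (\sum_(j < N) f j - \sum_(j < N) f (d + j)%N) <= 2 * d%:R.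
Proof.
move=> h.
have E : \sum_(j < N) f j + \sum_(j < d) f (N + j)%N = \sum_(j < d) f j + \sum_(j < N) f
  (d + j)%N.
  have e1 : \sum_(j < N + d) f j = \sum_(j < N) f j + \sum_(j < d) f (N + j)%N.
    by rewrite big_split_ord.
  have e2 : \sum_(j < d + N) f j = \sum_(j < d) f j + \sum_(j < N) f (d + j)%N.
    by rewrite big_split_ord.
  by rewrite -e1 -e2 addnC.
have -> : \sum_(j < N) f j - \sum_(j < N) f (d + j)%N = \sum_(j < d) f j - \sum_(j < d) f
  (N + j)%N.
  by apply/eqP; rewrite subr_eq addrAC -E addrK.
have b (k : nat -> nat) : (forall j, (j < d)%N -> (k j < N + d)%N) ->
    rn (\sum_(j < d) f (k j)) <= d%:R.
  move=> hk; rewrite (le_trans (rn_sum _ _ _)) //.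
  apply: (@le_trans _ _ (\sum_(j < d) 1)); first by apply: ler_sum => j _; apply: h;
    exact: hk.
  by rewrite sumr_const card_ord.
rewrite (le_trans (rnD _ _)) // rnN.
have := b id _; have := b (addn N) _ => h1 h2.
have {}h1 := h1 _; have {}h2 := h2 _.
rewrite mulr_natl mulr2n lerD // ?h1 ?h2 // => j jd; first by rewrite ltn_addl.
by rewrite ltn_add2l.
Qed.

End Estimates.

(** * Averaged vectors *)

Section Samples.
Variables (R : realType) (S : sgds) (A : cstarAlgebra R) (t0 t1 : (S -> R[i]) -> A).
Variables (x0 : S) (p : nat) (g : R[i]).
Hypothesis cyc : cyclic_at x0 p.
Hypothesis gT : circle R g.
Local Notation s := (sg_map S).
Local Notation U := (sg_dom S).

Record sample := Sample {
  sm_size : nat;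
  sm_pt : S;
  sm_ang : R[i];
  sm_space : hilbertSpace R;
  sm_delta : S -> sm_space;
  sm_rho : A -> sm_space -> sm_space;
  sm_circle : circle R sm_ang;
  sm_rep : orbit_representation t0 t1 sm_pt sm_ang sm_delta sm_rho }.
Implicit Types w : sample.

Definition twist w : R[i] := g / sm_ang w.
Definition walk w j : S := iter (j * p) s (sm_pt w).

(* Overlaps in the walk do not create cancellation in the averaged vectors. *)
Definition coherent (N : nat) (x : S) (b : R[i]) := forall j k, (j < N)%N -> (k < N)%N ->
  iter (j * p) s x = iter (k * p) s x ->
  0 <= complex.Re (b ^+ (j * p) * Num.conj (b ^+ (k * p))).

Definition avg w (n : int) (r : S -> S) : sm_space w :=
  \sum_(j < sm_size w) twist w ^ (n + (j * p)%:Z) *: sm_delta w (r (walk w j)).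

(* The squared norm of every [avg w n r], for [sm_pt w] close to [x0]. *)
Definition mass w : R := complex.Re (\sum_(j < sm_size w) \sum_(k < sm_size w)
  twist w ^+ (j * p) * Num.conj (twist w ^+ (k * p)) * (walk w j == walk w k)%:R).

(** The neighbourhood may shrink as [N] grows, which gives control over all [N] rounds of the walk
    and over tolerances such as 1 / N. The angle is restricted only through [coherent]. *)
Definition ev (P : sample -> Prop) := exists N0, forall N, (N0 <= N)%N ->
  \forall x \near x0, forall w, sm_size w = N -> sm_pt w = x ->
    coherent N x (twist w) -> P w.

Lemma ev_all (P : sample -> Prop) : (forall w, P w) -> ev P.
Proof. by move=> h; exists 0%N => N _; apply: nearW => x w _ _ _; exact: h. Qed.

Lemma ev_and (P Q T : sample -> Prop) : ev P -> ev Q -> (forall w,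
  P w -> Q w -> T w) -> ev T.
Proof.
move=> [M hM] [N hN] h; exists (maxn M N) => k; rewrite geq_max => /andP[Mk Nk].
apply: filterS2 (hM k Mk) (hN k Nk) => x hx hx' w wk wx c; apply: h; [exact: hx|exact: hx'].
Qed.

Lemma ev_near (Q : nat -> S -> Prop) (P : sample -> Prop) :
  (forall N, \forall x \near x0, Q N x) ->
  (forall w, Q (sm_size w) (sm_pt w) -> P w) -> ev P.
Proof.
move=> hQ h; exists 0%N => N _; apply: filterS (hQ N) => x hx w wN wx _.
by apply: h; rewrite wN wx.
Qed.

Lemma ev_seq (J : eqType) (l : seq J) (P : J -> sample -> Prop) :
  (forall z, z \in l -> ev (P z)) -> ev (fun w => forall z, z \in l -> P z w).
Proof.
elim: l => [|a l ih] h; first exact: ev_all.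
apply: (ev_and (h a (mem_head _ _)) (ih _)) => [z zl|w Pa Pl z].
  by apply: h; rewrite inE zl orbT.
by rewrite inE => /orP[/eqP ->//|]; exact: Pl.
Qed.

Lemma twist_rn w : rn (twist w) = 1.
Proof.
have h : rn (sm_ang w) = 1 by apply/circleP; exact: sm_circle.
have a0 : sm_ang w != 0.
  by apply/eqP => e; move/eqP: h; rewrite e rn0 eq_sym oner_eq0.
rewrite /twist rnM (circleP g).1 // mul1r -[LHS]mulr1 -h -rnM mulVf // rn1.
by [].
Qed.

Lemma twist_neq0 w : twist w != 0.
Proof. by apply/eqP => e; have := twist_rn w; rewrite e rn0 => /eqP;
  rewrite eq_sym oner_eq0. Qed.

Lemma twist_exp_rn w (n : int) : rn (twist w ^ n) = 1.
Proof.
have h k : rn (twist w ^+ k) = 1 by rewrite rnX twist_rn expr1n.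
case: n => n; first exact: h.
rewrite NegzE -exprnN -[LHS]mulr1 -(h n.+1) -rnM mulVf ?rn1 //.
by rewrite expf_neq0 // twist_neq0.
Qed.

Lemma twist_sqr w (n : int) : twist w ^ n * Num.conj (twist w ^ n) = 1.
Proof. by rewrite -rn_sqr twist_exp_rn expr1n. Qed.

Lemma ang_twist w : sm_ang w * twist w = g.
Proof.
rewrite /twist mulrC divfK //; apply/eqP => e.
have : rn (sm_ang w) = 1 by apply/circleP; exact: sm_circle.
by rewrite e rn0 => /eqP; rewrite eq_sym oner_eq0.
Qed.

Lemma conj_ang_twist w : Num.conj g * twist w = Num.conj (sm_ang w).
Proof.
have h : Num.conj (twist w) * twist w = 1 by rewrite mulrC -rn_sqr twist_rn expr1n.
by rewrite -(ang_twist w) rmorphM -mulrA h mulr1.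
Qed.

Definition on_orbit (r : S -> S) N w := forall j,
  (j < N)%N -> orbit_set (sm_pt w) (r (walk w j)).

Lemma avg_dot w n r n' r' : on_orbit r (sm_size w) w -> on_orbit r' (sm_size w) w ->
  hdot _ (avg w n r) (avg w n' r') = \sum_(j < sm_size w) \sum_(k < sm_size w)
    twist w ^ (n + (j * p)%:Z) * Num.conj (twist w ^ (n' + (k * p)%:Z)) *
      (r (walk w j) == r' (walk w k))%:R.
Proof.
move=> hr hr'; have [on _] := orbit_basis (sm_rep w).
rewrite /avg dot_suml; apply: eq_bigr => j _; rewrite dot_sumr; apply: eq_bigr => k _.
by rewrite dotZl dotZr on ?mulrA //; [exact: hr|exact: hr'].
Qed.

Lemma ev_orbit y n r : germ x0 y n r -> ev (fun w => on_orbit r (sm_size w) w).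
Proof.
move=> hg; apply: (ev_near (Q := fun N x =>
  forall j, (j < N)%N -> orbit_set x (r (iter (j * p) s x)))).
  by move=> N; exact: germ_near_orbit hg.
by [].
Qed.

(** A branch is injective near [x0], so coincidences in the average are those of the walk itself;
    the common power of [twist w] is unimodular and cancels. *)
Lemma ev_avg_norm y n r : germ x0 y n r -> ev (fun w => rn (avg w n r) ^+ 2 = mass w).
Proof.
move=> hg; have [V nV hV] := germ_injective hg.
apply: (ev_and (ev_orbit hg)
  (@ev_near (fun N x => forall j, (j < N)%N -> V (iter (j * p) s x))
     (fun w => forall j, (j < sm_size w)%N -> V (walk w j)) _ _)) => //.
  by move=> N; exact: near_shifts cyc _ N nV.
move=> w ho hv; rewrite rn_sqrE avg_dot // /mass; congr complex.Re.
apply: eq_bigr => j _; apply: eq_bigr => k _.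
have -> : (r (walk w j) == r (walk w k)) = (walk w j == walk w k).
  by apply/eqP/eqP => [|->//]; apply: hV; exact: hv.
rewrite !expfzDr ?twist_neq0 // [Num.conj (_ * _)]rmorphM /= mulrACA twist_sqr mul1r.
by [].
Qed.

(** The diagonal of the double sum contributes [sm_size w], and coherence makes the other terms
    nonnegative. *)
Lemma ev_mass_ge : ev (fun w => (sm_size w)%:R <= mass w).
Proof.
exists 0%N => N _; apply: nearW => x w wN wx; rewrite -wN -wx => c.
apply: (@le_trans _ _ (\sum_(j < sm_size w) (1 : R))); first by rewrite sumr_const card_ord.
rewrite /mass raddf_sum; apply: ler_sum => j _; rewrite raddf_sum (bigD1 j) //= eqxx mulr1.
have -> : complex.Re (twist w ^+ (j * p) * Num.conj (twist w ^+ (j * p))) = 1.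
  by have := twist_sqr w (j * p)%:Z; rewrite -exprnP => ->.
rewrite lerDl; apply: sumr_ge0 => k _; case: eqP => e; rewrite ?mulr1 ?mulr0 //.
by apply: c.
Qed.

(** Since [mass w] is at least the length, any length above [(C / e) ^+ 2] makes an absolute error
    [C] relatively small. *)
Lemma ev_const (C e : R) : 0 < e -> ev (fun w => C <= e * Num.sqrt (mass w)).
Proof.
move=> e0; pose k := Num.bound ((C / e) ^+ 2).
have hk : (C / e) ^+ 2 <= k%:R.
  by rewrite ltW // archi_boundP // sqr_ge0.
have big : ev (fun w => (k <= sm_size w)%N).
  by exists k => N kN; apply: nearW => x w -> _ _.
apply: (ev_and big ev_mass_ge) => w kw mw.
have h : (C / e) ^+ 2 <= mass w.
  by rewrite (le_trans hk) // (le_trans _ mw) // ler_nat.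
rewrite -ler_pdivrMl // mulrC.
have m0 : 0 <= mass w by apply: le_trans h; exact: sqr_ge0.
rewrite (le_trans (ler_norm _)) // -sqrtr_sqr ler_sqrt //.
Qed.

Lemma ev_avg_distinct y n r z n' r' : germ x0 y n r -> germ x0 z n' r' -> y <> z ->
  ev (fun w => hdot _ (avg w n r) (avg w n' r') = 0).
Proof.
move=> hg hg' yz.
apply: (ev_and (ev_and (ev_orbit hg) (ev_orbit hg') (fun w h h' => conj h h'))
  (@ev_near (fun N x => forall j k, (j < N)%N -> (k < N)%N ->
       r (iter (j * p) s x) <> r' (iter (k * p) s x))
     (fun w => forall j k, (j < sm_size w)%N -> (k < sm_size w)%N ->
       r (walk w j) <> r' (walk w k)) _ _)) => //.
  by move=> N; exact: germs_distinct hg hg' yz.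
move=> w [h h'] hd; rewrite avg_dot // big1 // => j _; rewrite big1 // => k _.
by rewrite (_ : (_ == _) = false) ?mulr0 //; apply/eqP; exact: hd.
Qed.

(* Both averages run along the same walk, shifted by [d] steps. *)
Lemma ev_avg_same_le y n r n' r' : germ x0 y n r -> germ x0 y n' r' -> n <= n' ->
  exists C : R, ev (fun w => rn (avg w n r - avg w n' r') <= C).
Proof.
move=> hg hg' nn'; have [d [nE hd]] := germ_shift cyc hg hg' nn'.
exists (2 * d%:R).
have h1 : ev (fun w => on_orbit r (sm_size w + d) w).
  apply: (ev_near (Q := fun N x =>
    forall j, (j < N + d)%N -> orbit_set x (r (iter (j * p) s x)))) => //.
  by move=> N; exact: germ_near_orbit hg.
have h2 : ev (fun w => forall j,
  (j < sm_size w)%N -> r' (walk w j) = r (iter (d * p) s (walk w j))).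
  apply: (ev_near (Q := fun N x => forall j, (j < N)%N ->
    r' (iter (j * p) s x) = r (iter (d * p) s (iter (j * p) s x)))) => //.
  by move=> N; exact: near_shifts cyc _ N hd.
apply: (ev_and h1 h2) => w ho he.
pose f j := twist w ^ (n + (j * p)%:Z) *: sm_delta w (r (walk w j)).
have -> : avg w n' r' = \sum_(j < sm_size w) f (d + j)%N.
  apply: eq_bigr => j _; rewrite he // /f nE /walk -iterD -mulnDl; congr (_ *: _).
  by congr (_ ^ _); rewrite mulnDl; lia.
apply: (@shift_sum_le _ _ f) => j jN.
by rewrite /f rnZ twist_exp_rn mul1r (orbit_rn_delta (sm_rep w)) //; exact: ho.
Qed.

Lemma ev_avg_same y n r n' r' : germ x0 y n r -> germ x0 y n' r' ->
  exists C : R, ev (fun w => rn (avg w n r - avg w n' r') <= C).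
Proof.
move=> hg hg'; have [nn'|nn'] := leP n n'; first exact: ev_avg_same_le hg hg' nn'.
have [C hC] := ev_avg_same_le hg' hg (ltW nn'); exists C.
by apply: (ev_and hC hC) => w h _; rewrite rn_sub.
Qed.

(** Each summand is made at most 1 / (N + 1), so the total stays below 1 however long the walk
    is. *)
Lemma ev_close (phi : S -> R[i]) : {for x0, continuous (phi : S -> R[i]^o)} ->
  ev (fun w => \sum_(j < sm_size w) rn (phi (walk w j) - phi x0) <= 1).
Proof.
move=> hc.
apply: (ev_near (Q := fun N x => forall j, (j < N)%N ->
   rn (phi (iter (j * p) s x) - phi x0) <= N.+1%:R^-1)) => [N|w hw].
  have /continuous_rnP/(_ N.+1%:R^-1) h := hc.
  have h' : \forall x \near x0, rn (phi x - phi x0) <= N.+1%:R^-1.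
    by apply: filterS (h _) => [x|]; [rewrite rn_sub => /ltW | rewrite invr_gt0 ltr0n].
  exact: near_shifts cyc _ N h'.
apply: (@le_trans _ _ (\sum_(j < sm_size w) (sm_size w).+1%:R^-1)).
  by apply: ler_sum => j _; apply: hw.
rewrite sumr_const card_ord -[leLHS]mulr_natl ler_pdivrMr ?ltr0n // mul1r ler_nat.
exact: leqnSn.
Qed.

Lemma ev_avg_mult y n r (phi : S -> R[i]) : germ x0 y n r ->
  {for x0, continuous (phi : S -> R[i]^o)} ->
  ev (fun w => rn (\sum_(j < sm_size w) twist w ^ (n + (j * p)%:Z) *:
     (phi (walk w j) *: sm_delta w (r (walk w j))) - phi x0 *: avg w n r) <= 1).
Proof.
move=> hg hc; apply: (ev_and (ev_orbit hg) (ev_close hc)) => w ho; apply: le_trans.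
rewrite /avg scaler_sumr -sumrB (le_trans (rn_sum _ _ _)) //; apply: ler_sum => j _.
rewrite [X in _ - X]scalerA mulrC -scalerA -scalerBr -scalerBl !rnZ twist_exp_rn mul1r.
by rewrite (orbit_rn_delta (sm_rep w)) ?mulr1 //; exact: ho.
Qed.

End Samples.

(** * Semicontinuity of the kernels *)

Section Approximation.
Variables (R : realType) (S : sgds) (A : cstarAlgebra R) (t0 t1 : (S -> R[i]) -> A).
Hypothesis hA : is_sgds_algebra t0 t1.
Variables (x0 : S) (p : nat) (g : R[i]).
Hypothesis cyc : cyclic_at x0 p.
Hypothesis gT : circle R g.
Variables (H0 : hilbertSpace R) (delta0 : S -> H0) (rho0 : A -> H0 -> H0).
Hypothesis hr0 : orbit_representation t0 t1 x0 g delta0 rho0.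
Local Notation s := (sg_map S).
Local Notation U := (sg_dom S).
Local Notation O := (orbit_set x0).
Local Notation sample := (sample t0 t1).
Local Notation ev := (@ev R S A t0 t1 x0 p g).
Implicit Types w : sample.

Lemma germ_choice_ex : exists G : S -> int * (S -> S),
  forall y, O y -> germ x0 y (G y).1 (G y).2.
Proof.
have h y : exists q : int * (S -> S), O y -> germ x0 y q.1 q.2.
  have [Oy|nO] := pselect (O y); last by exists (0, id).
  by have [n [r hr]] := germ_exists Oy; exists (n, r).
by exists (fun y => sval (cid (h y))) => y; exact: (svalP (cid (h y))).
Qed.

(** One branch is fixed for each orbit point; by [ev_avg_same] another choice changes the averages
    only by a bounded amount. *)
Definition the_germ := sval (cid germ_choice_ex).
Lemma the_germP y : O y -> germ x0 y (the_germ y).1 (the_germ y).2.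
Proof. exact: svalP (cid germ_choice_ex) y. Qed.

Definition vec w y := avg p g w (the_germ y).1 (the_germ y).2.

Definition base_model : model S A :=
  @Model R S A H0 delta0 rho0 1 (orbit_rep hr0) ler01.

Definition sample_model w : model S A :=
  @Model R S A (sm_space w) (vec w) (@sm_rho _ _ _ _ _ w) (Num.sqrt (mass p g w))
    (orbit_rep (sm_rep w)) (sqrtr_ge0 _).

(** Including the base model in the notion of eventual truth forces the combination found for the
    samples to be valid in [H0] as well. *)
Definition evm (P : model S A -> Prop) := P base_model /\ ev (fun w => P (sample_model w)).

Lemma evm_eventual : eventual evm.
Proof.
split=> [P h|P Q T [h1 h2] [h3 h4] h]; first by split=> //; apply: ev_all => w; exact: h.
split; first exact: h.
by apply: (ev_and h2 h4) => w; exact: h.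
Qed.

Lemma ev_vec_norm y : O y -> ev (fun w => rn (vec w y) = Num.sqrt (mass p g w)).
Proof.
move=> Oy; have h := ev_avg_norm t0 t1 cyc gT (the_germP Oy).
apply: (ev_and h h) => w e _; rewrite -e sqrtr_sqr ger0_norm ?rn_ge0 //.
Qed.

Lemma evm_vec_le y : O y -> evm (fun m => rn (md_vec m y) <= md_norm m).
Proof.
move=> Oy; split; first by rewrite /= (orbit_rn_delta hr0).
by apply: (ev_and (ev_vec_norm Oy) (ev_vec_norm Oy)) => w /= ->.
Qed.

(** Passing to a preimage lowers the degree by one, and the power of [twist g w] lost in this way
    turns the angle of the sample into [g]. This dictates the weights in [avg]. *)
Lemma twist_step w m : twist g w ^ (1 + m) * sm_ang w = g * twist g w ^ m.
Proof.
by rewrite expfzDr ?(twist_neq0 gT) // expr1z mulrAC [X in X * _]mulrC ang_twist.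
Qed.

Lemma twist_step_conj w m :
  twist g w ^ m * Num.conj (sm_ang w) = Num.conj g * twist g w ^ (m + 1).
Proof. by rewrite -(conj_ang_twist gT w) expfzDr ?(twist_neq0 gT) // expr1z mulrCA. Qed.

(** The combination is exact in the base model and off by an absolute constant in the samples, which
    [ev_const] absorbs. *)
Lemma approximable_of_bound a :
  (forall y, O y -> exists2 u : seq (R[i] * S), supported O u &
     rho0 a (delta0 y) = comb base_model u /\
     exists C : R, ev (fun w => rn (sm_rho a (vec w y) - comb (sample_model w) u) <= C)) ->
  approximable O evm a.
Proof.
move=> h y e Oy e0; have [u su [e1 [C hC]]] := h y Oy; exists u => //; split.
  by rewrite /= e1 subrr rn0 mulr1 ltW.
apply: (ev_and hC (ev_const t0 t1 x0 p gT C e0)) => w /=; exact: le_trans.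
Qed.

Lemma sm_rho_avg w a n (r : S -> S) :
  sm_rho a (avg p g w n r) = \sum_(j < sm_size w) twist g w ^ (n + (j * p)%:Z) *:
     sm_rho a (sm_delta w (r (walk p w j))).
Proof.
rewrite /avg (repLsum (orbit_rep (sm_rep w))); apply: eq_bigr => j _.
by rewrite (repLZ (orbit_rep (sm_rep w))).
Qed.

Lemma approximable_t0 f : C0 f -> approximable O evm (t0 f).
Proof.
move=> hf; apply: approximable_of_bound => y Oy; exists [:: (f y, y)].
  by rewrite /= andbT; apply/asboolP.
split; first by rewrite /comb big_seq1 /= (orbit_rep_t0 hr0).
exists 1; have hg := the_germP Oy; set n := (the_germ y).1; set r := (the_germ y).2.
have [_ [_ [_ r0 rc _]]] := hg.
have fc : {for x0, continuous (f \o r : S -> R[i]^o)}.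
  by apply: continuous_comp => //; have [h _] := hf; exact: h.
have h1 := ev_avg_mult t0 t1 cyc gT hg fc.
apply: (ev_and (ev_orbit t0 t1 g cyc hg) h1) => w ho.
have fr0 : (f \o r) x0 = f y by rewrite /= /r r0.
rewrite fr0 /comb big_seq1 /=; apply: le_trans.
rewrite le_eqVlt; apply/orP; left; apply/eqP; congr (rn (_ - _)).
rewrite /vec sm_rho_avg; apply: eq_bigr => j _; congr (_ *: _).
by rewrite (orbit_rep_t0 (sm_rep w)) //; exact: ho.
Qed.

Lemma C0_conj (f : S -> R[i]) : C0 f -> C0 (fun x => Num.conj (f x)).
Proof.
move=> [fc fv]; split.
  move=> x; apply/continuous_rnP => e e0; have /continuous_rnP/(_ e e0) := fc x.
  by apply: filterS => y; rewrite -rmorphB rn_conj.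
move=> e /fv[K [cK hK]]; exists K; split=> // x /hK.
by rewrite norm_conjC.
Qed.

Lemma approximable_t0_star f : C0 f -> approximable O evm (cstar (t0 f)).
Proof.
move=> hf; rewrite -(t0_star (sgds_algebra_relations hA) hf).
by apply: approximable_t0; exact: C0_conj.
Qed.

Lemma sum_rn_le (V : normedZmodType R[i]) (l : seq S) (F : S -> V) (C : S -> R) :
  (forall z, z \in l -> rn (F z) <= C z) -> rn (\sum_(z <- l) F z) <= \sum_(z <- l) C z.
Proof.
move=> h; rewrite (le_trans (rn_sum _ _ _)) // big_seq [leRHS]big_seq.
by apply: ler_sum.
Qed.

Lemma approximable_t1 xi : Cc U xi -> approximable O evm (t1 xi).
Proof.
move=> hx; have [xc [K [cK KU K0]]] := hx.
apply: approximable_of_bound => y Oy.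
have [L [uL LP sumL nearL]] := near_fiber_sum R y cK KU.
have LO z : z \in L -> O z by move=> /LP[_]; exact: orbit_fiber.
exists [seq (g * xi z, z) | z <- L].
  by apply/allP => _ /mapP[z /LO Oz ->] /=; apply/asboolP.
split.
  rewrite (orbit_rep_t1 hr0) // sumL; last by move=> z /K0 ->; rewrite scale0r.
  by rewrite /comb big_map scaler_sumr; apply: eq_bigr => z _; rewrite scalerA.
have hg := the_germP Oy; set n := (the_germ y).1 in hg; set r := (the_germ y).2 in hg.
have [_ [_ [_ r0 rc _]]] := hg.
have hgz z : z \in L -> germ x0 z (n - 1) (sec z \o r).
  by move=> /LP[_ [Uz sz]]; exact: germ_sec hg Uz sz.
(* Two errors add up: replacing the values of [xi] along the branch by [xi z] costs at most 1, and
   replacing the branch [sec z \o r] by the fixed one of [z] costs a constant [C]. *)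
have bound z : z \in L -> exists C : R, ev (fun w =>
    rn (\sum_(j < sm_size w) twist g w ^ (n - 1 + (j * p)%:Z) *:
       (xi (sec z (r (walk p w j))) *: sm_delta w (sec z (r (walk p w j)))) -
       xi z *: vec w z) <= C).
  move=> zL; have hz := hgz z zL.
  have [C hC] := ev_avg_same t0 t1 cyc gT hz (the_germP (LO z zL)).
  have [_ [_ [_ z0 zc _]]] := hz.
  have xic : {for x0, continuous (xi \o (sec z \o r) : S -> R[i]^o)}.
    by apply: continuous_comp => //; exact: xc.
  exists (1 + rn (xi z) * C).
  apply: (ev_and (ev_avg_mult t0 t1 cyc gT hz xic) hC) => w h1 h2.
  rewrite (le_trans (rn_triangle (xi z *: avg p g w (n - 1) (sec z \o r)) _ _)) //.
  rewrite -scalerBr rnZ lerD //; last by rewrite ler_wpM2l ?rn_ge0.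
  by move: h1; rewrite /= -[sec z (r x0)]/((sec z \o r) x0) z0.
have [C hC] : exists C : S -> R, forall z, z \in L -> ev (fun w =>
    rn (\sum_(j < sm_size w) twist g w ^ (n - 1 + (j * p)%:Z) *:
       (xi (sec z (r (walk p w j))) *: sm_delta w (sec z (r (walk p w j)))) -
       xi z *: vec w z) <= C z).
  have h z : exists C : R, z \in L -> ev (fun w =>
    rn (\sum_(j < sm_size w) twist g w ^ (n - 1 + (j * p)%:Z) *:
       (xi (sec z (r (walk p w j))) *: sm_delta w (sec z (r (walk p w j)))) -
       xi z *: vec w z) <= C).
    have [zL|] := boolP (z \in L); last by exists 0.
    by have [C hC] := bound z zL; exists C.
  by exists (fun z => sval (cid (h z))) => z; exact: (svalP (cid (h z))).
exists (\sum_(z <- L) C z).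
(* The local description of fibers near [y], pulled back by [r] and along the walk: over each point
   of the average, the relevant fiber consists of the branches [sec z]. *)
have fib : ev (fun w => forall j, (j < sm_size w)%N ->
    \sum_(z \in sg_fiber (r (walk p w j))) (xi z *: sm_delta w z) =
    \sum_(z <- L) (xi (sec z (r (walk p w j))) *: sm_delta w (sec z (r (walk p w j))))).
  apply: (@ev_near R S A t0 t1 x0 p g (fun N x =>
    forall j, (j < N)%N -> forall (V : lmodType R[i]) (F : S -> V),
      (forall z, ~ K z -> F z = 0) ->
      \sum_(z \in sg_fiber (r (iter (j * p) s x))) F z =
      \sum_(z <- L) F (sec z (r (iter (j * p) s x))))) => [N|w h j jN].
    rewrite -r0 in nearL; have h := rc _ nearL.
    exact: (near_shifts cyc N h).
  by apply: h => // z /K0 ->; rewrite scale0r.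
apply: (ev_and (ev_and (ev_orbit t0 t1 g cyc hg) fib (fun w h h' =>
  conj h h')) (ev_seq hC)) => w [ho hf] hb.
have -> : sm_rho (t1 xi) (vec w y) - comb (sample_model w) [seq (g * xi z, z) | z <- L] =
  \sum_(z <- L) g *: (\sum_(j < sm_size w) twist g w ^ (n - 1 + (j * p)%:Z) *:
       (xi (sec z (r (walk p w j))) *: sm_delta w (sec z (r (walk p w j)))) -
       xi z *: vec w z).
  under [RHS]eq_bigr => z _ do rewrite scalerBr scaler_sumr.
  rewrite sumrB /comb big_map /=; congr (_ - _); last by apply: eq_bigr => z _;
    rewrite scalerA.
  rewrite exchange_big /vec sm_rho_avg; apply: eq_bigr => j _ /=.
  rewrite (orbit_rep_t1 (sm_rep w)) //; last exact: ho.
  rewrite hf // !scaler_sumr; apply: eq_bigr => z _; rewrite !scalerA !mulrA -twist_step.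
  by congr (twist g w ^ _ * _ * _ *: _); lia.
apply: sum_rn_le => z zL; rewrite rnZ (circleP g).1 // mul1r.
exact: hb.
Qed.

Lemma approximable_t1_star xi : Cc U xi -> approximable O evm (cstar (t1 xi)).
Proof.
move=> hx; have [xc _] := hx.
apply: approximable_of_bound => y Oy.
have hg := the_germP Oy; set n := (the_germ y).1 in hg; set r := (the_germ y).2 in hg.
have [_ [_ [_ r0 rc _]]] := hg.
have phic : {for x0, continuous ((fun x => Num.conj (xi (r x))) : S -> R[i]^o)}.
  have : {for x0, continuous (xi \o r : S -> R[i]^o)} by apply: continuous_comp => //;
    exact: xc.
  move=> /continuous_rnP h; apply/continuous_rnP => e /h; apply: filterS => x.
  by rewrite -rmorphB rn_conj.
(* Outside the domain the limit vector is zero, but points of the walk may still be mapped into the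
   domain by [r]. There [xi] is close to [xi y = 0], and [ev_close] bounds the total. *)
have [Uy|nU] := pselect (U y); last first.
  have xy : xi y = 0 by have [_ [K [_ KU K0]]] := hx; apply: K0 => /KU.
  exists [::] => //; split.
    by rewrite (orbit_t1_star hr0) // asboolF // /comb big_nil.
  exists 1; apply: (ev_and (ev_orbit t0 t1 g cyc hg) (ev_close t0 t1 g cyc phic)) => w ho.
  apply: le_trans; rewrite /comb big_nil subr0 /vec sm_rho_avg (le_trans (rn_sum _ _ _)) //.
  apply: ler_sum => j _; rewrite rnZ twist_exp_rn // mul1r r0 xy rmorph0 subr0.
  rewrite (orbit_t1_star (sm_rep w)) //; last exact: ho.
  case: asboolP => Uj; last by rewrite rn0 rn_ge0.
  rewrite rnZ rnM rn_conj (circleP _).1 ?mul1r; last exact: sm_circle.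
  rewrite (orbit_rn_delta (sm_rep w)) ?mulr1 //.
  by have /(orbit_map (sm_pt w) Uj) := ho j (ltn_ord j).
have Osy : O (s y) by have /(orbit_map x0 Uy) := Oy.
exists [:: (Num.conj g * Num.conj (xi y), s y)]; first by rewrite /= andbT; apply/asboolP.
split; first by rewrite (orbit_t1_star hr0) // asboolT // /comb big_seq1.
have hgs := germ_map hg Uy.
have [C hC] := ev_avg_same t0 t1 cyc gT hgs (the_germP Osy).
exists (1 + rn (xi y) * C).
have nU : ev (fun w => forall j, (j < sm_size w)%N -> U (r (walk p w j))).
  apply: (@ev_near R S A t0 t1 x0 p g (fun N x =>
    forall j, (j < N)%N -> U (r (iter (j * p) s x)))) => // N.
  have : \forall x \near x0, U (r x) by apply: rc; rewrite /= r0; exact: near_dom.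
  by move=> h; exact: near_shifts cyc _ N h.
apply: (ev_and (ev_and (ev_orbit t0 t1 g cyc hg) nU (fun w h h' => conj h h'))
  (ev_and (ev_avg_mult t0 t1 cyc gT hgs phic) hC (fun w h h' => conj h h'))) =>
    w [ho hu] [h1 h2].
have -> : sm_rho (cstar (t1 xi)) (vec w y) - comb (sample_model w) [:: (Num.conj g *
  Num.conj (xi y), s y)] =
  Num.conj g *: (\sum_(j < sm_size w) twist g w ^ (n + 1 + (j * p)%:Z) *:
     (Num.conj (xi (r (walk p w j))) *: sm_delta w ((s \o r) (walk p w j))) -
     Num.conj (xi y) *: vec w (s y)).
  rewrite scalerBr /comb big_seq1 /= scalerA; congr (_ - _).
  rewrite /vec sm_rho_avg scaler_sumr; apply: eq_bigr => j _.
  rewrite (orbit_t1_star (sm_rep w)) //; last exact: ho.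
  rewrite asboolT; last exact: hu.
  rewrite !scalerA !mulrA twist_step_conj.
  by congr (_ * twist g w ^ _ * _ *: _); lia.
rewrite rnZ rn_conj (circleP g).1 // mul1r.
rewrite (le_trans (rn_triangle (Num.conj (xi y) *: avg p g w (n + 1) (s \o r)) _ _)) //.
rewrite -scalerBr rnZ rn_conj lerD //; last by rewrite ler_wpM2l ?rn_ge0.
by move: h1; rewrite r0.
Qed.

Lemma all_approximable a : approximable O evm a.
Proof.
have E := sgds_algebra_generated hA (approximable_subalgebra evm_eventual evm_vec_le).
have : [set a | approximable O evm a /\ approximable O evm (cstar a)] a.
  rewrite E // => [f hf|xi hx].
    by split; [exact: approximable_t0 | exact: approximable_t0_star].
  by split; [exact: approximable_t1 | exact: approximable_t1_star].
by case.
Qed.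

(** On the finitely many points of [u], the Gram matrix of the averages is [mass] times that of the
    basis vectors. *)
Lemma ev_comb_norm u : supported O u ->
  ev (fun w => rn (comb (sample_model w) u) = Num.sqrt (mass p g w) * rn (comb base_model
    u)).
Proof.
move=> su; have [on _] := orbit_basis hr0.
have sO q : q \in u -> O q.2 by move=> qu; have /allP/(_ q qu)/asboolP := su.
have h : ev (fun w => forall q, q \in u -> forall q', q' \in u ->
    hdot _ (vec w q.2) (vec w q'.2) = (mass p g w)%:C * hdot H0 (delta0 q.2) (delta0 q'.2)).
  apply: ev_seq => q qu; apply: ev_seq => q' qu'.
  rewrite (on _ _ (sO q qu) (sO q' qu')); case: (eqVneq q.2 q'.2) => [e|/eqP ne].
    rewrite e; have hn := ev_avg_norm t0 t1 cyc gT (the_germP (sO _ qu')).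
    by apply: (ev_and hn hn) => w h _; rewrite mulr1 dot_rn h.
  have hd := ev_avg_distinct t0 t1 g cyc (the_germP (sO _ qu)) (the_germP (sO _ qu')) ne.
  by apply: (ev_and hd hd) => w h _; rewrite mulr0.
apply: (ev_and h (ev_mass_ge t0 t1 x0 p gT)) => w hw mw.
have m0 : 0 <= mass p g w by apply: le_trans mw; rewrite ler0n.
apply/eqP; rewrite -(@eqrXn2 _ 2) ?mulr_ge0 ?rn_ge0 ?sqrtr_ge0 //.
rewrite exprMn sqr_sqrtr // !rn_sqrE /comb; apply/eqP.
have -> : hdot (md_space (sample_model w)) (\sum_(q <- u) q.1 *: md_vec (sample_model w)
  q.2)
   (\sum_(q <- u) q.1 *: md_vec (sample_model w) q.2) = (mass p g w)%:C *
   hdot H0 (\sum_(q <- u) q.1 *: delta0 q.2) (\sum_(q <- u) q.1 *: delta0 q.2).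
  rewrite !dot_suml mulr_sumr; apply: eq_big_seq => q qu.
  rewrite !dot_sumr mulr_sumr; apply: eq_big_seq => q' qu'.
  rewrite !dotZl !dotZr /= hw // !mulrA; congr (_ * _).
  by rewrite mulrC mulrA.
by rewrite dot_rn -rmorphM.
Qed.

Theorem approximation (J : set A) :
  (forall N (W : set S), nbhs x0 W -> exists x h, [/\ W x, circle R h,
     J `<=` orbit_kernel t0 t1 x h & coherent p N x (g / h)]) ->
  forall a, J a -> rho0 a = (fun=> 0).
Proof.
move=> hyp a Ja.
have sampleP (P : sample -> Prop) : ev P -> exists w, P w /\
    (sm_rho a : sm_space w -> _) = (fun=> 0) /\ (0 < sm_size w)%N /\ coherent p (sm_size
      w) (sm_pt w) (g / sm_ang w).
  (* The length [N0.+1] is positive, hence so is the mass, by which the final estimate is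
     divided. *)
  move=> [N0 hN]; have hW := hN _ (leqnSn N0).
  have [x [h [Wx hT Jk co]]] := hyp N0.+1 _ hW.
  have [H [delta [rho hr]]] := orbit_representation_exists x hA hT.
  exists (@Sample R S A t0 t1 N0.+1 x h H delta rho hT hr); split; first exact: Wx.
  by split; [exact: (Jk a Ja H delta rho hr) | split].
apply: (rep_basis_eq0 (orbit_rep hr0) (orbit_basis hr0)) => y Oy.
apply: rn_small => e e0; have e2 : 0 < e / 2 by rewrite divr_gt0.
have [u su [h0 h1]] := all_approximable a Oy e2.
have [w [[hw1 [hw2 hw3]] [rw [sw cw]]]] := sampleP _ (ev_and h1 (ev_and (ev_comb_norm su)
   (ev_mass_ge t0 t1 x0 p gT) (fun w h h' => conj h h')) (fun w h h' => conj h h')).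
have m0 : 0 < Num.sqrt (mass p g w).
  by rewrite sqrtr_gt0 (lt_le_trans _ hw3) // ltr0n.
(* As [a] acts by zero on the sample, the combination itself is small there; division by the square
   root of the mass bounds it by [e / 2] in [H0]. *)
move: hw1; rewrite /= rw sub0r rnN hw2 mulrC ler_pM2r // => hu.
move: h0; rewrite /= mulr1 => h0.
rewrite -[rho0 a (delta0 y)](subrK (comb base_model u)) (le_trans (rnD _ _)) //.
by lra.
Qed.

End Approximation.

(** * Periods and preperiods *)

Section Periods.
Variable S : sgds.
Implicit Types (x : S) (k n m : nat).
Local Notation s := (sg_map S).
Local Notation U := (sg_dom S).
Local Notation Un := (sg_iter_dom S).

Lemma least_some (P : set nat) n : least P = Some n -> P n /\ forall m, P m -> (n <= m)%N.
Proof.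
rewrite /least; case: pselect => // h [<-]; case: ex_minnP => k /asboolP Pk km.
by split=> // m Pm; apply: km; exact/asboolP.
Qed.

Lemma least_none (P : set nat) : least P = None -> forall n, ~ P n.
Proof. by rewrite /least; case: pselect => // h _ n Pn; apply: h; exists n. Qed.

Lemma least_ex (P : set nat) n : P n -> exists2 k, least P = Some k & (k <= n)%N.
Proof.
move=> Pn; case E : (least P) => [k|]; last by have := least_none E Pn.
by exists k => //; have [_] := least_some E; apply.
Qed.

(** Beyond time [k + n] the orbit only revisits points whose membership in the domain is already
    known. *)
Lemma recurs_dom x k n : (1 <= n)%N -> recurs x k n -> forall m, Un m x.
Proof.
move=> n1 [d e]; elim/ltn_ind => m ih.
have [mkn|knm] := leqP m (k + n); first exact: iter_dom_le d.
case: m knm ih => // m knm ih; split; first exact: ih.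
have mE : m = ((m - (k + n)) + (k + n))%N by rewrite subnK.
have -> : iter m s x = iter (m - n) s x.
  by rewrite {1}mE iterD e -iterD; congr iter; lia.
have h : ((m - n).+1 < m.+1)%N by lia.
by have [] := ih _ h.
Qed.

Lemma recurs_le x k k' n : (1 <= n)%N -> (k <= k')%N -> recurs x k n -> recurs x k' n.
Proof.
move=> n1 kk' h; split; first exact: recurs_dom n1 h _.
have [_ e] := h; rewrite -(subnK kk') -addnA !iterD.
by rewrite -[in RHS]e iterD.
Qed.

Lemma recurs_mul x k n d : (1 <= n)%N -> recurs x k n -> recurs x k (d * n).
Proof.
move=> n1 h; split; first exact: recurs_dom n1 h _.
elim: d => [|d ih]; first by rewrite addn0.
by rewrite mulSn addnCA iterD ih -iterD addnC; case: h.
Qed.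

Lemma recurs_sub x k n m : (1 <= n)%N -> (n <= m)%N ->
  recurs x k n -> recurs x k m -> recurs x k (m - n).
Proof.
move=> n1 nm h [d e]; split; first exact: recurs_dom n1 h _.
have [_ e'] := h.
have -> : iter (k + (m - n)) s x = iter (m - n) s (iter k s x) by rewrite -iterD addnC.
have E : (m - n + (k + n) = k + m)%N by lia.
by rewrite -[in LHS]e' -iterD E.
Qed.

Lemma period_spec x p : period x = Some p ->
  [/\ (1 <= p)%N, exists k, recurs x k p &
    forall k n, (1 <= n)%N -> recurs x k n -> (p %| n)%N /\ recurs x k p].
Proof.
move=> /least_some[[p1 [k0 hk0]] pmin]; split=> //; first by exists k0.
move=> k n n1 hkn.
have h1 := recurs_le p1 (leq_maxr k k0) hk0.
have h2 := recurs_le n1 (leq_maxl k k0) hkn.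
(* At the common time [maxn k k0] recurrences can be subtracted, so the remainder of [n] modulo [p]
   would be a smaller period. *)
have dv : (p %| n)%N.
  rewrite /dvdn; have [//|r1] := posnP (n %% p).
  have : recurs x (maxn k k0) (n %% p).
    have [q0|q0] := posnP (n %/ p).
      by have := h2; rewrite {1}(divn_eq n p) q0.
    have -> : (n %% p = n - n %/ p * p)%N by rewrite {2}(divn_eq n p) addKn.
    apply: recurs_sub => //;
      [by rewrite muln_gt0 q0 | exact: leq_trunc_div | exact: recurs_mul].
  move=> h; have : (p <= n %% p)%N by apply: pmin; split=> //; exists (maxn k k0).
  by rewrite leqNgt ltn_mod p1.
split=> //; split; first exact: recurs_dom n1 hkn _.
have [_ e] := recurs_mul (maxn k k0) n1 hkn.
(* Adding a multiple of [n] carries [k] beyond [k0] without moving the point, and there [p] is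
   already a period. *)
have kk : (maxn k k0 <= k + maxn k k0 * n)%N.
  by rewrite (leq_trans _ (leq_addl _ _)) // leq_pmulr.
have [_ e'] := recurs_le p1 kk h1.
have E : iter k s x = iter (k + maxn k k0 * n) s x by rewrite e.
rewrite addnC iterD E -iterD addnC -[RHS]E.
by rewrite e' -E.
Qed.

Lemma period_none x : period x = None -> forall k n, (1 <= n)%N -> ~ recurs x k n.
Proof. by move=> /least_none h k n n1 hk; apply: (h n); split=> //; exists k. Qed.

Lemma period_iter_eq x p n m : period x = Some p -> Un n x -> Un m x ->
  iter n s x = iter m s x -> n = m %[mod p].
Proof.
move=> /period_spec[p1 _ h].
wlog nm : n m / (n <= m)%N.
  move=> H; have [nm|/ltnW mn] := leqP n m; first exact: H.
  by move=> h1 h2 h3; apply/esym; apply: H.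
move=> h1 h2 h3; have [->//|nm'] := eqVneq n m.
have nm1 : (1 <= m - n)%N by rewrite subn_gt0 ltn_neqAle nm'.
have [|dv _] := h n (m - n)%N nm1.
  by split; rewrite subnKC.
by apply/eqP; rewrite eq_sym eqn_mod_dvd.
Qed.

Lemma period_none_iter_eq x n m : period x = None -> Un n x -> Un m x ->
  iter n s x = iter m s x -> n = m.
Proof.
move=> /period_none h.
wlog nm : n m / (n <= m)%N.
  move=> H; have [nm|/ltnW mn] := leqP n m; first exact: H.
  by move=> h1 h2 h3; apply/esym; apply: H.
move=> h1 h2 h3; apply/eqP; apply: contrapT => /negP nm'.
have nm1 : (1 <= m - n)%N by rewrite subn_gt0 ltn_neqAle nm'.
by apply: (h n (m - n)%N nm1); split; rewrite subnKC.
Qed.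

Lemma cyclic_preperiod x p l : period x = Some p -> recurs x l p -> cyclic_at (iter l s
  x) p.
Proof.
move=> hp hl; have [p1 _ _] := period_spec hp.
have dom := recurs_dom p1 hl; have [d e] := hl.
split.
- by have /iter_domD[] : Un (p + l) x by exact: dom.
- by rewrite -iterD addnC.
- move=> n m hn hm; rewrite -!iterD => E.
  have := period_iter_eq hp (dom _) (dom _) E.
  by move/eqP; rewrite eqn_modDr => /eqP.
Qed.

Lemma cyclic_exists x : exists k p, Un k x /\ cyclic_at (iter k s x) p.
Proof.
case E : (period x) => [p|].
  have [p1 [k hk] _] := period_spec E; exists k, p; split; first exact: recurs_dom p1 hk _.
  exact: cyclic_preperiod.
exists 0%N, 0%N; split=> //; split=> // n m hn hm e.
by rewrite (period_none_iter_eq E hn hm e).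
Qed.

Lemma orbit_set_map x : U x -> orbit_set x = orbit_set (s x).
Proof.
move=> Ux; apply/seteqP; split=> z [n [m [zn xm e]]]; last first.
  by exists n, m.+1; split=> //; [apply/iter_domS | rewrite iterSr].
case: m xm e => [|m] xm e.
  by exists n.+1, 0%N; split=> //=; [rewrite e | rewrite e].
by exists n, m; split=> //; [have /iter_domS[] := xm | rewrite -iterSr].
Qed.

(* Close to [x], a point whose preperiod differs from that of [x] winds around the
   cycle of [x] arbitrarily often without closing up. *)
Lemma near_walk_injective x p l N : period x = Some p -> preperiod x = Some l ->
  \forall y \near x, preperiod y <> Some l ->
    forall j k, (j < N)%N -> (k < N)%N ->
      iter (j * p) s (iter l s y) = iter (k * p) s (iter l s y) -> j = k.
Proof.
move=> hp; rewrite /preperiod hp => /least_some[hl lmin].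
have [p1 _ pspec] := period_spec hp; have dom := recurs_dom p1 hl.
have cyc := cyclic_preperiod hp hl; set w := iter l s x in cyc.
have near_inj : \forall w' \near w, forall j, j \in iota 0 N -> forall m, (m < N)%N ->
    iter (j * p) s w' = iter (j * p) s (iter (m * p) s w') -> w' = iter (m * p) s w'.
  apply: near_seq => j _; have [dj _] := cyclic_iter cyc j.
  have [V nV hV] := iter_locally_injective dj.
  apply: filterS2 nV (near_shifts cyc N nV) => w' Vw' h m mN; apply: hV => //.
  exact: h.
have near_dom : \forall w' \near w, forall m, m \in iota 0 N -> Un (m * p) w'.
  by apply: near_seq => m _; apply: near_iter_dom; have [] := cyclic_iter cyc m.
have lc := iter_continuous (dom l).
(* At [x] this is minimality of [l], and inequality is an open condition. The guard is needed: for
   [l = 0] the truncated predecessor is 0, where [x] does recur. *)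
have near_pre : \forall y \near x, forall m, m \in iota 1 N -> (0 < l)%N ->
    iter (l.-1 + m * p) s y <> iter l.-1 s y.
  apply: near_seq => m; rewrite mem_iota => /andP[m1 _].
  have [->|l0] := posnP l; first exact: nearW.
  have : \forall y \near x, iter (l.-1 + m * p) s y <> iter l.-1 s y.
    apply: near_neq; try exact: iter_continuous.
    move=> e; have mp : (1 <= m * p)%N by rewrite muln_gt0 m1.
    have [_ /lmin] := pspec l.-1 (m * p)%N mp (conj (dom _) e).
    by rewrite leqNgt prednK ?leqnn.
  by apply: filterS.
have h1 := lc _ near_inj; have h2 := lc _ near_dom.
apply: filterS3 (filterI (near_iter_dom (dom l)) near_pre) h1 h2 =>
  y [Uly hpre] hinj hdom ly j k.
wlog jk : j k / (j <= k)%N.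
  move=> H; have [jk|/ltnW kj] := leqP j k; first exact: H.
  by move=> jN kN e; apply/esym; apply: H.
move=> jN kN e; apply/eqP; apply: contrapT => /negP jk'; apply: ly.
have m1 : (1 <= k - j)%N by rewrite subn_gt0 ltn_neqAle jk'.
have mN : (k - j < N)%N by lia.
have e' : iter l s y = iter ((k - j) * p) s (iter l s y).
  apply: (hinj j) => //; first by rewrite mem_iota.
  by rewrite e -[RHS]iterD -mulnDl subnKC.
have mp : (1 <= (k - j) * p)%N by rewrite muln_gt0 m1.
have rec : recurs y l ((k - j) * p).
  split; last by rewrite addnC iterD -e'.
  by rewrite addnC iter_domD; split=> //; apply: hdom; rewrite mem_iota.
have [q qE _] : exists2 q, period y = Some q & (q <= (k - j) * p)%N.
  by apply: least_ex; split=> //; exists l.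
rewrite /preperiod qE; have [q1 _ qspec] := period_spec qE.
have [qd recq] := qspec _ _ mp rec.
have [l' l'E l'l] := least_ex (P := [set k | recurs y k q]) recq.
(* Were the preperiod of [y] below [l], the recurrence would already hold at [l.-1], with
   [(k - j) * p] as a multiple of the period of [y]; this is what [hpre] excludes. *)
rewrite l'E; congr Some; apply/eqP; rewrite eqn_leq l'l /= leqNgt; apply/negP => ll.
have l0 : (0 < l)%N by exact: leq_trans ll.
have [hl' _] := least_some l'E.
have hl1 : recurs y l.-1 q by apply: recurs_le hl' => //; rewrite -ltnS prednK.
have [_ ] := recurs_mul ((k - j) * p %/ q) q1 hl1.
by rewrite divnK //; apply: hpre => //; rewrite mem_iota m1 add1n ltnS ltnW.
Qed.

End Periods.

(** * Admissibility *)

Section Zeta.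
Variable R : realType.

Lemma zeta_exp n (k : nat) :
  zeta R n ^+ k = cos (2 * pi / n%:R * k%:R) +i* sin (2 * pi / n%:R * k%:R).
Proof.
elim: k => [|k ih]; first by rewrite expr0 mulr0 cos0 sin0.
rewrite exprSr ih /zeta; set t := 2 * pi / n%:R.
rewrite -(natr1 k) mulrDr mulr1 cosD sinD.
by apply/eqP; rewrite eq_complex /= eqxx addrC eqxx.
Qed.

Lemma zeta_expn n : (0 < n)%N -> zeta R n ^+ n = 1.
Proof.
move=> n0; rewrite zeta_exp divfK ?pnatr_eq0 -?lt0n //.
have -> : 2 * pi = pi + pi :> R by rewrite mulr_natl mulr2n.
by rewrite cosD sinD cospi sinpi !mulr0 !mul0r subr0 addr0 mulrNN mulr1.
Qed.

Lemma zeta_circle n : circle R (zeta R n).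
Proof.
apply/circleP; rewrite /rn normc_def /zeta /=.
by rewrite cos2Dsin2 sqrtr1.
Qed.

Lemma circleM (a b : R[i]) : circle R a -> circle R b -> circle R (a * b).
Proof. by move=> /circleP ha /circleP hb; apply/circleP; rewrite rnM ha hb mulr1. Qed.

Lemma circleX (a : R[i]) n : circle R a -> circle R (a ^+ n).
Proof. by move=> /circleP ha; apply/circleP; rewrite rnX ha expr1n. Qed.

Lemma circle_neq0 (a : R[i]) : circle R a -> a != 0.
Proof.
by move=> /circleP h; apply/eqP => e; move/eqP: h; rewrite e rn0 eq_sym oner_eq0.
Qed.

Lemma circleV (a : R[i]) : circle R a -> circle R a^-1.
Proof.
move=> h; apply/circleP; have /circleP ha := h.
by rewrite -[LHS]mulr1 -ha -rnM mulVf ?rn1 // circle_neq0.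
Qed.

End Zeta.

(** * Slices of the set of an ideal: invariance, rotation, approximation *)

Section Slices.
Variables (R : realType) (S : sgds) (A : cstarAlgebra R) (t0 t1 : (S -> R[i]) -> A).
Local Notation s := (sg_map S).
Local Notation U := (sg_dom S).
Local Notation Un := (sg_iter_dom S).

Lemma orbit_kernel_eq x x' (g : R[i]) : orbit_set x = orbit_set x' ->
  orbit_kernel t0 t1 x g = orbit_kernel t0 t1 x' g.
Proof.
move=> E; apply/seteqP; split=> a h H delta rho [h1 h2 h3 h4]; apply: (h H delta rho);
  by split=> //; rewrite ?E // -E.
Qed.

(* Multiplying the basis vector at [y] by [c ^ deg y], with
   [deg y = m - n] if [sigma^n y = sigma^m x0], turns the representation
   at [(x0, g)] into the one at [(x0, g * c)]. *)
Lemma orbit_kernel_rotate x0 (g c : R[i]) : circle R c ->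
  (forall n m, Un n x0 -> Un m x0 -> iter n s x0 = iter m s x0 -> c ^+ n = c ^+ m) ->
  orbit_kernel t0 t1 x0 (g * c) `<=` orbit_kernel t0 t1 x0 g.
Proof.
move=> cT hc a ha H delta rho hr.
have c0 := circle_neq0 cT.
(* [e] is [c] to the power deg y. The degree is determined only up to the relations of the orbit,
   which [hc] makes invisible to [c]. *)
pose deg y (e : R[i]) := exists n m, [/\ Un n y, Un m x0, iter n s y = iter m s x0 &
  e = c ^+ m * c^-1 ^+ n].
have deg_uniq y e e' : deg y e -> deg y e' -> e = e'.
  move=> [n [m [h1 h2 h3 ->]]] [n' [m' [h1' h2' h3' ->]]].
  wlog nn : n m n' m' h1 h2 h3 h1' h2' h3' / (n <= n')%N.
    move=> W; have [nn|/ltnW nn] := leqP n n'; first exact: W.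
    by apply/esym; apply: W.
  have E : iter (n' - n + m) s x0 = iter m' s x0 by rewrite iterD -h3 -iterD subnK.
  have D : Un (n' - n + m) x0.
    apply/iter_domD; split=> //; rewrite -h3.
    by have /iter_domD[] : Un (n' - n + n) y by rewrite subnK.
  rewrite -(hc _ _ D h2' E) exprD mulrC -{2}(subnK nn) exprD mulrCA !mulrA -exprMn.
  by rewrite mulVf // expr1n mul1r mulrC.
have deg_ex y : exists e, orbit_set x0 y -> deg y e.
  have [[n [m [h1 h2 h3]]]|nO] := pselect (orbit_set x0 y); last by exists 1.
  by exists (c ^+ m * c^-1 ^+ n) => _; exists n, m.
pose e y := sval (cid (deg_ex y)).
have eP y : orbit_set x0 y -> deg y (e y) by exact: (svalP (cid (deg_ex y))).
have eT y : orbit_set x0 y -> circle R (e y).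
  move=> /eP[n [m [_ _ _ ->]]]; apply: circleM; apply: circleX => //; exact: circleV.
(* A point of the fiber has degree one less; the resulting factor [c] is the one by which the angle
   changes. *)
have efib y z : orbit_set x0 y -> sg_fiber y z -> e y = c * e z.
  move=> Oy [Uz sz]; have Oz := orbit_fiber Oy (conj Uz sz).
  have [n [m [h1 h2 h3 eE]]] := eP _ Oy.
  have : deg z (c ^+ m * c^-1 ^+ n.+1).
    by exists n.+1, m; split=> //; [apply/iter_domS; rewrite sz | rewrite iterSr sz].
  move=> /(deg_uniq _ _ _ (eP _ Oz)) ->; rewrite eE exprS mulrCA.
  by rewrite [c * (_ * _)]mulrA mulfV // mul1r.
apply: (ha H (fun y => e y *: delta y) rho).
have [[on tot] hrep h0 h1] := hr.
split=> //.
- split=> [x y Ox Oy|W Wc hW].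
    rewrite dotZl dotZr on //; case: eqP => [->|_]; last by rewrite !mulr0.
    by rewrite mulr1 -rn_sqr (circleP _).1 ?expr1n //; exact: eT.
  apply: tot => // x Ox; have := subspaceZ Wc (e x)^-1 (hW x Ox).
  by rewrite scalerA mulVf ?scale1r // circle_neq0 //; exact: eT.
- by move=> f x hf Ox; rewrite (repLZ hrep) h0 // !scalerA mulrC.
- move=> xi x hx Ox; rewrite (repLZ hrep) h1 //.
  have [_ [K [cK KU K0]]] := hx.
  have [L [uL LP sumL _]] := near_fiber_sum R x cK KU.
  rewrite !sumL; try by move=> y /K0 ->; rewrite scale0r.
  rewrite !scaler_sumr; apply: eq_big_seq => z /LP[_ fz]; rewrite !scalerA.
  by rewrite (efib x z) //; congr (_ *: _); ring.
Qed.

Variable I : set A.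
Local Notation Y := (ideal_points t0 t1 I).

Lemma in_slice x (g : R[i]) : xsection Y x g <-> circle R g /\ I `<=` orbit_kernel t0 t1
  x g.
Proof. by rewrite /xsection /=; split=> [/set_mem|/mem_set]. Qed.

Lemma slice_map x : U x -> xsection Y x = xsection Y (s x).
Proof.
move=> Ux; apply/seteqP; split=> g /in_slice[gT h]; apply/in_slice; split=> //;
  [rewrite -(orbit_kernel_eq _ (orbit_set_map Ux)) | rewrite (orbit_kernel_eq _
    (orbit_set_map Ux))];
  exact: h.
Qed.

Lemma slice_iter x k : Un k x -> xsection Y x = xsection Y (iter k s x).
Proof. by elim: k => //= k ih [/ih -> Uk]; rewrite slice_map. Qed.

Lemma slice_rotate x0 (g c : R[i]) : circle R c ->
  (forall n m, Un n x0 -> Un m x0 -> iter n s x0 = iter m s x0 -> c ^+ n = c ^+ m) ->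
  xsection Y x0 (g * c) -> xsection Y x0 g.
Proof.
move=> cT hc /in_slice[gcT h]; apply/in_slice; split.
  have -> : g = g * c * c^-1 by rewrite mulfK // circle_neq0.
  by apply: circleM => //; exact: circleV.
by apply: subset_trans h _; exact: orbit_kernel_rotate.
Qed.

Lemma slice_approximation (hA : is_sgds_algebra t0 t1) x0 p (g : R[i]) :
  cyclic_at x0 p -> circle R g ->
  (forall N (W : set S), nbhs x0 W -> exists x h, [/\ W x, xsection Y x h &
     coherent p N x (g / h)]) ->
  xsection Y x0 g.
Proof.
move=> cyc gT hyp; apply/in_slice; split=> // a Ia H delta rho hr.
apply: (approximation hA cyc gT hr (J := I)) => // N W nW.
have [x [h [Wx /in_slice[hT hI] co]]] := hyp N W nW.
by exists x, h.
Qed.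

(** Powers of [b] with exponent at most [N * p] stay within 1 / 2 of 1, so the product of one with
    the conjugate of another is within 1 of 1 and has nonnegative real part. *)
Lemma coherent_near_one p N (x : S) (b : R[i]) : circle R b ->
  rn (b - 1) <= (2 * (N * p)%:R + 1)^-1 -> coherent p N x b.
Proof.
move=> /circleP bT hb j k jN kN _.
have pw m : rn (b ^+ m - 1) <= m%:R * rn (b - 1).
  elim: m => [|m ih]; first by rewrite expr0 subrr rn0 mul0r.
  have -> : b ^+ m.+1 - 1 = b * (b ^+ m - 1) + (b - 1) by rewrite exprS mulrBr mulr1 subrKA.
  by rewrite (le_trans (rnD _ _)) // rnM bT mul1r -natr1 mulrDl mul1r lerD2r.
set M : R := (N * p)%:R in hb.
have M0 : 0 <= M by rewrite ler0n.
have d0 := rn_ge0 (b - 1).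
have hb' : rn (b - 1) * (2 * M + 1) <= 1 by rewrite -ler_pdivlMr ?div1r //; lra.
have bd m : (m < N)%N -> rn (b ^+ (m * p) - 1) <= M * rn (b - 1).
  move=> mN; rewrite (le_trans (pw _)) // ler_wpM2r // ler_nat leq_mul2r.
  by rewrite (ltnW mN) orbT.
set z := _ * _.
have zE : z - 1 = (b ^+ (j * p) - b ^+ (k * p)) * Num.conj (b ^+ (k * p)).
  by rewrite mulrBl -rn_sqr rnX bT !expr1n.
have z1 : rn (z - 1) <= 1.
  rewrite zE rnM rn_conj rnX bT expr1n mulr1.
  have h1 := rn_triangle 1 (b ^+ (j * p)) (b ^+ (k * p)).
  have h2 := bd j jN; have h3 := bd k kN; rewrite rn_sub in h3.
  lra.
have := Re_le_rn (1 - z); rewrite rn_sub raddfB /= => h.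
lra.
Qed.

End Slices.

Theorem proposition6p8 (R : realType) (S : sgds) (A : cstarAlgebra R)
    (t0 t1 : (S -> R[i]%C) -> A) (hA : is_sgds_algebra t0 t1)
    (I : set A) (hI : closed_ideal I) :
  admissible (ideal_points t0 t1 I).
Proof.
set Y := ideal_points t0 t1 I.
split.
- exists (closure (Y : set (S * R[i]^o))); split; first exact: closed_closure.
  apply/seteqP; split=> [q Yq|[x0 g] [/= cl [_ gT]]].
    by split; [exact: subset_closure | split=> //; case: Yq].
  suff /in_slice[_ h] : xsection Y x0 g by split.
  (* The approximation result concerns cyclic points, so limit and nearby points are both moved by
     [iter k], which preserves slices. *)
  have [k [p [Uk cyc]]] := cyclic_exists x0.
  rewrite (slice_iter _ _ _ Uk).
  apply: (slice_approximation hA cyc gT) => N W nW.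
  pose e : R := (2 * (N * p)%:R + 1)^-1.
  have e0 : 0 < e by rewrite invr_gt0 ltr_wpDl // mulr_ge0 // ler0n.
  have nA : nbhs x0 [set x | sg_iter_dom S k x /\ W (iter k (sg_map S) x)].
    by apply: filterI; [exact: near_iter_dom | exact: (iter_continuous Uk nW)].
  have nB : nbhs (g : R[i]^o) [set h : R[i]^o | rn (g - h) < e].
    by apply/nbhs_rnP; exists e.
  have [|[x h] [/= Yxh [[Ux Wx] gh]]] := cl ([set x | sg_iter_dom S k x /\ W (iter k
    (sg_map S) x)] `*` [set h : R[i]^o | rn (g - h) < e]).
    by exists ([set x | sg_iter_dom S k x /\ W (iter k (sg_map S) x)],
      [set h : R[i]^o | rn (g - h) < e]).
  have hx : xsection Y x h by apply/in_slice.
  have [hT _] := Yxh.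
  exists (iter k (sg_map S) x), h; split=> //; first by rewrite -(slice_iter _ _ _ Ux).
  apply: coherent_near_one; first by apply: circleM => //; exact: circleV.
  have h0 := circle_neq0 hT.
  have -> : g / h - 1 = (g - h) / h by rewrite mulrBl divff.
  rewrite rnM (circleP h^-1).1 ?mulr1; first exact: ltW.
  exact: circleV.
- by move=> x Ux; exact: slice_map.
- move=> x0 ne nT.
  have [g0 Yg0] : exists g0, xsection Y x0 g0.
    by apply: contrapT => h; apply: ne; apply/seteqP; split=> // g Yg; apply: h; exists g.
  have [g0T _] := (in_slice _ _ _ _ _).1 Yg0.
  have sub : xsection Y x0 `<=` circle R by move=> g /in_slice[].
  have per : sg_periodic x0.
    apply: contrapT => nper; apply: nT; apply/seteqP; split=> // g gT.
    have E : period x0 = None.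
      case E : (period x0) => [p|//]; have [p1 [k hk] _] := period_spec E.
      by case: nper; exists k, p.
    (* Without periods the orbit imposes no relation on the rotation, so any angle can be carried to
       [g0]. *)
    apply: (@slice_rotate _ _ _ _ _ _ _ _ (g0 / g)).
    - by apply: circleM => //; exact: circleV.
    - by move=> n m hn hm e; rewrite (period_none_iter_eq E hn hm e).
    - by rewrite mulrC divfK // circle_neq0.
  split=> //.
    move=> p hp; have [p1 _ _] := period_spec hp.
    have rot n m : sg_iter_dom S n x0 -> sg_iter_dom S m x0 ->
        iter n (sg_map S) x0 = iter m (sg_map S) x0 -> n = m %[mod p].
      exact: period_iter_eq.
    have zmod j n m : n = m %[mod p] -> zeta R p ^+ j ^+ n = zeta R p ^+ j ^+ m.
      have red k : zeta R p ^+ j ^+ k = zeta R p ^+ j ^+ (k %% p).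
        rewrite {1}(divn_eq k p) exprD -!exprM mulnA (mulnC (j * _)) exprM zeta_expn //.
        by rewrite expr1n mul1r.
      by move=> e; rewrite red e -red.
    apply/seteqP; split=> [_ [g Yg <-]|g Yg].
      (* The power [p.-1] is the inverse of [zeta R p], so the rotated angle returns to [g]. *)
      apply: (@slice_rotate _ _ _ _ _ _ _ _ (zeta R p ^+ p.-1)).
      - by apply: circleX; exact: zeta_circle.
      - by move=> n m hn hm e; apply: zmod; exact: rot.
      - by rewrite mulrAC -exprS prednK // zeta_expn // mul1r.
    exists (zeta R p ^+ p.-1 * g);
      last by rewrite mulrA -exprS prednK // zeta_expn // mul1r.
    apply: (@slice_rotate _ _ _ _ _ _ _ _ (zeta R p ^+ 1)).
    - by apply: circleX; exact: zeta_circle.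
    - by move=> n m hn hm e; apply: zmod; exact: rot.
    - by rewrite mulrAC -exprD addn1 prednK // zeta_expn // mul1r.
  have [k0 [n0 [n1 hk0]]] := per.
  have [p hp] : exists p, period x0 = Some p.
    by case E : (period x0) => [p|]; [exists p | case: (period_none E n1 hk0)].
  have [p1 [k1 hk1] _] := period_spec hp.
  have [l hl] : exists l, preperiod x0 = Some l.
    by rewrite /preperiod hp;
      have [l lE _] := least_ex (P := [set k | recurs x0 k p]) hk1; exists l.
  have hl' : recurs x0 l p by move: hl; rewrite /preperiod hp => /least_some[].
  have dom := recurs_dom p1 hl'; have cyc := cyclic_preperiod hp hl'.
  (* If no neighbourhood works, points with another preperiod and nonempty slice accumulate at [x0];
     they force every angle into the slice of [x0], against [nT]. *)
  apply: contrapT => nV; apply: nT; apply/seteqP; split=> // g gT.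
  rewrite (slice_iter _ _ _ (dom l)).
  apply: (slice_approximation hA cyc gT) => N W nW.
  pose V := [set x | [/\ sg_iter_dom S l x, W (iter l (sg_map S) x) &
    preperiod x <> Some l -> forall j k, (j < N)%N -> (k < N)%N ->
      iter (j * p) (sg_map S) (iter l (sg_map S) x) = iter (k * p) (sg_map S) (iter l
        (sg_map S) x) ->
      j = k]].
  have nVx : nbhs x0 V.
    apply: filterS3 (near_iter_dom (dom l)) (iter_continuous (dom l) nW)
      (near_walk_injective N hp hl).
    by move=> x.
  have [x [Vx lx [h Yh]]] : exists x, [/\ V x, preperiod x <> preperiod x0 & exists h,
    xsection Y x h].
    apply: contrapT => nx; apply: nV; exists V; split=> // x Vx lx.
    by apply/seteqP; split=> // h Yh; apply: nx; exists x; split=> //; exists h.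
  have [Ux Wx inj] := Vx; rewrite hl in lx.
  exists (iter l (sg_map S) x), h; split=> //; first by rewrite -(slice_iter _ _ _ Ux).
  (* The walk is injective, so only [j = k] remains, where the product is a squared modulus whatever
     the angle [h] is. *)
  move=> j k jN kN e; rewrite (inj lx j k jN kN e).
  by rewrite -rn_sqr /= sqr_ge0.
Qed.
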